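(* (i) Let $M$ be a simply connected, four-dimensional smooth manifold, and let $g_1$ and $g_2$ be two independent semi-Riemannian metrics on $M$, both parallel with respect to a linear connection $\nabla$ on $M$. Then $\nabla$ has reducible holonomy. (ii) Let $M$ be a connected, four-dimensional smooth manifold, and let $g_1$, $g_2$ and $g_3$ be three independent semi-Riemannian metrics on $M$, all parallel with respect to a linear connection $\nabla$ on $M$. Then $\nabla$ has reducible holonomy.
   Context: Simply connected includes connected. A linear connection is a connection on the tangent bundle; it is not assumed to be symmetric (torsion-free). A semi-Riemannian metric on $M$ is a smooth symmetric nondegenerate $(0,2)$-tensor field (of constant signature); it is parallel with respect to $\nabla$ if $\nabla g=0$. Metrics are independent if they are linearly independent over $\mathbb{R}$ as tensor fields on $M$. The holonomy group $\Psi(x)\subseteq \mathrm{Aut}(T_xM)$ of $\nabla$ at $x\in M$ is the group of parallel translations around all piecewise smooth loops based at $x$. The connection $\nabla$ has reducible holonomy if, for some (equivalently every) $x\in M$, there is a $\Psi(x)$-invariant real subspace of $T_xM$ different from $0$ and $T_xM$. *)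

(* Defs.v *)
From mathcomp Require Import all_boot all_order all_algebra.
From mathcomp Require Import all_classical all_reals all_analysis.

Set Implicit Arguments.
Unset Strict Implicit.
Unset Printing Implicit Defensive.

Import Order.TTheory GRing.Theory Num.Theory.
Import numFieldNormedType.Exports.

Local Open Scope classical_set_scope.
Local Open Scope ring_scope.

Section Smooth.
Context {R : realType} {V W : normedModType R}.

(* On an open subset D of a finite-dimensional V this is the usual C^k: all
   directional derivatives 'D_v f exist and are C^(k-1). *)
Fixpoint Ck_on (k : nat) (D : set V) (f : V -> W) : Prop :=
  match k with
  | 0 => forall x, D x -> {for x, continuous f}
  | k'.+1 => (forall x, D x -> differentiable f x) /\
             (forall v, Ck_on k' D (fun x => 'D_v f x))
  end.

Definition smooth_on (D : set V) (f : V -> W) := forall k, Ck_on k D f.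

End Smooth.

(* The charts are the maps [phi i] on [dom i], with local inverses [psi i]; the
   values of [phi i] off [dom i] and of [psi i] off [phi i @` dom i] are
   irrelevant.  [chart_at] selects a chart around each point; it only serves to
   represent tangent vectors, see [components] below. *)
Record smooth_manifold (R : realType) (n : nat) := SmoothManifold {
  carrier :> topologicalType;
  manifold_hausdorff : hausdorff_space carrier;
  manifold_second_countable : @second_countable carrier;
  chart : Type;
  dom : chart -> set carrier;
  phi : chart -> carrier -> 'rV[R]_n;
  psi : chart -> 'rV[R]_n -> carrier;
  chart_at : carrier -> chart;
  dom_chart_at : forall x, dom (chart_at x) x;
  dom_open : forall i, open (dom i);
  img_open : forall i, open (phi i @` dom i);
  phiK : forall i x, dom i x -> psi i (phi i x) = x;
  phi_continuous : forall i x, dom i x -> {for x, continuous (phi i)};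
  psi_continuous : forall i p,
    (phi i @` dom i) p -> {for p, continuous (psi i)};
  transition_smooth : forall i j,
    smooth_on (phi i @` (dom i `&` dom j)) (phi j \o psi i)
}.

Section Manifold.
Context {R : realType} {n : nat} (M : smooth_manifold R n).
Implicit Types (x : M) (i j : chart M) (U : set M).

Definition loop_at x (c : R -> M) :=
  [/\ {within `[0, 1], continuous c}, c 0 = x & c 1 = x].

Definition null_homotopic x (c : R -> M) := exists H : R * R -> M,
  [/\ {within `[0, 1] `*` `[0, 1], continuous H},
      forall t, t \in `[0, 1] -> H (0, t) = c t,
      forall t, t \in `[0, 1] -> H (1, t) = x &
      forall s, s \in `[0, 1] -> H (s, 0) = x /\ H (s, 1) = x].

Definition simply_connected :=
  connected [set: M] /\ forall x c, loop_at x c -> null_homotopic x c.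

(* A tangent vector at x is represented by its components (a row vector) in the
   chart [chart_at x].  [jac i j x] is the Jacobian matrix at x of the change
   from chart i to chart j; it acts on row vectors from the right, and
   [components i x v] are the components in chart i of v tangent at x. *)
Definition jac i j x : 'M[R]_n := 'J (phi j \o psi i) (phi i x).

Definition components i x (v : 'rV[R]_n) : 'rV[R]_n :=
  v *m jac (chart_at x) i x.

Definition smooth_fun_on U (f : M -> R) := forall i,
  smooth_on (phi i @` (U `&` dom i)) (f \o psi i).

(* the derivative v(f) of f along v tangent at x *)
Definition dirder x (v : 'rV[R]_n) (f : M -> R) : R :=
  'D_v (f \o psi (chart_at x)) (phi (chart_at x) x).

Definition vector_field := M -> 'rV[R]_n.

Definition smooth_field_on U (X : vector_field) := forall i,
  smooth_on (phi i @` (U `&` dom i))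
            (fun p => components i (psi i p) (X (psi i p))).

(* the a-th coordinate vector field of chart i, on [dom i] *)
Definition coord_field i (a : 'I_n) : vector_field :=
  fun x => delta_mx 0 a *m jac i (chart_at x) x.

(* A (0,2)-tensor field is given at x by its matrix in the chart [chart_at x]. *)
Definition tensor02 := M -> 'M[R]_n.

Definition teval (g : tensor02) x (v w : 'rV[R]_n) : R :=
  (v *m g x *m w^T) 0 0.

Definition smooth_tensor (g : tensor02) := forall i (a b : 'I_n),
  smooth_fun_on (dom i)
    (fun x => teval g x (coord_field i a x) (coord_field i b x)).

(* A has q negative and n - q positive squares in a suitable basis. *)
Definition has_index (A : 'M[R]_n) (q : nat) := exists2 P : 'M[R]_n,
  P \in unitmx & P *m A *m P^T = diag_mx (\row_(j < n) (-1) ^+ (j < q)%N).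

Record semi_riemannian (g : tensor02) : Prop := SemiRiemannian {
  metric_smooth : smooth_tensor g;
  metric_symmetric : forall x v w, teval g x v w = teval g x w v;
  metric_nondegenerate : forall x v,
    (forall w, teval g x v w = 0) -> v = 0;
  metric_signature : exists2 q, (q <= n)%N & forall x, has_index (g x) q
}.

Definition independent k (g : 'I_k -> tensor02) := forall a : 'I_k -> R,
  (forall x, \sum_(l < k) a l *: g l x = 0) -> forall l, a l = 0.

(* Covariant derivatives of vector fields that need only be smooth on some open
   set U: [nabla X Y] is constrained on U as soon as X and Y are smooth on U,
   and there it depends only on X and Y on U ([nabla_local]).  Its values
   elsewhere are irrelevant.  No symmetry is imposed. *)
Record linear_connection := LinearConnection {
  nabla :> vector_field -> vector_field -> vector_field;
  nabla_smooth : forall U X Y, open U ->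
    smooth_field_on U X -> smooth_field_on U Y -> smooth_field_on U (nabla X Y);
  nabla_local : forall U X X' Y Y', open U ->
    smooth_field_on U X -> smooth_field_on U Y ->
    (forall x, U x -> X x = X' x) -> (forall x, U x -> Y x = Y' x) ->
    forall x, U x -> nabla X Y x = nabla X' Y' x;
  nablaDl : forall U X X' Y, open U ->
    smooth_field_on U X -> smooth_field_on U X' -> smooth_field_on U Y ->
    forall x, U x ->
    nabla (fun y => X y + X' y) Y x = nabla X Y x + nabla X' Y x;
  nablaZl : forall U f X Y, open U ->
    smooth_fun_on U f -> smooth_field_on U X -> smooth_field_on U Y ->
    forall x, U x -> nabla (fun y => f y *: X y) Y x = f x *: nabla X Y x;
  nablaDr : forall U X Y Y', open U ->
    smooth_field_on U X -> smooth_field_on U Y -> smooth_field_on U Y' ->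
    forall x, U x ->
    nabla X (fun y => Y y + Y' y) x = nabla X Y x + nabla X Y' x;
  nabla_leibniz : forall U f X Y, open U ->
    smooth_fun_on U f -> smooth_field_on U X -> smooth_field_on U Y ->
    forall x, U x -> nabla X (fun y => f y *: Y y) x =
                     dirder x (X x) f *: Y x + f x *: nabla X Y x
}.

Implicit Types (D : linear_connection) (c : R -> M) (V : R -> 'rV[R]_n).

(* (nabla_X g)(Y, Z) = X(g(Y, Z)) - g(nabla_X Y, Z) - g(Y, nabla_X Z) = 0 *)
Definition parallel_metric D (g : tensor02) := forall U X Y Z, open U ->
  smooth_field_on U X -> smooth_field_on U Y -> smooth_field_on U Z ->
  forall x, U x ->
  dirder x (X x) (fun y => teval g y (Y y) (Z y)) =
  teval g x (D X Y x) (Z x) + teval g x (Y x) (D X Z x).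

(* the row vector (Gamma^k_ab)_k of connection coefficients in chart i *)
Definition christoffel D i (a b : 'I_n) x : 'rV[R]_n :=
  components i x (D (coord_field i a) (coord_field i b) x).

Definition smooth_curve (J : set R) c :=
  (forall t, J t -> {for t, continuous c}) /\
  forall i, smooth_on (J `&` c @^-1` dom i) (phi i \o c).

(* V t is tangent at c t, and in each chart
   dV^k/dt + Gamma^k_ab (dc^a/dt) V^b = 0. *)
Definition parallel_field D (J : set R) c V := forall i t, J t -> dom i (c t) ->
  is_derive t (1 : R) (fun s => components i (c s) (V s))
    (- \sum_(a < n) \sum_(b < n)
        ('D_1 (phi i \o c) t 0 a * components i (c t) (V t) 0 b)
          *: christoffel D i a b (c t)).

(* On a closed interval, smooth means: extends smoothly to an open one. *)
Definition smooth_arc c (a b : R) := exists (e : R) c1,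
  [/\ 0 < e, smooth_curve `]a - e, b + e[ c1
    & forall t, t \in `[a, b] -> c t = c1 t].

Definition parallel_arc D c V (a b : R) := exists (e : R) c1 V1,
  [/\ 0 < e, smooth_curve `]a - e, b + e[ c1,
      parallel_field D `]a - e, b + e[ c1 V1
    & forall t, t \in `[a, b] -> c t = c1 t /\ V t = V1 t].

(* Q a b for all consecutive points a < b of some subdivision of [0, 1] *)
Definition piecewise (Q : R -> R -> Prop) := exists s : seq R,
  [/\ path <%R 0 s, last 0 s = 1
    & forall k, (k < size s)%N -> Q (nth 0 (0 :: s) k) (nth 0 s k)].

Definition piecewise_smooth_loop x c :=
  [/\ piecewise (smooth_arc c), c 0 = x & c 1 = x].

(* As parallel fields are unique and exist for every initial vector, P is the
   matrix of the parallel translation around c. *)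
Definition parallel_translation D c (P : 'M[R]_n) := forall v : 'rV[R]_n,
  exists V, [/\ piecewise (parallel_arc D c V), V 0 = v & V 1 = v *m P].

Definition holonomy_group D x : set 'M[R]_n :=
  [set P | exists2 c, piecewise_smooth_loop x c & parallel_translation D c P].

(* Subspaces of the tangent space at x are row spaces of matrices W. *)
Definition reducible_holonomy D := exists x (W : 'M[R]_n),
  (0 < \rank W < n)%N /\ forall P, holonomy_group D x P -> stablemx W P.

End Manifold.

Arguments linear_connection {R n} M.
Arguments tensor02 {R n} M.
Arguments simply_connected {R n} M.

(* Main.v *)
Require Import Defs.
From mathcomp Require Import all_boot all_order all_algebra.
From mathcomp Require Import all_classical all_reals all_analysis.
From mathcomp Require Import ring lra.
From mathcomp Require complex.

(* If the holonomy H at some point is irreducible, every endomorphism commuting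
   with H is zero or invertible, so that A = g2 g1^-1 is either a scalar or
   a + b J with J^2 = -1.  The traces of A and A^2 are constant on M because A is
   parallel; hence a linear relation between the metrics at one point would hold
   everywhere, and independence makes A a + b J with constant a and b.

   (i) J is self-adjoint, so g1 is the real part of a J-complex quadratic form on
   a J-complex plane, and so(2, C) contains exactly two E with E^2 = -1, namely
   E and -E.  Parallel translation preserves the pair {E, -E}, which is a double
   covering of M; as M is simply connected, parallel translation around a loop
   fixes E.  Then EJ commutes with H, (EJ)^2 = 1 and EJ is not a scalar, since it
   is skew: its eigenspaces (they are the null lines of the complex form) are
   invariant, a contradiction.

   (ii) A second endomorphism g3 g1^-1 yields J' with J'^2 = -1 and JJ' = -J'J.
   An isometry commuting with these quaternions lies in SO*(2) = U(1), hence
   commutes with a skew E, E^2 = -1, that also commutes with J and J'; now the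
   eigenspaces of JE are invariant. *)

(** Three obstacles shape the proof. Tensors, vectors and endomorphisms at [x] are stored in the
    chart [chart_at x], which may jump from point to point; continuity and derivatives are therefore
    those of matrices moved to one fixed chart, while traces of endomorphisms and products
    [F *m T *m F^T] do not depend on the chart. Parallel translation is given only through fields
    along a curve. Those of a holonomy element assemble into a frame [F], along which a parallel [T]
    has constant [F *m T *m F^T]. Constancy over all of M is obtained for traces, whose derivatives
    along coordinate segments are traces of commutators. Finally, the double covering {E, -E} is
    represented not by a space but by an arbitrary choice of E at every point, with Boolean signs
    comparing nearby choices; lifting a homotopy becomes gluing sign functions over rectangles.
    Complex and quaternionic algebra is done with real 4x4 matrices, in bases adapted to J or to I
    and J. *)

Set Implicit Arguments.
Unset Strict Implicit.
Unset Printing Implicit Defensive.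

Import Order.TTheory GRing.Theory Num.Theory.
Import numFieldNormedType.Exports.

Local Open Scope classical_set_scope.
Local Open Scope ring_scope.

(** * Smooth functions *)

Section Smooth_calculus.
Context {R : realType} {V : normedModType R}.

Lemma near_derive_eq (W : normedModType R) (D : set V) (f g : V -> W) x v :
  open D -> D x -> (forall y, D y -> f y = g y) -> 'D_v f x = 'D_v g x.
Proof.
move=> oD Dx fg; apply: near_eq_derive.
by near=> y; apply: fg; near: y; exact: open_nbhs_nbhs.
Unshelve. all: by end_near. Qed.

(** The case of a vanishing germ; invariance of differentiability under local equality follows from
    it through [g = f + (g - f)]. *)
Lemma near0_differentiable (W : normedModType R) (h : V -> W) x :
  (\near x, h x = 0) -> differentiable h x.
Proof.
move=> h0; have hx : h x = 0 by exact: nbhs_singleton h0.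
have E : h \o shift x = cst (h x) + (\0 : {linear V -> W}) +o_ 0 id.
  apply/eqaddoP => _/posnumP[e]; rewrite near_simpl.
  have : \forall y \near (0 : V), h (y + x) = 0.
    by move: h0; rewrite (near_shift 0) /= subr0.
  apply: filterS => y /= hy; rewrite hx.
  have -> : (h \o shift x - (cst 0 + \0)) y = 0 by rewrite !fctE /= hy !addr0 subrr.
  by rewrite normr0 mulr_ge0.
have c0 : continuous (\0 : {linear V -> W}) by move=> y; exact: cvg_cst.
by apply/diff_locallyP; rewrite (diff_unique c0 E).
Qed.

Lemma near_differentiable (W : normedModType R) (f g : V -> W) x :
  (\near x, f x = g x) -> differentiable f x -> differentiable g x.
Proof.
move=> fg df; have -> : g = f + (g - f) by rewrite addrC subrK.
apply: differentiableD => //; apply: near0_differentiable.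
by apply: filterS fg => y; rewrite !fctE => ->; rewrite subrr.
Qed.

(** As [D] is open, functions equal on [D] have equal germs there, hence equal derivatives of all
    orders. *)
Lemma Ck_on_eq (W : normedModType R) k (D : set V) (f g : V -> W) :
  open D -> (forall x, D x -> f x = g x) -> Ck_on k D f -> Ck_on k D g.
Proof.
move=> oD; elim: k f g => [|k IH] f g fg /=.
  move=> cf x Dx; move: (cf x Dx); rewrite /prop_for /continuous_at -(fg _ Dx).
  apply: cvg_trans; apply: near_eq_cvg.
  by near=> y; rewrite fg //; near: y; exact: open_nbhs_nbhs.
move=> [df Df]; split=> [x Dx|v].
  apply: near_differentiable (df x Dx).
  by near=> y; apply: fg; near: y; exact: open_nbhs_nbhs.
apply: IH (Df v) => x Dx; exact: near_derive_eq fg.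
Unshelve. all: by end_near. Qed.

Lemma Ck_onS (W : normedModType R) k (D : set V) (f : V -> W) :
  Ck_on k.+1 D f -> Ck_on k D f.
Proof.
elim: k f => [|k IH] f [h1 h2] /=.
  by move=> x /h1; exact: differentiable_continuous.
by split=> // v; exact: IH.
Qed.

Lemma Ck_on_cst (W : normedModType R) k (D : set V) (a : W) : Ck_on k D (cst a).
Proof.
elim: k a => [|k IH] a /=; first by move=> x _; exact: cvg_cst.
split=> [x _|v]; first exact: differentiable_cst.
by rewrite (_ : (fun _ => _) = cst 0) //; apply/funext => x; rewrite derive_cst.
Qed.

Lemma Ck_onD (W : normedModType R) k (D : set V) (f g : V -> W) : open D ->
  Ck_on k D f -> Ck_on k D g -> Ck_on k D (fun x => f x + g x).
Proof.
move=> oD; elim: k f g => [|k IH] f g /=.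
  by move=> cf cg x Dx; apply: cvgD; [exact: cf|exact: cg].
move=> [df Df] [dg Dg]; split=> [x Dx|v].
  by apply: differentiableD; [exact: df|exact: dg].
apply: Ck_on_eq (IH _ _ (Df v) (Dg v)) => // x Dx.
by rewrite deriveD //; apply: diff_derivable; [exact: df|exact: dg].
Qed.

Lemma Ck_on_sum (W : normedModType R) k (D : set V) n (f : 'I_n -> V -> W) :
  open D -> (forall i, Ck_on k D (f i)) -> Ck_on k D (fun x => \sum_(i < n) f i x).
Proof.
move=> oD; elim: n f => [|n IH] f hf.
  apply: Ck_on_eq (Ck_on_cst k D 0) => // x _; by rewrite big_ord0.
apply: Ck_on_eq (Ck_onD oD (hf ord0) (IH _ (fun i => hf (lift ord0 i)))) => // x _.
by rewrite big_ord_recl.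
Qed.

Lemma Ck_onM k (D : set V) (f g : V -> R) : open D ->
  Ck_on k D f -> Ck_on k D g -> Ck_on k D (fun x => f x * g x).
Proof.
move=> oD; elim: k f g => [|k IH] f g.
  by move=> cf cg x Dx; apply: cvgM; [exact: cf|exact: cg].
move=> hf hg; have [df Df] := hf; have [dg Dg] := hg; split=> [x Dx|v].
  by apply: differentiableM; [exact: df|exact: dg].
have h1 := IH _ _ (Ck_onS hf) (Dg v); have h2 := IH _ _ (Ck_onS hg) (Df v).
apply: Ck_on_eq (Ck_onD oD h1 h2) => // x Dx.
by rewrite deriveM //; apply: diff_derivable; [exact: df|exact: dg].
Qed.

Lemma Ck_onZl (W : normedModType R) k (D : set V) (f : V -> R) (w : W) : open D ->
  Ck_on k D f -> Ck_on k D (fun x => f x *: w).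
Proof.
move=> oD; elim: k f => [|k IH] f /=.
  by move=> cf x Dx; apply: cvgZr_tmp; exact: cf.
move=> [df Df]; split=> [x Dx|v]; first exact/differentiableZl/df.
apply: Ck_on_eq (IH _ (Df v)) => // x Dx.
rewrite !deriveE; [|exact/differentiableZl/df|exact: df].
by rewrite diffZl //; exact: df.
Qed.

Lemma Ck_on_coord n k (D : set V) (f : V -> 'rV[R]_n) j : open D ->
  Ck_on k D f -> Ck_on k D (fun x => f x 0 j).
Proof.
move=> oD; elim: k f => [|k IH] f /=.
  move=> cf x /cf fx.
  by apply: (cvg_comp f (fun N : 'rV[R]_n => N 0 j) fx); exact: coord_continuous.
move=> [df Df]; split=> [x Dx|v].
  by apply: (@differentiable_comp _ _ _ _ f (fun N : 'rV[R]_n => N 0 j)); [exact: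
    df|exact: differentiable_coord].
apply: Ck_on_eq (IH _ (Df v)) => // x Dx.
by rewrite derive_mx ?mxE //; apply/diff_derivable/df.
Qed.

Lemma Ck_on_row n k (D : set V) (f : V -> 'rV[R]_n) : open D ->
  (forall j, Ck_on k D (fun x => f x 0 j)) -> Ck_on k D f.
Proof.
move=> oD hf; apply: Ck_on_eq (Ck_on_sum oD (fun j => Ck_onZl (delta_mx 0 j) oD (hf j)))
  => // x _.
by rewrite -row_sum_delta.
Qed.

End Smooth_calculus.

Lemma derive_chain (R : realType) (U V W : normedModType R) (h : U -> V)
    (f : V -> W) x v : differentiable h x -> differentiable f (h x) ->
  'D_v (f \o h) x = 'D_('D_v h x) f (h x).
Proof.
move=> dh df; rewrite deriveE; last exact: differentiable_comp.
by rewrite (diff_comp dh df) /= -(deriveE _ dh) -(deriveE _ df).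
Qed.

Section Smooth_comp.
Context {R : realType} {V : normedModType R} {m : nat}.

Lemma derive_delta (f : 'rV[R]_m -> R) p v : differentiable f p ->
  'D_v f p = \sum_(b < m) v 0 b * 'D_(delta_mx 0 b) f p.
Proof.
move=> df; rewrite {1}(row_sum_delta v) deriveE // linear_sum.
by apply: eq_bigr => b _; rewrite linearZ /= deriveE.
Qed.

Lemma derive_comp (f : 'rV[R]_m -> R) (h : V -> 'rV[R]_m) x v :
  differentiable h x -> differentiable f (h x) ->
  'D_v (f \o h) x = \sum_(b < m) 'D_v h x 0 b * 'D_(delta_mx 0 b) f (h x).
Proof.
by move=> dh df; rewrite derive_chain // derive_delta.
Qed.

(** The chain rule replaces [f] by its partial derivatives and keeps [h], so the induction varies
    [f] only. *)
Lemma Ck_on_comp k (D : set V) (E : set 'rV[R]_m) (f : 'rV[R]_m -> R)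
    (h : V -> 'rV[R]_m) : open D -> h @` D `<=` E ->
  Ck_on k E f -> Ck_on k D h -> Ck_on k D (f \o h).
Proof.
move=> oD DE; have hE x : D x -> E (h x) by move=> Dx; apply: DE; exists x.
elim: k f => [|k IH] f.
  move=> cf ch x Dx; apply: continuous_comp; [exact: ch|exact/cf/hE].
move=> [df Df] hh; have [dh Dh] := hh; split=> [x Dx|v].
  by apply: differentiable_comp; [exact: dh|exact/df/hE].
apply: Ck_on_eq (Ck_on_sum oD (fun b => Ck_onM oD (Ck_on_coord b oD (Dh v))
   (IH _ (Df (delta_mx 0 b)) (Ck_onS hh)))) => // x Dx.
by rewrite [RHS]derive_comp //; [exact: dh|exact/df/hE].
Qed.

End Smooth_comp.

(** * Charts *)

Section Charts.
Context {R : realType} {n : nat} (M : smooth_manifold R n).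
Implicit Types (x : M) (i j k : chart M) (U : set M).

Lemma near_chart i x U : open U -> U x -> dom i x ->
  \forall p \near phi i x, (phi i @` (U `&` dom i)) p.
Proof.
move=> oU Ux ix; near=> p.
have [y iy yp] : (phi i @` dom i) p.
  by near: p; apply: open_nbhs_nbhs; split; [exact: img_open|exists x].
exists y => //; split=> //; rewrite -(phiK iy) yp; near: p.
apply: (@psi_continuous _ _ M i (phi i x)); first by exists x.
by rewrite phiK //; exact: open_nbhs_nbhs.
Unshelve. all: by end_near. Qed.

Lemma chart_image_open i U : open U -> open (phi i @` (U `&` dom i)).
Proof.
by move=> oU; rewrite openE => _ [x [Ux ix] <-]; exact: near_chart.
Qed.

Lemma transition_image_open i j : open (phi i @` (dom i `&` dom j)).
Proof. by rewrite setIC; apply: chart_image_open; exact: dom_open. Qed.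

Arguments transition_image_open : clear implicits.

Lemma transition_differentiable i j x : dom i x -> dom j x ->
  differentiable (phi j \o psi i) (phi i x).
Proof.
by move=> ix jx; have [+ _] := transition_smooth i j 1; apply; exists x.
Qed.

Lemma mul_jac i j x v : dom i x -> dom j x ->
  v *m jac i j x = 'D_v (phi j \o psi i) (phi i x).
Proof. by move=> ix jx; rewrite -derivemxE //; exact: transition_differentiable. Qed.

Lemma jac_comp i j k x : dom i x -> dom j x -> dom k x ->
  jac i j x *m jac j k x = jac i k x.
Proof.
move=> ix jx kx; apply/row_matrixP => a; rewrite !rowE mulmxA.
set v := delta_mx 0 a; rewrite [RHS]mul_jac // mul_jac //.
have -> : 'D_v (phi k \o psi i) (phi i x) =
    'D_v ((phi k \o psi j) \o (phi j \o psi i)) (phi i x).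
  apply: (near_derive_eq _ (transition_image_open i j)); first by exists x.
  by move=> _ [y [iy jy] <-] /=; rewrite !phiK.
have d1 := transition_differentiable ix jx.
have e : (phi j \o psi i) (phi i x) = phi j x by rewrite /= phiK.
have d2 : differentiable (phi k \o psi j) ((phi j \o psi i) (phi i x)).
  by rewrite e; exact: transition_differentiable.
by rewrite (derive_chain v d1 d2) e (mul_jac v ix jx).
Qed.

Lemma jac_id i x : dom i x -> jac i i x = 1%:M.
Proof.
move=> ix; apply/row_matrixP => a; rewrite !rowE mul_jac // mulmx1.
rewrite -[RHS](@derive_id _ _ (phi i x)).
apply: (near_derive_eq _ (transition_image_open i i)); first by exists x.
by move=> _ [y [iy _] <-] /=; rewrite phiK.
Qed.

Lemma jacK i j x : dom i x -> dom j x -> jac i j x *m jac j i x = 1%:M.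
Proof. by move=> ix jx; rewrite jac_comp // jac_id. Qed.

Lemma dirder_chart i x (v : 'rV[R]_n) (f : M -> R) : dom i x ->
  differentiable (f \o psi i) (phi i x) ->
  dirder x (v *m jac i (chart_at x) x) f = 'D_v (f \o psi i) (phi i x).
Proof.
move=> ix df; rewrite /dirder; have cx := dom_chart_at x.
set c := chart_at x in cx *; set w := v *m _.
have -> : 'D_w (f \o psi c) (phi c x) =
    'D_w ((f \o psi i) \o (phi i \o psi c)) (phi c x).
  apply: (near_derive_eq _ (transition_image_open c i)); first by exists x.
  by move=> _ [y [cy iy] <-] /=; rewrite !phiK.
have d1 := transition_differentiable cx ix.
have e : (phi i \o psi c) (phi c x) = phi i x by rewrite /= phiK.
have d2 : differentiable (f \o psi i) ((phi i \o psi c) (phi c x)) by rewrite e.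
by rewrite (derive_chain w d1 d2) e -mul_jac // -mulmxA jacK // mulmx1.
Qed.

Lemma coord_field_smooth i a : smooth_field_on (dom i) (coord_field (M := M) i a).
Proof.
move=> j k; pose D := phi j @` (dom i `&` dom j).
have oD : open D by apply: chart_image_open; exact: dom_open.
apply: (@Ck_on_eq _ _ _ _ _
  (fun p => 'D_(delta_mx 0 a) (phi j \o psi i) ((phi i \o psi j) p))) => //.
  move=> _ [x [ix jx] <-] /=; rewrite (phiK jx) -(mul_jac _ ix jx).
  rewrite /components /coord_field -mulmxA.
  by rewrite (jac_comp ix (dom_chart_at x) jx).
apply: Ck_on_row => // b.
have hD p : (phi i @` (dom i `&` dom j)) p ->
    'D_(delta_mx 0 a) (fun q => (phi j \o psi i) q 0 b) p =
    'D_(delta_mx 0 a) (phi j \o psi i) p 0 b.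
  move=> [x [ix jx] <-]; rewrite [in RHS]derive_mx ?mxE //.
  exact/diff_derivable/transition_differentiable.
have oE := transition_image_open i j.
(* The Jacobian costs one derivative, hence the order [k.+1] for the transition map. *)
have [_ Df] := Ck_on_coord b oE (transition_smooth i j k.+1).
have sD : (phi i \o psi j) @` D `<=` phi i @` (dom i `&` dom j).
  by move=> _ [_ [x [ix jx] <-] <-]; exists x => //=; rewrite phiK.
have T : Ck_on k D (phi i \o psi j).
  by have := transition_smooth j i k; rewrite setIC.
apply: Ck_on_eq (Ck_on_comp oD sD (Df (delta_mx 0 a)) T) => // p Dp /=.
by apply: hD; apply: sD; exists p.
Qed.

End Charts.

Lemma mulmx_congruence (R : comNzRingType) m n (V W : 'M[R]_(m, n))
    (C C' T : 'M[R]_n) : C' *m C = 1%:M ->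
  (V *m C') *m (C *m T *m C^T) *m (W *m C')^T = V *m T *m W^T.
Proof.
move=> K; rewrite trmx_mul !mulmxA -(mulmxA V) K mulmx1 -!mulmxA.
by rewrite (mulmxA C^T) -trmx_mul K trmx1 mul1mx.
Qed.

(** * Tensors and the connection in a fixed chart *)

Section Tensors.
Context {R : realType} {n : nat} (M : smooth_manifold R n).
Implicit Types (x : M) (i j k : chart M) (T : tensor02 M).

(** The matrices [T x] may jump with [chart_at x]; these refer to one chart and can be
    differentiated. *)
Definition chart_tensor T i x : 'M[R]_n :=
  jac i (chart_at x) x *m T x *m (jac i (chart_at x) x)^T.

Lemma teval_mul T x m (V W : 'M[R]_(m, n)) p q :
  teval T x (row p V) (row q W) = (V *m T x *m W^T) p q.
Proof. by rewrite /teval -row_mul mxE [RHS]mxE; apply: eq_bigr => k _; rewrite !mxE. Qed.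

Lemma teval_coord T i x a b :
  teval T x (coord_field i a x) (coord_field i b x) = chart_tensor T i x a b.
Proof. by rewrite /coord_field -!rowE teval_mul. Qed.

Lemma chart_tensorE T i x m (V W : 'M[R]_(m, n)) : dom i x ->
  (V *m jac (chart_at x) i x) *m chart_tensor T i x *m (W *m jac (chart_at x) i x)^T
  = V *m T x *m W^T.
Proof.
move=> ix; rewrite /chart_tensor; exact: mulmx_congruence (jacK (dom_chart_at x) ix).
Qed.

(** The connection form of chart [i] evaluated at [v], acting on row vectors from the right. *)
Definition christoffel_mx (D : linear_connection M) i x (v : 'rV[R]_n) : 'M[R]_n :=
  \sum_(c < n) v 0 c *: \matrix_a christoffel D i c a x.

Lemma teval_chart T i x v w : dom i x -> teval T x v w =
  (components i x v *m chart_tensor T i x *m (components i x w)^T) 0 0.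
Proof. by move=> ix; rewrite /components chart_tensorE. Qed.

Lemma components_coord i b x : dom i x ->
  components i x (coord_field i b x) = delta_mx 0 b.
Proof.
by move=> ix; rewrite /components -mulmxA jacK ?mulmx1 //; exact: dom_chart_at.
Qed.

Lemma mul_delta_tr m (u : 'rV[R]_m) (b : 'I_m) :
  (u *m (delta_mx 0 b : 'rV[R]_m)^T) 0 0 = u 0 b.
Proof. by rewrite trmx_delta -colE mxE. Qed.

(* [parallel_metric], read off in a chart on coordinate fields *)
Definition chart_parallel (D : linear_connection M) T := forall i x, dom i x ->
  (forall a b, differentiable (fun p => chart_tensor T i (psi i p) a b) (phi i x)) /\
  forall v a b, 'D_v (fun p => chart_tensor T i (psi i p) a b) (phi i x) =
    (christoffel_mx D i x v *m chart_tensor T i x +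
     chart_tensor T i x *m (christoffel_mx D i x v)^T) a b.

Lemma metric_chart_parallel D T :
  smooth_tensor T -> parallel_metric D T -> chart_parallel D T.
Proof.
move=> sT pT i x ix.
have dT a b : differentiable (fun p => chart_tensor T i (psi i p) a b) (phi i x).
  have [+ _] := sT i a b i 1; rewrite setIid => /(_ (phi i x)) h.
  have {}h := h (ex_intro2 _ _ x ix erefl).
  by rewrite (_ : (fun p => _) = (fun y => teval T y (coord_field i a y) (coord_field i b
    y)) \o psi i) //; apply/funext => p /=; rewrite teval_coord.
split=> // v a b.
have E c : 'D_(delta_mx 0 c) (fun p => chart_tensor T i (psi i p) a b) (phi i x) =
   (\matrix_a christoffel D i c a x *m chart_tensor T i x +
     chart_tensor T i x *m (\matrix_a christoffel D i c a x)^T) a b.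
  have := pT (dom i) (coord_field i c) (coord_field i a) (coord_field i b)
    (dom_open i) (@coord_field_smooth _ _ M i c) (@coord_field_smooth _ _ M i a)
      (@coord_field_smooth _ _ M i b) x ix.
  set f := (fun y => teval T y _ _).
  have ef : f \o psi i = (fun p => chart_tensor T i (psi i p) a b).
    by apply/funext => p /=; rewrite /f teval_coord.
  have df : differentiable (f \o psi i) (phi i x) by rewrite ef; exact: dT.
  rewrite {1}/coord_field (dirder_chart _ ix df) ef => ->.
  rewrite !(teval_chart T _ _ ix) !(components_coord _ ix).
    rewrite -/(christoffel D i c a x) -/(christoffel D i c b x).
    rewrite mul_delta_tr [RHS]mxE; congr (_ + _).
      by rewrite [LHS]mxE [RHS]mxE; apply: eq_bigr => k _; rewrite [in RHS]mxE.
    rewrite -rowE [LHS]mxE [RHS]mxE; apply: eq_bigr => k _.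
    rewrite [row _ _ _ _]mxE; congr (_ * _); by rewrite [LHS]mxE [RHS]mxE [RHS]mxE.
(* Both sides are linear in [v], so the coordinate directions settle the general case. *)
rewrite derive_delta //.
under eq_bigr do rewrite E.
rewrite [RHS]mxE /christoffel_mx linear_sum mulmx_suml mulmx_sumr !summxE -big_split /=.
apply: eq_bigr => c _.
rewrite [X in _ * X]mxE mulrDr; congr (_ + _); first by rewrite -scalemxAl [RHS]mxE.
by rewrite linearZ /= -scalemxAr [RHS]mxE.
Qed.
End Tensors.

(** * Entrywise calculus of matrix functions *)

Section Closure.
Context {R : realType} {T : Type} (P : (T -> R) -> Prop).
Context (Pcst : forall a, P (fun=> a)).
Context (PD : forall f g, P f -> P g -> P (fun x => f x + g x)).
Context (PM : forall f g, P f -> P g -> P (fun x => f x * g x)).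

Lemma closed_sum I (r : seq I) (Q : pred I) (F : I -> T -> R) :
  (forall i, P (F i)) -> P (fun x => \sum_(i <- r | Q i) F i x).
Proof.
move=> PF; elim: r => [|i r IH].
  by rewrite (_ : (fun x => _) = fun=> 0) //; apply/funext => x; rewrite big_nil.
rewrite (_ : (fun x => _) = fun x => (if Q i then F i x else 0) + \sum_(j <- r | Q j) F j
  x).
  by apply: PD => //; case: (Q i).
by apply/funext => x; rewrite big_cons; case: ifP; rewrite ?add0r.
Qed.

Lemma closed_prod I (r : seq I) (F : I -> T -> R) :
  (forall i, P (F i)) -> P (fun x => \prod_(i <- r) F i x).
Proof.
move=> PF; elim: r => [|i r IH].
  by rewrite (_ : (fun x => _) = fun=> 1) //; apply/funext => x; rewrite big_nil.
rewrite (_ : (fun x => _) = fun x => F i x * \prod_(j <- r) F j x); first exact: PM.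
by apply/funext => x; rewrite big_cons.
Qed.

(** Determinants and entries of adjugates are polynomials in the entries. Keeping [P] abstract lets
    the same argument serve for continuity and for derivability. *)
Lemma closed_det n (A : T -> 'M[R]_n) :
  (forall i j, P (fun x => A x i j)) -> P (fun x => \det (A x)).
Proof.
by move=> PA; apply: closed_sum => s; apply: PM => //; exact: closed_prod.
Qed.

Lemma closed_adj n (A : T -> 'M[R]_n) i j :
  (forall i j, P (fun x => A x i j)) -> P (fun x => (\adj (A x)) i j).
Proof.
move=> PA; rewrite (_ : (fun x => _) = fun x => (-1) ^+ (j + i) * \det (row' j (col' i (A
  x)))).
  apply: PM => //; apply: closed_det => a b.
  rewrite (_ : (fun x => _) = fun x => A x (lift j a) (lift i b)) //.
  by apply/funext => x; rewrite !mxE.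
by apply/funext => x; rewrite !mxE.
Qed.

Lemma closed_mulmx m n p (A : T -> 'M[R]_(m, n)) (B : T -> 'M[R]_(n, p)) i j :
  (forall i j, P (fun x => A x i j)) -> (forall i j, P (fun x => B x i j)) ->
  P (fun x => (A x *m B x) i j).
Proof.
move=> PA PB; rewrite (_ : (fun x => _) = fun x => \sum_k A x i k * B x k j).
  by apply: closed_sum => k; exact: PM.
by apply/funext => x; rewrite mxE.
Qed.

Lemma closed_trace n (A : T -> 'M[R]_n) :
  (forall i j, P (fun x => A x i j)) -> P (fun x => \tr (A x)).
Proof. by move=> PA; exact: closed_sum. Qed.

End Closure.

Section Continuity.
Context {R : realType} {T : Type} (F : set_system T) {FF : Filter F} (x0 : T).

(* [x0] need not be the limit of [F] in any topology: this only says that the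
   limit of [f] along [F] is the value at [x0]. *)
Definition cts (f : T -> R) := f x @[x --> F] --> f x0.

Definition mcts m n (A : T -> 'M[R]_(m, n)) := forall i j, cts (fun x => A x i j).

Lemma cts_cst a : cts (fun=> a). Proof. exact: cvg_cst. Qed.

Lemma ctsD f g : cts f -> cts g -> cts (fun x => f x + g x).
Proof. exact: cvgD. Qed.

Lemma ctsM f g : cts f -> cts g -> cts (fun x => f x * g x).
Proof. exact: cvgM. Qed.

Lemma cts_near (f g : T -> R) :
  (\forall x \near F, f x = g x) -> f x0 = g x0 -> cts f -> cts g.
Proof.
move=> fg e cf; rewrite /cts -e; apply: cvg_trans cf; apply: near_eq_cvg.
by apply: filterS fg.
Qed.

Lemma mcts_near m n (A B : T -> 'M[R]_(m, n)) :
  (\forall x \near F, A x = B x) -> A x0 = B x0 -> mcts A -> mcts B.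
Proof.
move=> AB e cA i j; apply: cts_near (cA i j); last by rewrite e.
by apply: filterS AB => x ->.
Qed.

Lemma cts_near_gt f a : cts f -> a < f x0 -> \forall x \near F, a < f x.
Proof. by move=> cf af; exact: (cvgr_gt _ cf). Qed.

Lemma cts_near_neq0 f : cts f -> f x0 != 0 -> \forall x \near F, f x != 0.
Proof. by move=> cf f0; exact: (cvgr_neq0 _ cf). Qed.

Lemma mcts_cst m n (A : 'M[R]_(m, n)) : mcts (fun=> A).
Proof. by move=> i j; exact: cts_cst. Qed.

Lemma mctsD m n (A B : T -> 'M[R]_(m, n)) : mcts A -> mcts B -> mcts (fun x => A x + B x).
Proof.
move=> cA cB i j; rewrite (_ : (fun x => _) = fun x => A x i j + B x i j).
  exact: ctsD.
by apply/funext => x; rewrite mxE.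
Qed.

Lemma mctsZ m n (f : T -> R) (A : T -> 'M[R]_(m, n)) :
  cts f -> mcts A -> mcts (fun x => f x *: A x).
Proof.
move=> cf cA i j; rewrite (_ : (fun x => _) = fun x => f x * A x i j).
  exact: ctsM.
by apply/funext => x; rewrite mxE.
Qed.

Lemma mcts_tr m n (A : T -> 'M[R]_(m, n)) : mcts A -> mcts (fun x => (A x)^T).
Proof.
move=> cA i j; rewrite (_ : (fun x => _) = fun x => A x j i); first exact: cA.
by apply/funext => x; rewrite mxE.
Qed.

Lemma mctsM m n p (A : T -> 'M[R]_(m, n)) (B : T -> 'M[R]_(n, p)) :
  mcts A -> mcts B -> mcts (fun x => A x *m B x).
Proof.
by move=> cA cB i j; apply: (closed_mulmx cts_cst ctsD ctsM) => ? ?; [exact: cA|exact: cB].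
Qed.

Lemma mcts_trace n (A : T -> 'M[R]_n) : mcts A -> cts (fun x => \tr (A x)).
Proof. by move=> cA; exact: (closed_trace cts_cst ctsD). Qed.

Lemma mcts_inv n (A : T -> 'M[R]_n) : mcts A -> A x0 \in unitmx ->
  mcts (fun x => invmx (A x)).
Proof.
move=> cA uA.
have cd : cts (fun x => \det (A x)) by exact: (closed_det cts_cst ctsD ctsM).
have d0 : \det (A x0) != 0 by rewrite -unitfE -unitmxE.
(* [invmx] is given by Cramer's formula only at invertible matrices; continuity of the determinant
   ensures this near [x0]. *)
apply: (@mcts_near _ _ (fun x => (\det (A x))^-1 *: \adj (A x))).
- near=> x; rewrite /invmx ifT // unitmxE unitfE; near: x.
  exact: cts_near_neq0 cd d0.
- by rewrite /invmx uA.
- apply: mctsZ; first exact: cvgV.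
  by move=> i j; exact: (closed_adj cts_cst ctsD ctsM).
Unshelve. all: by end_near. Qed.

End Continuity.

Section Matrix_derivative.
Context {R : realType}.

Definition mderiv m n (F : R -> 'M[R]_(m, n)) t (F' : 'M[R]_(m, n)) :=
  forall i j, is_derive t (1 : R) (fun s => F s i j) (F' i j).

Lemma mderiv_eq m n (F : R -> 'M[R]_(m, n)) t A B : mderiv F t A -> A = B -> mderiv F t B.
Proof. by move=> h <-. Qed.

Lemma mderiv_near m n (F G : R -> 'M[R]_(m, n)) t A :
  (\forall s \near t, F s = G s) -> mderiv F t A -> mderiv G t A.
Proof.
move=> FG h i j; have := h i j; apply: near_eq_is_derive.
by apply: filterS FG => s ->.
Qed.

Lemma mderiv_cst m n (A : 'M[R]_(m, n)) t : mderiv (fun=> A) t 0.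
Proof. by move=> i j; rewrite mxE; exact: is_derive_cst. Qed.

Lemma mderivM m n p (A : R -> 'M[R]_(m, n)) (B : R -> 'M[R]_(n, p)) t A' B' :
  mderiv A t A' -> mderiv B t B' ->
  mderiv (fun s => A s *m B s) t (A' *m B t + A t *m B').
Proof.
move=> dA dB i j.
rewrite (_ : (fun s => _) = \sum_k ((fun s => A s i k) * (fun s => B s k j))).
  have hk k : is_derive t (1 : R) ((fun s => A s i k) * (fun s => B s k j))
      (A t i k *: B' k j + B t k j *: A' i k).
    by apply: is_deriveM; [exact: dA|exact: dB].
  apply: (is_derive_eq (is_derive_sum hk)).
  rewrite !mxE -big_split /=; apply: eq_bigr => k _.
  by rewrite addrC; congr (_ + _); exact: mulrC.
by apply/funext => s; rewrite mxE fct_sumE.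
Qed.

Lemma mderiv_tr m n (A : R -> 'M[R]_(m, n)) t A' :
  mderiv A t A' -> mderiv (fun s => (A s)^T) t A'^T.
Proof.
move=> dA i j; rewrite mxE (_ : (fun s => _) = fun s => A s j i); first exact: dA.
by apply/funext => s; rewrite mxE.
Qed.

Lemma mderiv_trace n (A : R -> 'M[R]_n) t A' :
  mderiv A t A' -> is_derive t (1 : R) (fun s => \tr (A s)) (\tr A').
Proof.
move=> dA; rewrite (_ : (fun s => _) = \sum_k (fun s => A s k k)).
  by apply: is_derive_sum => k; exact: dA.
by apply/funext => s; rewrite fct_sumE.
Qed.

(** Cramer's formula gives derivability; the value then comes from differentiating
    [G s *m invmx (G s) = 1%:M]. *)
Lemma mderiv_inv n (G : R -> 'M[R]_n) t G' : mderiv G t G' -> G t \in unitmx ->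
  mderiv (fun s => invmx (G s)) t (- (invmx (G t) *m G' *m invmx (G t))).
Proof.
move=> dG uG.
pose P (f : R -> R) := derivable f t 1.
have Pc a : P (fun=> a) by exact: derivable_cst.
have PD f g : P f -> P g -> P (fun x => f x + g x) by exact: derivableD.
have PM f g : P f -> P g -> P (fun x => f x * g x) by exact: derivableM.
have PG i j : P (fun x => G x i j) by have [] := dG i j.
have Pdet : P (fun x => \det (G x)) by exact: closed_det.
have cdet : \det (G x) @[x --> t] --> \det (G t).
  have /derivable1_diffP d : derivable (fun x => \det (G x)) t 1 by exact: Pdet.
  exact: (differentiable_continuous d).
have det0 : \det (G t) != 0 by rewrite -unitfE -unitmxE.
have unear : \forall s \near t, G s \in unitmx.
  by near=> s; rewrite unitmxE unitfE; near: s; exact: (cvgr_neq0 _ cdet).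
have PI i j : P (fun x => invmx (G x) i j).
  apply: (@near_eq_derivable _ _ _ (fun x => (\det (G x))^-1 * (\adj (G x)) i j)).
    by apply: filterS unear => s us; rewrite /invmx us [RHS]mxE.
  apply: (PM (fun x => (\det (G x))^-1) (fun x => (\adj (G x)) i j)).
    exact: derivableV.
  exact (closed_adj Pc PD PM i j PG).
pose I' := \matrix_(i, j) 'D_1 (fun x => invmx (G x) i j) t.
have dI : mderiv (fun s => invmx (G s)) t I'.
  move=> i j; rewrite [X in is_derive _ _ _ X]mxE.
  exact (derivableP (PI i j)).
have := mderivM dG dI.
have : mderiv (fun s => G s *m invmx (G s)) t 0.
  apply: mderiv_near (mderiv_cst 1%:M t).
  by apply: filterS unear => s us; rewrite mulmxV.
move=> d0 d1.
have E : 0 = G' *m invmx (G t) + G t *m I'.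
  by apply/matrixP => i j; rewrite -(@derive_val _ _ _ _ _ _ _ (d0 i j)) (@derive_val _ _
    _ _ _ _ _ (d1 i j)).
apply: mderiv_eq dI _.
have : invmx (G t) *m (G' *m invmx (G t) + G t *m I') = 0 by rewrite -E mulmx0.
by rewrite mulmxDr !mulmxA mulVmx // mul1mx addrC => /eqP; rewrite addr_eq0 => /eqP.
Unshelve. all: by end_near. Qed.

End Matrix_derivative.

(** The level set of [f] through [x] is cut out of [A] by an open set, and so is its complement in
    [A]. *)
Lemma connected_locally_constant (X : topologicalType) (T : Type) (A : set X) (f : X -> T) :
  connected A -> (forall x, A x -> \forall y \near x, A y -> f y = f x) ->
  forall x y, A x -> A y -> f x = f y.
Proof.
move=> cA lf x y Ax Ay.
suff E : A `&` [set z | f z = f x] = A.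
  by have [] : (A `&` [set z | f z = f x]) y by rewrite E.
apply: cA; first by exists x.
- exists [set z | A z -> f z = f x]^°; first exact: open_interior.
  apply/seteqP; split=> z [Az h]; split=> //.
    by have := lf z Az; apply: filterS => w hw /hw ->.
  exact: (interior_subset h).
- exists (~` [set z | A z -> f z <> f x]^°).
    by apply: open_closedC; exact: open_interior.
  apply/seteqP; split=> z [Az h]; split=> //.
    by move=> /interior_subset /(_ Az).
  apply: contrapT => nh; apply: h; have := lf z Az.
  by apply: filterS => w hw /hw ->.
Qed.

Section Calculus.
Context {R : realType}.

(** The mean value theorem applies between exceptional points and continuity joins the pieces. The
    exceptional points will be the corners of a loop. *)
Lemma derive0_off_finite (h : R -> R) (s : seq R) a b : a <= b ->
  {within `[a, b], continuous h} ->
  (forall t, t \in `]a, b[ -> t \notin s -> is_derive t (1 : R) h 0) -> h a = h b.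
Proof.
elim: s a b => [|p s IH] a b ab ch dh.
  have [c _] := MVT_segment ab (fun t ht => dh t ht isT) ch.
  by rewrite mul0r => /eqP; rewrite subr_eq0 => /eqP.
have [pab|npab] := boolP (p \in `]a, b[); last first.
  apply: IH => // t tab ts; apply: dh => //; rewrite inE negb_or ts andbT.
  by apply: contraNneq npab => <-.
have [ap pb] : a < p /\ p < b by move: pab; rewrite in_itv /= => /andP[].
have d1 t : t \in `]a, p[ -> t \notin s -> is_derive t (1 : R) h 0.
  rewrite in_itv /= => /andP[t1 t2] ts; apply: dh.
    by rewrite in_itv /= t1 (lt_trans t2).
  by rewrite inE negb_or ts andbT lt_eqF.
have d2 t : t \in `]p, b[ -> t \notin s -> is_derive t (1 : R) h 0.
  rewrite in_itv /= => /andP[t1 t2] ts; apply: dh.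
    by rewrite in_itv /= t2 andbT (lt_trans ap).
  by rewrite inE negb_or ts andbT gt_eqF.
have c1 : {within `[a, p], continuous h}.
  apply: continuous_subspaceW ch => t /=; rewrite !in_itv /= => /andP[-> tp].
  by rewrite (le_trans tp) // ltW.
have c2 : {within `[p, b], continuous h}.
  apply: continuous_subspaceW ch => t /=; rewrite !in_itv /= => /andP[pt ->].
  by rewrite (le_trans _ pt) // ltW.
exact (etrans (IH a p (ltW ap) c1 d1) (IH p b (ltW pb) c2 d2)).
Qed.

End Calculus.

(** * Parallel tensors and parallel translation *)

Section Parallel_tensors.
Context {R : realType} {n : nat} (M : smooth_manifold R n) (D : linear_connection M).
Implicit Types (x : M) (i j k : chart M) (T G : tensor02 M) (c : R -> M).

(** It turns a linear relation between metrics at one point into a parallel tensor with a zero. *)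
Lemma chart_parallel_sum m (T : 'I_m -> tensor02 M) (a : 'I_m -> R) :
  (forall l, chart_parallel D (T l)) ->
  chart_parallel D (fun x => \sum_l a l *: T l x).
Proof.
move=> pT i x ix.
have E y : chart_tensor (fun x => \sum_l a l *: T l x) i y = \sum_l a l *: chart_tensor
  (T l) i y.
  rewrite /chart_tensor mulmx_sumr mulmx_suml; apply: eq_bigr => l _.
  by rewrite -scalemxAr -scalemxAl.
have F b d : (fun p => chart_tensor (fun x => \sum_l a l *: T l x) i (psi i p) b d) =
    \sum_l (a l *: (fun p => chart_tensor (T l) i (psi i p) b d)).
  by apply/funext => p; rewrite E summxE fct_sumE; apply: eq_bigr => l _; rewrite mxE.
have dT l b d : differentiable (fun p => chart_tensor (T l) i (psi i p) b d) (phi i x).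
  by have [] := pT l i x ix.
have dZ b d l : differentiable (a l *: (fun p => chart_tensor (T l) i (psi i p) b d))
  (phi i x).
  exact: differentiableZ.
split=> [b d|v b d]; first by rewrite F; exact: differentiable_sum.
rewrite F derive_sum => [|l]; last exact: diff_derivable.
rewrite E mulmx_sumr mulmx_suml -big_split /= summxE; apply: eq_bigr => l _.
rewrite deriveZ; last exact: diff_derivable.
have [_ ->] := pT l i x ix.
by rewrite -scalemxAr -scalemxAl -scalerDr [RHS]mxE.
Qed.

Lemma chart_parallel_curve T c i t : chart_parallel D T -> dom i (c t) ->
  {for t, continuous c} -> derivable (phi i \o c) t 1 ->
  mderiv (fun s => chart_tensor T i (c s)) t
    (christoffel_mx D i (c t) ('D_1 (phi i \o c) t) *m chart_tensor T i (c t) +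
     chart_tensor T i (c t) *m (christoffel_mx D i (c t) ('D_1 (phi i \o c) t))^T).
Proof.
move=> pT ict cc dc a b; have [dT ET] := pT i (c t) ict.
pose f p := chart_tensor T i (psi i p) a b.
have df : differentiable f ((phi i \o c) t) by exact: dT.
have dc' : differentiable (phi i \o c) t by apply/derivable1_diffP.
apply: (@near_eq_is_derive _ _ _ (f \o (phi i \o c))).
  have : \forall s \near t, dom i (c s).
    by apply: cc; apply: open_nbhs_nbhs; split=> //; exact: dom_open.
  by apply: filterS => s ics; rewrite /f /= phiK.
apply: DeriveDef; first exact/diff_derivable/differentiable_comp.
by rewrite (derive_chain _ dc' df) -ET.
Qed.

Lemma invmx_congruence (C C' A : 'M[R]_n) : C *m C' = 1%:M -> A \in unitmx ->
  invmx (C *m A *m C^T) = C'^T *m invmx A *m C'.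
Proof.
move=> CC' uA; have C'C := mulmx1C CC'.
have E : C *m A *m C^T *m (C'^T *m invmx A *m C') = 1%:M.
  rewrite !mulmxA -(mulmxA (C *m A)) -trmx_mul C'C trmx1 mulmx1.
  by rewrite -(mulmxA C) mulmxV // mulmx1.
have [u _] := mulmx1_unit E.
by rewrite -[LHS]mulmx1 -E (mulmxA (invmx _)) (mulVmx u) mul1mx.
Qed.

Lemma endo_congruence (C C' A B : 'M[R]_n) : C *m C' = 1%:M -> B \in unitmx ->
  (C *m A *m C^T) *m invmx (C *m B *m C^T) = C *m (A *m invmx B) *m C'.
Proof.
move=> K uB; rewrite (invmx_congruence K uB) !mulmxA -(mulmxA _ C^T) -trmx_mul.
by rewrite (mulmx1C K) trmx1 mulmx1.
Qed.

Lemma chart_endo T G i x : dom i x -> G x \in unitmx ->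
  chart_tensor T i x *m invmx (chart_tensor G i x) =
  jac i (chart_at x) x *m (T x *m invmx (G x)) *m jac (chart_at x) i x.
Proof.
move=> ix; exact: endo_congruence (jacK ix (dom_chart_at x)).
Qed.

Lemma chart_tensor_unit G i x : dom i x -> G x \in unitmx -> chart_tensor G i x \in unitmx.
Proof.
move=> ix uG; have [u _] := mulmx1_unit (jacK ix (dom_chart_at x)).
by rewrite /chart_tensor !unitmx_mul unitmx_tr u uG.
Qed.

(** With [B] the connection form along the curve, [T' = B T + T B^T] and
    [(G^-1)' = - (G^-1 B + B^T G^-1)]; in the derivative of [T G^-1] the transposed terms cancel and
    a commutator remains. *)
Lemma chart_endo_curve T G c i t : chart_parallel D T -> chart_parallel D G ->
  (forall x, G x \in unitmx) -> dom i (c t) ->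
  {for t, continuous c} -> derivable (phi i \o c) t 1 ->
  exists B : 'M[R]_n, let A s := chart_tensor T i (c s) *m invmx (chart_tensor G i (c s)) in
  mderiv A t (B *m A t - A t *m B).
Proof.
move=> pT pG uG ict cc dc.
have uGt := chart_tensor_unit ict (uG (c t)).
exists (christoffel_mx D i (c t) ('D_1 (phi i \o c) t)) => /=.
have dT := chart_parallel_curve pT ict cc dc.
have dG := chart_parallel_curve pG ict cc dc.
apply: mderiv_eq (mderivM dT (mderiv_inv dG uGt)) _.
move: (christoffel_mx _ _ _ _) (chart_tensor T i (c t)) (chart_tensor G i (c t)) uGt => B
  A F uF.
have E : invmx F *m (B *m F + F *m B^T) *m invmx F = invmx F *m B + B^T *m invmx F.
  rewrite mulmxDr mulmxDl !mulmxA mulVmx // mul1mx; congr (_ + _).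
  by rewrite -mulmxA mulmxV // mulmx1.
rewrite E mulmxDl mulmxN mulmxDr !mulmxA opprD [X in _ + X = _]addrC addrA.
by rewrite addrK.
Qed.

(** The square of [A] also evolves by a commutator with [B], and commutators have trace zero. *)
Lemma trace_derive (A : R -> 'M[R]_n) t (B : 'M[R]_n) :
  mderiv A t (B *m A t - A t *m B) ->
  is_derive t (1 : R) (fun s => \tr (A s)) 0 /\
  is_derive t (1 : R) (fun s => \tr (A s *m A s)) 0.
Proof.
move=> dA; split.
  by apply: is_derive_eq (mderiv_trace dA) _; rewrite linearB /= mxtrace_mulC subrr.
apply: is_derive_eq (mderiv_trace (mderivM dA dA)) _.
by rewrite mulmxBl mulmxBr !mulmxA addrA subrK -(mulmxA B) linearB /= (mxtrace_mulC B)
  subrr.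
Qed.

(** Inside a ball of the chart image, [x] and [y] are joined by a coordinate segment, along which
    [f] has derivative zero. *)
Lemma locally_constant_of_curves (f : M -> R) :
  (forall c i t, dom i (c t) -> {for t, continuous c} ->
     derivable (phi i \o c) t 1 -> is_derive t (1 : R) (f \o c) 0) ->
  forall x, \forall y \near x, f y = f x.
Proof.
move=> hf x; set i := chart_at x; have ix : dom i x by exact: dom_chart_at.
have /nbhs_ballP[r r0 br] : nbhs (phi i x) (phi i @` dom i).
  by apply: open_nbhs_nbhs; split; [exact: img_open|exists x].
have : \forall y \near x, dom i y /\ ball (phi i x) r (phi i y).
  near=> y; split; near: y; first by apply: open_nbhs_nbhs; split=> //; exact: dom_open.
  by apply: (phi_continuous ix); exact: nbhsx_ballx.
apply: filterS => y [iy By].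
pose l (s : R) := phi i x + s *: (phi i y - phi i x).
have Bl (s : R) : s \in `[0, 1] -> ball (phi i x) r (l s).
  move: By; rewrite -ball_normE /ball_ /= in_itv /= => By /andP[s0 s1].
  rewrite /l opprD addrA subrr add0r normrN normrZ (ger0_norm s0).
  by rewrite distrC; apply: le_lt_trans By; rewrite ler_piMl.
have cl : continuous l.
  by move=> s; apply: cvgD; [exact: cvg_cst|apply: cvgZr_tmp; exact: cvg_id].
have dl s : derivable l s 1.
  by apply: derivableD => //; apply/diff_derivable/differentiableZl.
have dc (s : R) : s \in `[0, 1] -> is_derive s (1 : R) (f \o (psi i \o l)) 0.
  move=> /Bl B; have [z iz ez] := br _ B.
  have iL : dom i ((psi i \o l) s) by rewrite /= -ez phiK.
  apply: (hf _ i) => //.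
    apply: (@continuous_comp _ _ _ l (psi i)); first exact: cl.
    by apply: psi_continuous; exists z.
  apply: (@near_eq_derivable _ _ _ l) (dl s).
  have : \forall u \near s, ball (phi i x) r (l u).
    apply: cl; rewrite -ball_normE; apply: open_nbhs_nbhs; split; last by rewrite
      ball_normE.
    by rewrite ball_normE; exact: ball_open.
  by apply: filterS => u /br[w iw ew]; rewrite /= -ew phiK.
have l0 : l 0 = phi i x by rewrite /l scale0r addr0.
have l1 : l 1 = phi i y by rewrite /l scale1r addrC subrK.
have H : (f \o (psi i \o l)) 0 = (f \o (psi i \o l)) 1.
  apply: (@derive0_off_finite _ _ [::] 0 1 ler01).
    by apply: derivable_within_continuous => s hs; have [] := dc s hs.
  by move=> t ht _; apply: dc; apply: subset_itv_oo_cc.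
by move: H; rewrite /= l0 l1 !phiK.
Unshelve. all: by end_near. Qed.

End Parallel_tensors.

(** * Parallel frames along piecewise smooth loops *)

Section Parallel_transport.
Context {R : realType} {n : nat} (M : smooth_manifold R n) (D : linear_connection M).
Implicit Types (x : M) (i j : chart M) (T G : tensor02 M) (c : R -> M).

Lemma chart_tensor_cts T i x : chart_parallel D T -> dom i x ->
  mcts (nbhs x) x (fun y => chart_tensor T i y).
Proof.
move=> pT ix a b; have [dT _] := pT i x ix.
apply: (@cts_near _ _ _ _ x ((fun p => chart_tensor T i (psi i p) a b) \o phi i)).
- have : \forall y \near x, dom i y by apply: open_nbhs_nbhs; split=> //; exact: dom_open.
  by apply: filterS => y iy /=; rewrite phiK.
- by rewrite /= phiK.
- apply: continuous_comp; first exact: phi_continuous.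
  exact: differentiable_continuous.
Qed.

Lemma cts_comp (f : M -> R) c (F : set_system R) t : Filter F ->
  cts (nbhs (c t)) (c t) f -> c @ F --> c t -> cts F t (f \o c).
Proof. by move=> FF cf cc; apply: cvg_comp cc cf. Qed.

(* [bad] contains the corners, where [c] and [V] need only be continuous. *)
Definition transports a b c m (V : R -> 'M[R]_(m, n)) (bad : seq R) :=
  [/\ forall t : R, t \in `[a, b] -> c @ within `[a, b]%classic (nbhs t) --> c t,
      forall (t : R) i, t \in `[a, b] -> dom i (c t) ->
        mcts (within `[a, b]%classic (nbhs t)) t (fun s => V s *m jac (chart_at (c s)) i
          (c s))
    & forall t : R, t \in `]a, b[ -> t \notin bad -> {for t, continuous c} /\
      forall i, dom i (c t) -> derivable (phi i \o c) t 1 /\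
        mderiv (fun s => V s *m jac (chart_at (c s)) i (c s)) t
        (- (V t *m jac (chart_at (c t)) i (c t) *m
            christoffel_mx D i (c t) ('D_1 (phi i \o c) t)))].

Lemma arc_transports a b c (V : R -> 'rV[R]_n) : parallel_arc D c V a b ->
  transports a b c V [::].
Proof.
move=> [e [c1 [V1 [e0 [cc1 sc1] pV1 E]]]].
have sub (t : R) : t \in `[a, b] -> `]a - e, b + e[%classic t.
  rewrite /= !in_itv /= => /andP[h1 h2].
  by rewrite ltrBlDr (le_lt_trans h1) ?ltrDl // (le_lt_trans h2) // ltrDl.
split.
- move=> t tab; have [-> _] := E t tab; have := cc1 t (sub t tab).
  move=> h U /h hU; change (\forall s \near t, `[a, b]%classic s -> U (c s)).
  apply: (@filterS _ (nbhs t) _ (fun s => U (c1 s))) => [s hs sab|]; last exact: hU.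
  by have [-> _] := E s sab.
- move=> t i tab; have [-> eV] := E t tab => ict.
  have [/derivable_mxP dV _] := pV1 i t (sub t tab) ict.
  apply: (@mcts_near _ _ _ _ t _ _ (fun s => components i (c1 s) (V1 s))).
  + change (\forall s \near t, `[a, b]%classic s ->
      components i (c1 s) (V1 s) = V s *m jac (chart_at (c s)) i (c s)).
    by near=> s => sab; have [-> ->] := E s sab.
  + by have [-> ->] := E t tab.
  + move=> p q; have /derivable1_diffP/differentiable_continuous := dV p q.
    by apply: cvg_trans; apply: cvg_app; exact: cvg_within.
- move=> t tab _; have tab' := subset_itv_oo_cc tab.
  have near_ab : \forall s \near t, c1 s = c s /\ V1 s = V s.
    have : \forall s \near t, `]a, b[%classic s.
      by apply: open_nbhs_nbhs; split=> //; exact: interval_open.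
    by apply: filterS => s sab; have [-> ->] := E s (subset_itv_oo_cc sab).
  have [ct Vt] := E t tab'; split.
    rewrite /prop_for /continuous_at ct; apply: cvg_trans (cc1 t (sub t tab')).
    by apply: near_eq_cvg; apply: filterS near_ab => s [-> _].
  rewrite ct => i ict; have [dphi _] := sc1 i 1.
  have {}dphi : derivable (phi i \o c1) t 1.
    by apply: diff_derivable; apply: dphi; split=> //; exact: sub.
  have e1 : \forall s \near t, (phi i \o c1) s = (phi i \o c) s.
    by apply: filterS near_ab => s /= [-> _].
  split; first exact: near_eq_derivable dphi.
  apply: (@mderiv_near _ _ _ (fun s => components i (c1 s) (V1 s))).
    by apply: filterS near_ab => s [-> ->].
  rewrite -(near_eq_derive _ e1) Vt.
  have dV := pV1 i t (sub t tab') ict.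
  have {}dV : is_derive t (1 : R) (fun s => components i (c1 s) (V1 s))
     (- (components i (c1 t) (V1 t) *m christoffel_mx D i (c1 t) ('D_1 (phi i \o c1) t))).
    apply: is_derive_eq dV _; congr (- _).
    rewrite /christoffel_mx mulmx_sumr; apply: eq_bigr => k _.
    rewrite -scalemxAr mulmx_sum_row scaler_sumr; apply: eq_bigr => l _.
    by rewrite scalerA rowK.
  move=> p q; case: dV => dV eV; apply: DeriveDef.
    by move/derivable_mxP: dV; apply.
  by rewrite -eV derive_mx // mxE.
Unshelve. all: by end_near. Qed.

(** The joint [b] becomes an exceptional point, since the two pieces fit together only continuously
    there. *)
Lemma transports_cat a b d c V s1 s2 : a <= b -> b <= d ->
  transports a b c V s1 -> transports b d c V s2 ->
  @transports a d c 1 V (b :: s1 ++ s2).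
Proof.
move=> ab bd [A1 B1 C1] [A2 B2 C2].
have cover (t : R) : t \in `[a, d] -> t \in `[a, b] \/ t \in `[b, d].
  by rewrite !in_itv /= => /andP[-> ->]; rewrite andbT; case: (lerP t b) => h;
    [left|right => /=; rewrite ltW].
have glue (U : set R) (t : R) : (t \in `[a, b] -> within `[a, b]%classic (nbhs t) U) ->
    (t \in `[b, d] -> within `[b, d]%classic (nbhs t) U) ->
    within `[a, d]%classic (nbhs t) U.
  (* A [t] outside [[u, v]] has a neighbourhood disjoint from it, where there is nothing to
     check. *)
  have half (u v : R) : (t \in `[u, v] -> within `[u, v]%classic (nbhs t) U) ->
      within `[u, v]%classic (nbhs t) U.
    move=> h; have [/h //|nt] := boolP (t \in `[u, v]).
    have : \forall s \near t, (~` `[u, v]%classic) s.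
      apply: open_nbhs_nbhs; split; last by move=> /=; exact/negP.
      by apply: closed_openC; exact: interval_closed.
    by apply: filterS => s ns /ns.
  move=> /half h1 /half h2; move: h1 h2; rewrite /within /= => h1 h2.
  by near=> s => /cover[]; near: s.
split.
- by move=> t _ U hU; apply: (glue (c @^-1` U)) => tab; [exact: A1|exact: A2].
- move=> t i _ ict p q U hU; apply: glue => tab; [exact: (B1 t i tab ict p q U hU)|exact:
  (B2 t i tab ict p q U hU)].
- move=> t tad; rewrite inE mem_cat !negb_or => /and3P[tb n1 n2].
  move: tad; rewrite in_itv /= => /andP[h1 h2].
  have [lt|gt|eq] := ltgtP t b; last by rewrite eq eqxx in tb.
    by apply: C1 => //; rewrite in_itv /= h1.
  by apply: C2 => //; rewrite in_itv /= h2 andbT.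
Unshelve. all: by end_near. Qed.

Lemma path_le_last (a : R) s : path <%R a s -> a <= last a s.
Proof.
by elim: s a => //= b s IH a /andP[ab /IH]; apply: le_trans; exact: ltW.
Qed.

Lemma path_transports c (V : R -> 'rV[R]_n) a s : path <%R a s ->
  (forall k, (k < size s)%N -> parallel_arc D c V (nth 0 (a :: s) k) (nth 0 s k)) ->
  exists bad, transports a (last a s) c V bad.
Proof.
elim: s a => [|b s IH] a /=.
  move=> _ _; exists [::]; split.
  - move=> t taa U hU; change (\forall s \near t, `[a, a]%classic s -> U (c s)).
    near=> s => saa; suff -> : s = t by exact: nbhs_singleton hU.
    by move: taa saa; rewrite /= !itvxx => /eqP -> /eqP ->.
  - move=> t i taa ict p q U hU.
    change (\forall s \near t, `[a, a]%classic s -> U ((V s *m jac (chart_at (c s)) i (c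
      s)) p q)).
    near=> s => saa; suff -> : s = t by exact: nbhs_singleton hU.
    by move: taa saa; rewrite /= !itvxx => /eqP -> /eqP ->.
  - by move=> t; rewrite in_itv /= => /andP[h1 h2]; have := lt_trans h1 h2; rewrite ltxx.
move=> /andP[ab ps] Q.
have [k hk|bad tr] := IH b ps _; first exact: (Q k.+1).
exists (b :: [::] ++ bad); apply: transports_cat tr => //; first exact: ltW.
  exact: path_le_last.
exact: (arc_transports (Q 0%N isT)).
Unshelve. all: by end_near. Qed.

(** The parallel fields starting at the standard basis vectors are the rows of [F], so that [F] ends
    at [P]. Each field has its own subdivision; the exceptional points are pooled. *)
Lemma holonomy_transports x P : holonomy_group D x P -> exists c (F : R -> 'M[R]_n) bad,
  [/\ transports 0 1 c F bad, c 0 = x, c 1 = x, F 0 = 1%:M & F 1 = P].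
Proof.
move=> [c [_ c0 c1] hP].
(* The field starting at 0 supplies the regularity of the curve itself, in every dimension. *)
have [V0 [[s0 [p0 l0 q0]] _ _]] := hP 0.
have := path_transports p0 q0; rewrite l0 => -[bad0 [A0 B0 C0]].
have hV (p : 'I_n) : exists (V : R -> 'rV[R]_n) bad, [/\ transports 0 1 c V bad, V 0 =
  delta_mx 0 p & V 1 = delta_mx 0 p *m P].
  have [V [[s [ps ls qs]] v0 v1]] := hP (delta_mx 0 p).
  by have := path_transports ps qs; rewrite ls => -[bad tr]; exists V, bad.
pose V p := sval (cid (hV p)).
have hV' p : exists bad, [/\ transports 0 1 c (V p) bad, V p 0 = delta_mx 0 p & V p 1 =
  delta_mx 0 p *m P].
  exact: (svalP (cid (hV p))).
pose bad p := sval (cid (hV' p)).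
have hV2 p : [/\ transports 0 1 c (V p) (bad p), V p 0 = delta_mx 0 p & V p 1 = delta_mx
  0 p *m P].
  exact: (svalP (cid (hV' p))).
pose F s := \matrix_p V p s.
have EF m (B : 'M[R]_(n, m)) s p q : (F s *m B) p q = (V p s *m B) 0 q.
  by rewrite !mxE; apply: eq_bigr => k _; rewrite mxE.
exists c, F, (bad0 ++ flatten [seq bad p | p <- enum 'I_n]); split=> //.
- split=> //.
  + move=> t i t01 ict p q; have [[_ Bp _] _ _] := hV2 p.
    have -> : (fun s => (F s *m jac (chart_at (c s)) i (c s)) p q) =
      (fun s => (V p s *m jac (chart_at (c s)) i (c s)) 0 q) by apply/funext => s;
        rewrite EF.
    exact: (Bp t i t01 ict 0 q).
  + move=> t t01; rewrite mem_cat negb_or => /andP[n0 nb].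
    have [cc dphi] := C0 t t01 n0; split=> // i ict.
    split=> [|p q]; first by have [] := dphi i ict.
    have [[_ _ Cp] _ _] := hV2 p.
    have np : t \notin bad p.
      apply: contra nb => tp; apply/flattenP; exists (bad p) => //.
      by apply: map_f; rewrite mem_enum.
    have [_ /(_ i ict)[_ /(_ 0 q)]] := Cp t t01 np.
    have -> : (fun s => (F s *m jac (chart_at (c s)) i (c s)) p q) =
      (fun s => (V p s *m jac (chart_at (c s)) i (c s)) 0 q) by apply/funext => s;
        rewrite EF.
    have EN (B B' : 'M[R]_n) : (- (F t *m B *m B')) p q = (- (V p t *m B *m B')) 0 q.
      by rewrite [LHS]mxE [RHS]mxE -!mulmxA EF.
    by rewrite EN.
- by apply/row_matrixP => p; rewrite rowK row1; have [_ ->] := hV2 p.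
- by apply/row_matrixP => p; rewrite rowK rowE; have [_ _ ->] := hV2 p.
Qed.

(** In a chart, with [B] the connection form along [c], [F' = - F B] and [T' = B T + T B^T], so the
    derivative of [F T F^T] cancels away from the exceptional points; continuity passes over
    these. *)
Lemma transports_gram T c m (F : R -> 'M[R]_(m, n)) bad : chart_parallel D T ->
  transports 0 1 c F bad -> forall t, t \in `[0, 1] ->
  F t *m T (c t) *m (F t)^T = F 0 *m T (c 0) *m (F 0)^T.
Proof.
move=> pT [A B C] t; rewrite in_itv /= => /andP[t0 t1].
apply/matrixP => p q; pose h s := (F s *m T (c s) *m (F s)^T) p q.
(* The product may be computed in any chart around the current point. *)
have E i s : dom i (c s) -> (F s *m jac (chart_at (c s)) i (c s)) *m
    chart_tensor T i (c s) *m (F s *m jac (chart_at (c s)) i (c s))^T =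
    F s *m T (c s) *m (F s)^T by exact: chart_tensorE.
have ndom i (G : set_system R) u : c @ G --> c u -> dom i (c u) ->
    \forall s \near G, dom i (c s).
  by move=> cc icu; apply: cc; apply: open_nbhs_nbhs; split=> //; exact: dom_open.
apply/esym; change (h 0 = h t).
have ch : {within `[0, 1], continuous h}.
  apply/subspace_continuousP => s s01.
  set i := chart_at (c s); have ics : dom i (c s) by exact: dom_chart_at.
  have cc := A s s01.
  have cF := B s i s01 ics.
  have cT : mcts (within `[0, 1]%classic (nbhs s)) s (fun s => chart_tensor T i (c s)).
    by move=> a b; apply: (cts_comp (f := fun y => chart_tensor T i y a b)) cc; exact:
      chart_tensor_cts.
  have cG := mctsM (mctsM cF cT) (mcts_tr cF).
  change (cts (within `[0, 1]%classic (nbhs s)) s h).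
  apply: cts_near (cG _ _ p q); last by rewrite /h E.
  by apply: filterS (ndom i _ s cc ics) => u icu; rewrite /h E.
apply: (@derive0_off_finite _ h bad 0 t t0).
  apply: continuous_subspaceW ch => s /=.
  by rewrite !in_itv /= => /andP[-> /le_trans]; apply.
move=> s; rewrite in_itv /= => /andP[s0 st] nb.
have s01 : s \in `]0, 1[ by rewrite in_itv /= s0 (lt_le_trans st).
have [cc dd] := C s s01 nb.
set i := chart_at (c s); have ics : dom i (c s) by exact: dom_chart_at.
have [dphi dF] := dd i ics.
have dT := chart_parallel_curve pT ics cc dphi.
have dG := mderivM (mderivM dF dT) (mderiv_tr dF).
apply: near_eq_is_derive (is_derive_eq (dG p q) _).
  by apply: filterS (ndom i _ s cc ics) => u icu; rewrite /h E.
move: (christoffel_mx _ _ _ _) (chart_tensor T i (c s)) (F s *m _) => X Y Z.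
rewrite linearN /= trmx_mul mulNmx mulmxDr !mulmxDl mulmxN !mulmxA.
by rewrite mulNmx addKr subrr mxE.
Qed.

End Parallel_transport.

(** * Linear algebra in dimension four *)

Section Quadratic.
Context {R : realType} {n : nat}.
Implicit Types (A J N : 'M[R]_n.+1) (H : set 'M[R]_n.+1).

Definition commutant H N := forall P, H P -> P *m N = N *m P.

(** The form in which irreducibility enters, through Schur's lemma ([irreducible_division]). *)
Definition division_commutant H := forall N, commutant H N -> N = 0 \/ N \in unitmx.

Lemma commutantD H N N' : commutant H N -> commutant H N' -> commutant H (N + N').
Proof. by move=> h h' P HP; rewrite mulmxDl mulmxDr h ?h'. Qed.

Lemma commutantM H N N' : commutant H N -> commutant H N' -> commutant H (N *m N').
Proof. by move=> h h' P HP; rewrite mulmxA h // -mulmxA h' // mulmxA. Qed.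

Lemma commutant_scalar H a : commutant H a%:M.
Proof. by move=> P _; rewrite scalar_mxC. Qed.

Lemma commutantZ H a N : commutant H N -> commutant H (a *: N).
Proof. by move=> h P HP; rewrite -scalemxAl -scalemxAr h. Qed.

Lemma commutantB H N N' : commutant H N -> commutant H N' -> commutant H (N - N').
Proof. by move=> h h' P HP; rewrite mulmxBl mulmxBr h ?h'. Qed.

Lemma division_mul0 H N N' : division_commutant H -> commutant H N ->
  N *m N' = 0 -> N = 0 \/ N' = 0.
Proof.
move=> dH /dH [->|u] NN; [by left|right].
by rewrite -[N']mul1mx -(mulVmx u) -mulmxA NN mulmx0.
Qed.

Import complex.
Local Open Scope complex_scope.

(** Take a complex eigenvalue [a + b i] of [A]: the real and imaginary parts of an eigenvector are
    both annihilated by this polynomial in [A], and they are not both zero. *)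
Lemma real_quadratic_singular A : exists a b,
  ((A - a%:M) *m (A - a%:M) + (b ^+ 2)%:M) \notin unitmx.
Proof.
pose AC := map_mx (real_complex R) A.
have [l rl] : exists l, root (char_poly AC) l.
  by apply/closed_rootP; rewrite size_char_poly.
move: rl; rewrite -eigenvalue_root_char => /eigenvalueP[v vA v0].
pose x := map_mx (@Re R) v; pose y := map_mx (@Im R) v.
exists (Re l), (Im l); set a := Re l; set b := Im l.
have ReM (z : R[i]) (r : R) : Re (z * r%:C) = Re z * r by case: z => p q /=; ring.
have ImM (z : R[i]) (r : R) : Im (z * r%:C) = Im z * r by case: z => p q /=; ring.
have xA : x *m A = a *: x - b *: y.
  apply/rowP => j; have := congr1 (fun M : 'rV_n.+1 => Re (M 0 j)) vA.
  rewrite !mxE raddf_sum /=.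
  under eq_bigr do rewrite mxE ReM.
  move=> E; rewrite -[RHS]/(a * Re (v 0 j) - b * Im (v 0 j)).
  transitivity (Re (l * v 0 j)); last by rewrite /a /b; case: (l) (v 0 j) => ? ? [].
  by rewrite -E; apply: eq_bigr => k _; rewrite mxE.
have yA : y *m A = b *: x + a *: y.
  apply/rowP => j; have := congr1 (fun M : 'rV_n.+1 => Im (M 0 j)) vA.
  rewrite !mxE raddf_sum /=.
  under eq_bigr do rewrite mxE ImM.
  move=> E; rewrite -[RHS]/(b * Re (v 0 j) + a * Im (v 0 j)).
  transitivity (Im (l * v 0 j)).
    by rewrite -E; apply: eq_bigr => k _; rewrite mxE.
  by rewrite /a /b; case: (l) (v 0 j) => ? ? [] ? ? /=; rewrite addrC.
have x1 : x *m (A - a%:M) = - (b *: y).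
  by rewrite mulmxBr xA mul_mx_scalar addrAC subrr add0r.
have y1 : y *m (A - a%:M) = b *: x.
  by rewrite mulmxBr yA mul_mx_scalar addrK.
apply/negP => u; case/negP: v0; apply/eqP.
have kill z : z *m ((A - a%:M) *m (A - a%:M) + (b ^+ 2)%:M) = 0 -> z = 0 :> 'rV_n.+1.
  by move=> h; rewrite -[z]mulmx1 -(mulmxV u) mulmxA h mul0mx.
have x0 : x = 0.
  apply: kill; rewrite mulmxDr mulmxA x1 mulNmx -scalemxAl y1 mul_mx_scalar.
  by rewrite scalerA addrC subrr.
have y0 : y = 0.
  apply: kill; rewrite mulmxDr mulmxA y1 -scalemxAl x1 mul_mx_scalar.
  by rewrite scalerN scalerA addrC subrr.
apply/rowP => j; have := congr1 (fun M : 'rV_n.+1 => M 0 j) x0.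
have := congr1 (fun M : 'rV_n.+1 => M 0 j) y0; rewrite !mxE.
by case: (v 0 j) => p q /= -> ->.
Qed.

(** A polynomial in [A] lies in the commutant; being singular, it vanishes. *)
Lemma division_quadratic H A : division_commutant H -> commutant H A ->
  exists a b, (A - a%:M) *m (A - a%:M) = - (b ^+ 2)%:M.
Proof.
move=> dH cA; have [a [b nu]] := real_quadratic_singular A; exists a, b.
have cB := commutantB cA (@commutant_scalar H a).
have [h|u] := dH _ (commutantD (commutantM cB cB) (@commutant_scalar H (b ^+ 2))).
  by apply/eqP; rewrite -addr_eq0 h.
by rewrite u in nu.
Qed.

(** For [b = 0] the square-zero element [A - a%:M] of a division algebra is zero; otherwise division
    by [b] makes its square -1. *)
Lemma division_scalar_or_complex H A : division_commutant H -> commutant H A ->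
  (exists a, A = a%:M) \/ exists a b J, [/\ b != 0, commutant H J, J *m J = - 1%:M & A =
    a%:M + b *: J].
Proof.
move=> dH cA; have [a [b E]] := division_quadratic dH cA.
have cB := commutantB cA (@commutant_scalar H a).
have [b0|b0] := eqVneq b 0.
  left; exists a; move: E; rewrite b0 expr0n /= raddf0 oppr0.
  by move=> /(division_mul0 dH cB) [] /eqP; rewrite subr_eq0 => /eqP.
right; exists a, b, (b^-1 *: (A - a%:M)); split => //.
- exact: commutantZ.
- rewrite -scalemxAl -scalemxAr scalerA E -scalemx1 scalerN scalerA.
  by rewrite -invfM -expr2 mulVf ?scale1r // expf_neq0.
- by rewrite scalerA divff // scale1r addrC subrK.
Qed.

End Quadratic.

(** * Complex structures and alternating complex forms *)

Section Complex_structure.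
Context {R : realType} {n : nat}.
Implicit Types (J : 'M[R]_n.+1) (a b c d : R).

(** The complex number a + b i, with [J] in the role of i. *)
Definition cmx J a b := a%:M + b *: J.

Lemma cmxM J a b c d : J *m J = - 1%:M ->
  cmx J a b *m cmx J c d = cmx J (a * c - b * d) (a * d + b * c).
Proof.
move=> JJ; rewrite /cmx mulmxDl !mulmxDr -!scalar_mxM mul_scalar_mx -!scalemxAl
  mul_mx_scalar -scalemxAr JJ.
apply/matrixP => i j; rewrite !mxE; case: (i == j); rewrite ?mulr1n ?mulr0n; ring.
Qed.

(** Multiplication by the conjugate [cmx J a (- b)] gives the scalar a^2 + b^2. *)
Lemma cmx_eq0 J a b : J *m J = - 1%:M -> cmx J a b = 0 -> a = 0 /\ b = 0.
Proof.
move=> JJ E; have : cmx J a b *m cmx J a (- b) = 0 by rewrite E mul0mx.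
rewrite cmxM // /cmx !mulrN opprK [b * a]mulrC addNr scale0r addr0.
move=> /matrixP /(_ 0 0); rewrite !mxE mulr1n => h.
by split; nra.
Qed.
End Complex_structure.

(** Explicit matrices as nested lists: sums, products and transposes simplify to such lists again,
    and an identity splits into its 16 entries. *)
Definition mx4 (R : realType) (l : seq (seq R)) : 'M[R]_4 :=
  \matrix_(i, j) nth 0 (nth [::] l i) j.

Ltac mx4_congr :=
  congr (mx4 [:: [:: _; _; _; _]; [:: _; _; _; _]; [:: _; _; _; _]; [:: _; _; _; _]]).

Section Four.
Context {R : realType}.

Lemma mx4_eta (A : 'M[R]_4) : exists x00 x01 x02 x03 x10 x11 x12 x13 x20 x21 x22 x23 x30
  x31 x32 x33,
  A = mx4 [:: [:: x00; x01; x02; x03]; [:: x10; x11; x12; x13];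
              [:: x20; x21; x22; x23]; [:: x30; x31; x32; x33]].
Proof.
exists (A (inord 0) (inord 0)), (A (inord 0) (inord 1)), (A (inord 0) (inord 2)), (A
  (inord 0) (inord 3)), (A (inord 1) (inord 0)), (A (inord 1) (inord 1)), (A (inord 1)
  (inord 2)), (A (inord 1) (inord 3)), (A (inord 2) (inord 0)), (A (inord 2) (inord 1)),
  (A (inord 2) (inord 2)), (A (inord 2) (inord 3)), (A (inord 3) (inord 0)), (A (inord 3)
  (inord 1)), (A (inord 3) (inord 2)), (A (inord 3) (inord 3)).
by apply/matrixP => -[[|[|[|[|//]]]] hi] [[|[|[|[|//]]]] hj]; rewrite mxE /=;
  congr (A _ _); apply/val_inj; rewrite /= inordK.
Qed.

Lemma mx4_inj (l l' : seq (seq R)) : mx4 l = mx4 l' ->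
  forall i j, (i < 4)%N -> (j < 4)%N -> nth 0 (nth [::] l i) j = nth 0 (nth [::] l' i) j.
Proof.
by move=> /matrixP E i j hi hj; have := E (Ordinal hi) (Ordinal hj); rewrite !mxE.
Qed.

Lemma mx4M (l l' : seq (seq R)) : mx4 l *m mx4 l' =
  let e i j := nth 0 (nth [::] l i) 0 * nth 0 (nth [::] l' 0) j + nth 0 (nth [::] l i) 1
    * nth 0 (nth [::] l' 1) j
   + nth 0 (nth [::] l i) 2 * nth 0 (nth [::] l' 2) j + nth 0 (nth [::] l i) 3 * nth 0
     (nth [::] l' 3) j in
  mx4 [seq [seq e i j | j <- iota 0 4] | i <- iota 0 4].
Proof.
apply/matrixP => i j; rewrite !mxE !big_ord_recl big_ord0 !mxE /= addr0 !addrA.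
by case: i => [[|[|[|[|//]]]] hi]; case: j => [[|[|[|[|//]]]] hj].
Qed.

Lemma mx4T (l : seq (seq R)) : (mx4 l)^T =
  mx4 [seq [seq nth 0 (nth [::] l j) i | j <- iota 0 4] | i <- iota 0 4].
Proof.
apply/matrixP => i j; rewrite !mxE.
by case: i => [[|[|[|[|//]]]] hi]; case: j => [[|[|[|[|//]]]] hj].
Qed.

Lemma mx4N (l : seq (seq R)) : - mx4 l =
  mx4 [seq [seq - nth 0 (nth [::] l i) j | j <- iota 0 4] | i <- iota 0 4].
Proof.
apply/matrixP => i j; rewrite !mxE.
by case: i => [[|[|[|[|//]]]] hi]; case: j => [[|[|[|[|//]]]] hj].
Qed.

Lemma mx4Z a (l : seq (seq R)) : a *: mx4 l =
  mx4 [seq [seq a * nth 0 (nth [::] l i) j | j <- iota 0 4] | i <- iota 0 4].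
Proof.
apply/matrixP => i j; rewrite !mxE.
by case: i => [[|[|[|[|//]]]] hi]; case: j => [[|[|[|[|//]]]] hj].
Qed.

Lemma mx4D (l l' : seq (seq R)) : mx4 l + mx4 l' =
  mx4 [seq [seq nth 0 (nth [::] l i) j + nth 0 (nth [::] l' i) j | j <- iota 0 4] | i <-
    iota 0 4].
Proof.
apply/matrixP => i j; rewrite !mxE.
by case: i => [[|[|[|[|//]]]] hi]; case: j => [[|[|[|[|//]]]] hj].
Qed.

Lemma mx4_scalar (a : R) : a%:M = mx4 [:: [:: a; 0; 0; 0]; [:: 0; a; 0; 0]; [:: 0; 0; a;
  0]; [:: 0; 0; 0; a]].
Proof.
apply/matrixP => i j; rewrite !mxE.
by case: i => [[|[|[|[|//]]]] hi]; case: j => [[|[|[|[|//]]]] hj].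
Qed.

(* The matrix of a complex structure J in a basis u, uJ, w, wJ; matrices act on
   row vectors from the right. *)
Definition J4 : 'M[R]_4 := mx4 [:: [:: 0; 1; 0; 0]; [:: -1; 0; 0; 0]; [:: 0; 0; 0; 1];
  [:: 0; 0; -1; 0]].

(** For skew [X] with [J4 X = X J4^T], [v *m X *m w^T] is the real part of an alternating complex
    bilinear form on C^2. Such a form is a complex multiple of the determinant, whence the two real
    parameters. *)
Definition skew4 p q : 'M[R]_4 := mx4 [:: [:: 0; 0; p; q]; [:: 0; 0; q; -p]; [:: -p; -q;
  0; 0]; [:: -q; p; 0; 0]].

Lemma skew4P (X : 'M[R]_4) : X^T = - X -> J4 *m X = X *m J4^T -> exists p q, X = skew4 p q.
Proof.
have [x00 [x01 [x02 [x03 [x10 [x11 [x12 [x13 [x20 [x21 [x22 [x23 [x30 [x31 [x32 [x33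
  ->]]]]]]]]]]]]]]]] := mx4_eta X.
rewrite /J4 mx4T mx4N !mx4T !mx4M => /mx4_inj S /mx4_inj C.
exists x02, x03; rewrite /skew4.
have := (S 0 0 isT isT, S 0 1 isT isT, S 0 2 isT isT, S 0 3 isT isT, S 1 1 isT isT, S 1 2
  isT isT, S 1 3 isT isT, S 2 2 isT isT, S 2 3 isT isT, S 3 3 isT isT)%N.
have := (C 0 0 isT isT, C 0 2 isT isT, C 0 3 isT isT, C 2 2 isT isT)%N.
rewrite /= !(mul0r, mul1r, mulr0, mulr1, add0r, addr0, mulrN, mulNr, oppr0) => C' S';
  clear S C.
repeat match goal with H : prod _ _ |- _ => destruct H end.
by mx4_congr; lra.
Qed.

Lemma row_mx4 (r0 r1 r2 r3 : 'rV[R]_4) (v : 'rV[R]_4) :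
  v *m (\matrix_k nth 0 [:: r0; r1; r2; r3] k) =
  v 0 (inord 0) *: r0 + v 0 (inord 1) *: r1 + v 0 (inord 2) *: r2 + v 0 (inord 3) *: r3.
Proof.
rewrite mulmx_sum_row !big_ord_recl big_ord0 addr0 !rowK /= !addrA.
by do !congr (_ + _); congr (_ *: _); congr (v 0 _); apply/val_inj; rewrite /= inordK.
Qed.

Lemma row4_eq0 (v : 'rV[R]_4) : v 0 (inord 0) = 0 -> v 0 (inord 1) = 0 ->
  v 0 (inord 2) = 0 -> v 0 (inord 3) = 0 -> v = 0.
Proof.
move=> h0 h1 h2 h3; apply/rowP => j; rewrite mxE.
case: j => [[|[|[|[|//]]]] hj]; [rewrite -h0|rewrite -h1|rewrite -h2|rewrite -h3].
all: by congr (v 0 _); apply/val_inj; rewrite /= inordK.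
Qed.

Lemma unitmx_of_inj n (B : 'M[R]_n) : (forall v : 'rV[R]_n, v *m B = 0 -> v = 0) -> B \in
  unitmx.
Proof.
move=> h; rewrite -row_free_unit -kermx_eq0; apply/eqP/row_matrixP => i.
by rewrite row0; apply: h; rewrite -row_mul mulmx_ker row0.
Qed.

Lemma cmx_row_eq0 (J : 'M[R]_4) a b (u : 'rV[R]_4) : J *m J = - 1%:M ->
  u *m cmx J a b = 0 -> u = 0 \/ a = 0 /\ b = 0.
Proof.
move=> JJ E; have : u *m (cmx J a b *m cmx J a (- b)) = 0 by rewrite mulmxA E mul0mx.
rewrite cmxM // /cmx !mulrN opprK [b * a]mulrC addNr scale0r addr0 mul_mx_scalar.
move=> /eqP; rewrite scaler_eq0 => /orP[/eqP h|/eqP ->]; [right|by left].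
by split; nra.
Qed.

Lemma complex_normal_form (J : 'M[R]_4) : J *m J = - 1%:M ->
  exists2 B, B \in unitmx & B *m J = J4 *m B.
Proof.
move=> JJ; pose u : 'rV[R]_4 := delta_mx 0 0.
have u0 : u != 0 by apply/eqP => /rowP /(_ 0); rewrite !mxE /= => /eqP; rewrite oner_eq0.
(* Two rows cannot span all four basis vectors. *)
have [k nk] : exists k : 'I_4, ~~ ((delta_mx 0 k : 'rV[R]_4) <= col_mx u (u *m J))%MS.
  apply: contrapT => /forallNP h.
  have : (1%:M <= col_mx u (u *m J))%MS.
    by apply/row_subP => k; rewrite row1; apply/negP => /negP; exact: h.
  by move=> /mxrankS; rewrite mxrank1 => /leq_trans /(_ (rank_leq_row _)).
set w : 'rV[R]_4 := delta_mx 0 k in nk.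
exists (\matrix_k nth 0 [:: u; u *m J; w; w *m J] k).
  apply: unitmx_of_inj => v; rewrite row_mx4.
  set a := v 0 (inord 0); set b := v 0 (inord 1); set c := v 0 (inord 2); set d := v 0
    (inord 3).
  move=> E.
  have Ez z p q : p *: z + q *: (z *m J) = z *m cmx J p q by rewrite /cmx mulmxDr
    mul_mx_scalar -scalemxAr.
  have E' : u *m cmx J a b + w *m cmx J c d = 0 by rewrite -!Ez addrA.
  have cd0 : c ^+ 2 + d ^+ 2 = 0.
    apply/eqP; apply: contraNT nk => cd.
    (* The relation is solved for [w]: the inverse of c + d J is c - d J divided by c^2 + d^2. *)
    have -> : w = - (c ^+ 2 + d ^+ 2)^-1 *: (u *m (cmx J a b *m cmx J c (- d))).
      have -> : u *m (cmx J a b *m cmx J c (- d)) = - (w *m (cmx J c d *m cmx J c (- d))).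
        by rewrite !mulmxA -mulNmx; congr (_ *m _); apply/eqP; rewrite -addr_eq0 E'.
      rewrite cmxM // /cmx !mulrN opprK [d * c]mulrC addNr scale0r addr0 mul_mx_scalar.
      by rewrite scalerN scaleNr opprK scalerA mulVf ?scale1r // .
    rewrite cmxM // -Ez; apply: scalemx_sub; apply: addmx_sub; apply: scalemx_sub.
      by rewrite -addsmxE addsmxSl.
    by rewrite -addsmxE addsmxSr.
  have [c0 d0] : c = 0 /\ d = 0 by split; nra.
  move: E'; rewrite c0 d0 {2}/cmx scale0r raddf0 addr0 mulmx0 addr0.
  move=> /(cmx_row_eq0 JJ) [/eqP|[a0 b0]]; first by rewrite (negPf u0).
  exact: row4_eq0.
apply/row_matrixP => i; rewrite !row_mul row_mx4 rowK.
by case: i => [[|[|[|[|//]]]] hi]; rewrite !mxE /= !inordK //= ?scale0r ?scale1r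
  ?scaleN1r ?addr0 ?add0r // -mulmxA JJ mulmxN mulmx1.
Qed.

(** Alternating complex forms on C^2 make up a complex line; in the basis [B] this is seen from
    [skew4P]. *)
Lemma skew_commuting_dim1 (J X Y : 'M[R]_4) : J *m J = - 1%:M ->
  X^T = - X -> J *m X = X *m J^T -> Y^T = - Y -> J *m Y = Y *m J^T -> Y != 0 ->
  exists a b, X = cmx J a b *m Y.
Proof.
move=> JJ sX cX sY cY Y0; have [B uB BJ] := complex_normal_form JJ.
have BJT : J^T *m B^T = B^T *m J4^T by rewrite -!trmx_mul BJ.
have H (Z : 'M[R]_4) : Z^T = - Z -> J *m Z = Z *m J^T -> exists p q, B *m Z *m B^T =
  skew4 p q.
  move=> sZ cZ; apply: skew4P.
    by rewrite !trmx_mul trmxK sZ mulNmx mulmxN mulmxA.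
  by rewrite !mulmxA -BJ -(mulmxA B J) cZ -!mulmxA BJT.
have [p [q EX]] := H X sX cX; have [p' [q' EY]] := H Y sY cY.
have inj (Z Z' : 'M[R]_4) : B *m Z *m B^T = B *m Z' *m B^T -> Z = Z'.
  have uT : B^T \in unitmx by rewrite unitmx_tr.
  by move=> /(can_inj (mulmxK uT)) /(can_inj (mulKmx uB)).
have d0 : p' ^+ 2 + q' ^+ 2 != 0.
  apply: contra Y0 => /eqP d0; apply/eqP; apply: inj; rewrite mulmx0 mul0mx EY.
  have [-> ->] : p' = 0 /\ q' = 0 by split; nra.
  have -> : 0 = 0%:M :> 'M[R]_4 by rewrite raddf0.
  by rewrite mx4_scalar /skew4 !oppr0.
(* The quotient of p - i q by p' - i q': multiplication of [skew4 p q] by [J4] is multiplication of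
   p - i q by i. *)
exists ((p * p' + q * q') / (p' ^+ 2 + q' ^+ 2)), ((p * q' - q * p') / (p' ^+ 2 + q' ^+ 2)).
apply: inj; rewrite EX /cmx !mulmxDl mul_scalar_mx mulmxDr mulmxDl -scalemxAl -!scalemxAr
  -!scalemxAl EY.
have -> : B *m (J *m Y) *m B^T = J4 *m skew4 p' q' by rewrite -EY !mulmxA BJ.
rewrite /J4 /skew4 mx4M !mx4Z mx4D.
by mx4_congr; rewrite /=; field.
Qed.

End Four.

(** * Generators of so(2, C) *)

Section Rotation.
Context {R : realType}.
Implicit Types (E F G J : 'M[R]_4).

Lemma sqrt_complex (a b : R) : exists c d, c * c - d * d = a /\ c * d + d * c = b.
Proof.
pose r := Num.sqrt (a ^+ 2 + b ^+ 2).
have r2 : r ^+ 2 = a ^+ 2 + b ^+ 2 by rewrite sqr_sqrtr // addr_ge0 // sqr_ge0.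
have r0 : 0 <= r by exact: sqrtr_ge0.
have h1 : 0 <= (r + a) / 2 by nra.
have h2 : 0 <= (r - a) / 2 by nra.
pose c := Num.sqrt ((r + a) / 2); pose d := Num.sqrt ((r - a) / 2).
have c2 : c ^+ 2 = (r + a) / 2 by rewrite sqr_sqrtr.
have d2 : d ^+ 2 = (r - a) / 2 by rewrite sqr_sqrtr.
have cd : (2 * (c * d)) ^+ 2 = b ^+ 2.
  transitivity (4 * c ^+ 2 * d ^+ 2); first by ring.
  by rewrite c2 d2; transitivity (r ^+ 2 - a ^+ 2); [field|rewrite r2; ring].
(* So [2 c d] is [b] or [- b]; in the second case [d] changes sign. *)
have /eqP := cd; rewrite eqf_sqr => /orP[/eqP e|/eqP e].
  by exists c, d; split; nra.
by exists c, (- d); split; nra.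
Qed.

(* In complex terms: [J] is the scalar [i], [G] the real part of a complex
   quadratic form on C^2, and [E] a generator of its Lie algebra so(2, C). *)
Definition rotation J G E :=
  [/\ E *m E = - 1%:M, E *m J = J *m E & E *m G = - (G *m E^T)].

Lemma trace_complex_structure J : J *m J = - 1%:M -> \tr J = 0.
Proof.
move=> /complex_normal_form [B uB BJ].
have -> : J = invmx B *m (J4 *m B) by rewrite -BJ mulKmx.
rewrite mxtrace_mulC -mulmxA mulmxV // mulmx1 /J4 /mxtrace !big_ord_recl big_ord0 !mxE /=.
by rewrite !addr0.
Qed.

Lemma unitmx_sqrN n (A : 'M[R]_n) : A *m A = - 1%:M -> A \in unitmx.
Proof.
move=> h; have : A *m (- A) = 1%:M by rewrite mulmxN h opprK.
by case/mulmx1_unit.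
Qed.

Lemma unitmx_neq0 n (A : 'M[R]_n.+1) : A \in unitmx -> A != 0.
Proof. by apply: contraTneq => ->; rewrite unitmxE det0 unitr0. Qed.

(** Multiplication by [G] turns [E] into an alternating complex form, to which [skew_commuting_dim1]
    applies. *)
Lemma rotation_skew J G E : G^T = G -> G \in unitmx -> J *m G = G *m J^T -> rotation J G
  E ->
  [/\ (E *m G)^T = - (E *m G), J *m (E *m G) = (E *m G) *m J^T & E *m G != 0].
Proof.
move=> sG uG JG [EE EJ EG]; split.
- by rewrite trmx_mul sG EG opprK.
- by rewrite mulmxA -EJ -mulmxA JG mulmxA.
- by apply: unitmx_neq0; rewrite unitmx_mul uG (unitmx_sqrN EE).
Qed.

Lemma intertwine_inv n (Y A B : 'M[R]_n) : Y \in unitmx -> A *m Y = Y *m B ->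
  B *m invmx Y = invmx Y *m A.
Proof.
by move=> uY e; apply: (can_inj (mulKmx uY)); rewrite mulKVmx // mulmxA -e mulmxK.
Qed.

(** Any nonzero alternating form [Y] yields [K = Y G^-1] in so(2, C). As [G Y^-1 G] is again
    alternating, it is [(a + b J) Y], which says [(a + b J) K^2 = 1]. A complex square root c + d J
    of -(a + b J) then makes [(c + d J) K] square to -1. *)
Lemma rotation_exists J G : J *m J = - 1%:M -> G^T = G -> G \in unitmx ->
  J *m G = G *m J^T -> exists E, rotation J G E.
Proof.
move=> JJ sG uG JG; have [B uB BJ] := complex_normal_form JJ.
pose Y := invmx B *m skew4 1 0 *m (invmx B)^T.
have uY : Y \in unitmx.
  have uS : skew4 1 0 \in @unitmx R 4.
    have : skew4 1 0 *m (- skew4 1 0) = 1%:M :> 'M[R]_4.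
      by rewrite mulmxN /skew4 mx4M mx4N mx4_scalar; mx4_congr; rewrite /=; ring.
    by case/mulmx1_unit.
  by rewrite /Y !unitmx_mul unitmx_tr unitmx_inv uB uS.
have sY : Y^T = - Y.
  rewrite /Y !trmx_mul trmxK mulmxA -mulNmx -mulmxN; congr (_ *m _ *m _).
  by rewrite /skew4 mx4T mx4N; mx4_congr; rewrite /=; ring.
have JB : J *m invmx B = invmx B *m J4.
  exact: intertwine_inv uB (esym BJ).
have JY : J *m Y = Y *m J^T.
  have -> : Y *m J^T = invmx B *m (skew4 1 0 *m J4^T) *m (invmx B)^T.
    by rewrite /Y -!mulmxA -trmx_mul JB trmx_mul.
  rewrite /Y !mulmxA JB; congr (_ *m _); rewrite -!mulmxA; congr (_ *m _).
  by rewrite /J4 /skew4 mx4T !mx4M; mx4_congr; rewrite /=; ring.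
clearbody Y; have YJ : J^T *m invmx Y = invmx Y *m J.
  exact: intertwine_inv uY JY.
have GJ : J^T *m invmx G = invmx G *m J.
  exact: intertwine_inv uG JG.
pose X := G *m invmx Y *m G.
have iN : invmx (- Y) = - invmx Y.
  have uN : - Y \in unitmx by rewrite -sY unitmx_tr.
  by rewrite -[RHS]mulmx1 -(mulmxV uN) mulmxA mulNmx mulmxN opprK mulVmx // mul1mx.
have sX : X^T = - X.
  by rewrite /X !trmx_mul sG trmx_inv sY iN mulNmx mulmxN mulmxA.
have JX : J *m X = X *m J^T.
  by rewrite /X !mulmxA JG -(mulmxA G) YJ -!mulmxA JG.
have [a [b EX]] := skew_commuting_dim1 JJ sX JX sY JY (unitmx_neq0 uY).
pose K := Y *m invmx G.
have KG : K *m G = Y by rewrite /K mulmxKV.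
have KJ : K *m J = J *m K by rewrite /K mulmxA JY -!mulmxA GJ.
have K2 : cmx J a b *m (K *m K) = 1%:M.
  rewrite /K !mulmxA -EX /X (mulmxK uG) -(mulmxA G) mulVmx // mulmx1 mulmxV //.
clearbody K; have [c [d [Ec Ed]]] := sqrt_complex (- a) (- b).
have cK : cmx J c d *m K = K *m cmx J c d.
  by rewrite /cmx mulmxDl mulmxDr scalar_mxC -scalemxAl -scalemxAr KJ.
exists (cmx J c d *m K); split.
- rewrite -mulmxA (mulmxA K) -cK -(mulmxA _ K K) (mulmxA (cmx J c d) (cmx J c d)) cmxM //
  Ec Ed.
  by rewrite -K2 -mulNmx /cmx raddfN scaleNr opprD.
- by rewrite -mulmxA KJ !mulmxA; congr (_ *m _); rewrite /cmx mulmxDl mulmxDr scalar_mxC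
  -scalemxAl -scalemxAr.
- have GK : G *m K^T = - Y by rewrite -sY -KG trmx_mul sG.
  rewrite -mulmxA KG trmx_mul mulmxA GK mulNmx opprK.
  by rewrite /cmx linearD /= tr_scalar_mx linearZ /= mulmxDl mulmxDr scalar_mxC
    -scalemxAl -scalemxAr JY.
Qed.

(** The Lie algebra so(2, C) is a complex line. *)
Lemma rotation_span J G E E' : J *m J = - 1%:M -> G^T = G -> G \in unitmx ->
  J *m G = G *m J^T -> rotation J G E -> (E' *m G)^T = - (E' *m G) ->
  J *m (E' *m G) = (E' *m G) *m J^T -> exists a b, E' = cmx J a b *m E.
Proof.
move=> JJ sG uG JG rE sE' cE'; have [s c n] := rotation_skew sG uG JG rE.
have [a [b h]] := skew_commuting_dim1 JJ sE' cE' s c n.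
by exists a, b; apply: (can_inj (mulmxK uG)); rewrite -mulmxA.
Qed.

Lemma cmxM_rotation J G E a b c d : J *m J = - 1%:M -> rotation J G E ->
  (cmx J a b *m E) *m (cmx J c d *m E) = - cmx J (a * c - b * d) (a * d + b * c).
Proof.
move=> JJ [EE EJ _].
have cE : E *m cmx J c d = cmx J c d *m E.
  by rewrite /cmx mulmxDl mulmxDr scalar_mxC -scalemxAl -scalemxAr EJ.
by rewrite -mulmxA (mulmxA E) cE -(mulmxA _ E E) EE mulmxN mulmx1 mulmxN cmxM.
Qed.

(** [E'] is a complex multiple of [E] by some z with z^2 = 1, and C has only the two roots 1 and
    -1. *)
Lemma rotation_unique J G E E' : J *m J = - 1%:M -> G^T = G -> G \in unitmx ->
  J *m G = G *m J^T -> rotation J G E -> rotation J G E' -> E' = E \/ E' = - E.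
Proof.
move=> JJ sG uG JG rE rE'; have [s c _] := rotation_skew sG uG JG rE'.
have [a [b h]] := rotation_span JJ sG uG JG rE s c.
have [EE _ _] := rE'.
have : cmx J (a * a - b * b - 1) (a * b + b * a) = 0.
  move: EE; rewrite h (cmxM_rotation _ _ _ _ JJ rE) => /oppr_inj E1.
  by rewrite /cmx raddfB /= addrAC -/(cmx J _ _) E1 subrr.
move=> /(cmx_eq0 JJ) [e1 e2].
have /eqP : a * b = 0 by nra.
rewrite mulf_eq0 => /orP[/eqP a0|/eqP b0].
  have : (1 : R) <= 0 by rewrite a0 in e1; nra.
  by rewrite ler10.
have /eqP : (a - 1) * (a + 1) = 0 by rewrite b0 in e1; nra.
rewrite mulf_eq0 subr_eq0 addr_eq0 h b0 /cmx scale0r addr0 mul_scalar_mx.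
by case/orP => /eqP ->; [left; rewrite scale1r|right; rewrite scaleN1r].
Qed.

Lemma rotation_commutant (H : set 'M[R]_4) J G E : J *m J = - 1%:M -> G \in unitmx ->
  J *m G = G *m J^T -> rotation J G E -> commutant H J -> commutant H E ->
  ~ division_commutant H.
Proof.
move=> JJ uG JG [EE EJ EG] cJ cE dH.
have E2 : (E *m J - 1%:M) *m (E *m J + 1%:M) = 0.
  rewrite mulmxDr mulmxBl mulmx1 mul1mx -mulmxA (mulmxA J) -EJ -(mulmxA E J J) JJ mulmxN
    mulmxN mulmx1 EE opprK.
  by rewrite addrA subrK subrr.
have eEJ : E = - (E *m J) *m J by rewrite mulNmx -mulmxA JJ mulmxN mulmx1 opprK.
have cN := commutantB (commutantM cE cJ) (@commutant_scalar _ _ H 1).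
have JG0 : J *m G != 0 by apply: unitmx_neq0; rewrite unitmx_mul (unitmx_sqrN JJ).
(* A [J] both skew and self-adjoint would give [J *m G = 0]. If [E *m J] were 1 or -1, then [E]
   would be [- J] or [J] and put [J] in this position. *)
have abs : J *m G = - (G *m J^T) -> False.
  rewrite -JG => /eqP; rewrite -addr_eq0 -mulr2n -scaler_nat scaler_eq0 pnatr_eq0 /=.
  by rewrite (negPf JG0).
have [/eqP|/eqP] := division_mul0 dH cN E2.
  rewrite subr_eq0 => /eqP h; rewrite h mulNmx mul1mx in eEJ.
  by apply: abs; move: EG; rewrite eEJ mulNmx linearN /= mulmxN opprK => <-; rewrite opprK.
rewrite addr_eq0 => /eqP h; rewrite h opprK mul1mx in eEJ.
by apply: abs; rewrite -[in LHS]eEJ EG eEJ.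
Qed.

Lemma rotation_transport F J J' G G' E : F \in unitmx -> F *m J' = J *m F ->
  F *m G' *m F^T = G -> rotation J G E -> rotation J' G' (invmx F *m E *m F).
Proof.
move=> uF FJ FG [EE EJ EG]; split.
- rewrite -!mulmxA (mulmxA F) mulmxV // mul1mx (mulmxA E) EE mulNmx mulmxN mul1mx mulVmx //.
- rewrite !mulmxA (intertwine_inv uF (esym FJ)) -(mulmxA _ F J') FJ !mulmxA.
  by rewrite -(mulmxA _ E J) EJ mulmxA.
- have uFT : F^T \in unitmx by rewrite unitmx_tr.
  apply: (can_inj (mulmxK uFT)); apply: (can_inj (mulKmx uF)).
  have iT : (invmx F)^T *m F^T = 1%:M by rewrite -trmx_mul mulmxV // trmx1.
  have FG' : F *m (G' *m F^T) = G by rewrite mulmxA.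
  rewrite /= mulNmx mulmxN !trmx_mul -!mulmxA iT mulmx1 mulKVmx // FG' EG.
  by rewrite (mulmxA G') (mulmxA F) FG'.
Qed.

End Rotation.

(** * Quaternionic structures *)

Section Quaternions.
Context {R : realType}.
Implicit Types (A G I J P : 'M[R]_4).

Definition self_adjoint G A := A *m G = G *m A^T.

Lemma self_adjoint_scalar G a : self_adjoint G a%:M.
Proof. by rewrite /self_adjoint tr_scalar_mx scalar_mxC. Qed.

Lemma self_adjointD G A B : self_adjoint G A -> self_adjoint G B -> self_adjoint G (A + B).
Proof. by rewrite /self_adjoint linearD /= mulmxDl mulmxDr => -> ->. Qed.

Lemma self_adjointZ G a A : self_adjoint G A -> self_adjoint G (a *: A).
Proof. by rewrite /self_adjoint linearZ /= -scalemxAl -scalemxAr => ->. Qed.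

(* The squares of [I + J] and [I - J] are again combinations of [1], [I] and
   [J]; comparing them shows that the anticommutator is a scalar, and
   orthogonalizing [J] against [I] makes it vanish. *)
Lemma quaternions_exist (H : set 'M[R]_4) G A B : division_commutant H ->
  commutant H A -> commutant H B -> self_adjoint G A -> self_adjoint G B ->
  (forall a b c, a%:M + b *: A + c *: B = 0 -> [/\ a = 0, b = 0 & c = 0]) ->
  exists I J, [/\ commutant H I, commutant H J, self_adjoint G I & self_adjoint G J] /\
    [/\ I *m I = - 1%:M, J *m J = - 1%:M & I *m J = - (J *m I)].
Proof.
move=> dH cA cB sA sB ind.
have [[a Ea]|[a [b [I [b0 cI II EA]]]]] := division_scalar_or_complex dH cA.
  have [] := ind (- a) 1 0; first by rewrite scale0r addr0 scale1r Ea raddfN addNr.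
  by move=> _ /eqP; rewrite oner_eq0.
have [[c Ec]|[c [d [J [d0 cJ JJ EB]]]]] := division_scalar_or_complex dH cB.
  have [] := ind (- c) 0 1; first by rewrite scale0r addr0 scale1r Ec raddfN addNr.
  by move=> _ _ /eqP; rewrite oner_eq0.
have EI : I = (- (a / b))%:M + b^-1 *: A.
  by rewrite EA scalerDr scalerA mulVf // scale1r scale_scalar_mx addrA -raddfD /= [b^-1
    * a]mulrC addNr raddf0 add0r.
have EJ : J = (- (c / d))%:M + d^-1 *: B.
  by rewrite EB scalerDr scalerA mulVf // scale1r scale_scalar_mx addrA -raddfD /= [d^-1
    * c]mulrC addNr raddf0 add0r.
have sI : self_adjoint G I.
  by rewrite EI; apply: self_adjointD; [exact: self_adjoint_scalar|exact: self_adjointZ].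
have sJ : self_adjoint G J.
  by rewrite EJ; apply: self_adjointD; [exact: self_adjoint_scalar|exact: self_adjointZ].
have ind' x y z : x%:M + y *: I + z *: J = 0 -> [/\ x = 0, y = 0 & z = 0].
  move=> E; have [] := ind (x - y * (a / b) - z * (c / d)) (y / b) (z / d).
    rewrite -E [in RHS]EI [in RHS]EJ; apply/matrixP => i j; rewrite !mxE.
    by case: (i == j); rewrite ?mulr1n ?mulr0n; ring.
  move=> h1 /eqP; rewrite mulf_eq0 invr_eq0 (negPf b0) orbF => /eqP y0.
  move=> /eqP; rewrite mulf_eq0 invr_eq0 (negPf d0) orbF => /eqP z0.
  by move: h1; rewrite y0 z0 !mul0r !subr0 => ->.
have quad N : commutant H N -> exists r s, N *m N = r *: N + s%:M.
  move=> cN; have [p [q E]] := division_quadratic dH cN.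
  exists (2 * p), (- (p ^+ 2 + q ^+ 2)).
  have -> : N *m N = (N - p%:M) *m (N - p%:M) + (2 * p) *: N - (p ^+ 2)%:M.
    rewrite mulmxBl !mulmxBr mul_scalar_mx mul_mx_scalar -scalar_mxM -expr2.
    by apply/matrixP => i j; rewrite !mxE; ring.
  rewrite E addrAC [LHS]addrC; congr (_ + _); apply/matrixP => i j; rewrite !mxE.
  by case: (i == j); rewrite ?mulr1n ?mulr0n; ring.
have [r [s E1]] := quad _ (commutantD cI cJ).
have [r' [s' E2]] := quad _ (commutantB cI cJ).
(* The squares of [I + J] and [I - J] add up to -4; written as combinations of 1, [I] and [J] they
   give this relation, hence [r = r' = 0]. *)
have [] := ind' (s + s' + 4) (r + r') (r - r').
  have : (I + J) *m (I + J) + (I - J) *m (I - J) = - 4%:M.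
    rewrite !(mulmxDl, mulmxDr, mulmxN, mulNmx, opprK) II JJ.
    apply/matrixP => i j; rewrite !mxE.
    by case: (i == j); rewrite ?mulr1n ?mulr0n; ring.
  rewrite E1 E2 => /eqP; rewrite -addr_eq0 => /eqP <-.
  apply/matrixP => i j; rewrite !mxE.
  by case: (i == j); rewrite ?mulr1n ?mulr0n; ring.
move=> _ rr rr'; have r0 : r = 0 by lra.
(* From [(I + J)^2 = s] the anticommutator of [I] and [J] is s + 2; adding [t I] to [J] cancels it
   because [I^2 = -1]. *)
pose t := (s + 2) / 2.
have anti : I *m J + J *m I = (2 * t)%:M.
  move: E1; rewrite r0 scale0r add0r mulmxDl !mulmxDr II JJ => /matrixP E1.
  apply/matrixP => i j; have := E1 i j; rewrite /t !mxE.
  by case: (i == j); rewrite ?mulr1n ?mulr0n => h; lra.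
pose J' := J + t *: I.
have cJ' : commutant H J' by apply: commutantD => //; exact: commutantZ.
have IJ' : I *m J' = - (J' *m I).
  apply/eqP; rewrite -addr_eq0 /J' mulmxDr mulmxDl addrACA anti -scalemxAl -scalemxAr II.
  apply/eqP/matrixP => i j; rewrite !mxE.
  by case: (i == j); rewrite ?mulr1n ?mulr0n; ring.
have J'2 : J' *m J' = (t ^+ 2 - 1)%:M.
  rewrite /J' mulmxDl !mulmxDr -!scalemxAl -!scalemxAr JJ II.
  have -> : J *m I = (2 * t)%:M - I *m J by rewrite -anti addrC addKr.
  apply/matrixP => i j; rewrite !mxE.
  by case: (i == j); rewrite ?mulr1n ?mulr0n; ring.
(* Otherwise [J'] has the same square as a real scalar [q], so it equals [q] or [- q], against
   independence. *)
have t1 : t ^+ 2 < 1.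
  rewrite ltNge; apply/negP => t1; pose q := Num.sqrt (t ^+ 2 - 1).
  have q2 : q ^+ 2 = t ^+ 2 - 1 by rewrite sqr_sqrtr // subr_ge0.
  have : (J' - q%:M) *m (J' + q%:M) = 0.
    rewrite mulmxDr !mulmxBl scalar_mxC J'2 -q2 -scalar_mxM -expr2.
    by rewrite addrA subrK subrr.
  move=> /(division_mul0 dH (commutantB cJ' (@commutant_scalar _ _ H q))) [] E.
    have [] := ind' (- q) t 1; first by rewrite -E scale1r raddfN /J' addrC addrA addrAC.
    by move=> _ _ /eqP; rewrite oner_eq0.
  have [] := ind' q t 1; first by rewrite -E scale1r /J' addrC addrA addrAC.
  by move=> _ _ /eqP; rewrite oner_eq0.
pose k := (Num.sqrt (1 - t ^+ 2))^-1.
have k2 : k ^+ 2 * (1 - t ^+ 2) = 1.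
  by rewrite exprVn sqr_sqrtr ?mulVf // ?subr_ge0 ?ltW // subr_eq0 eq_sym lt_eqF.
exists I, (k *: J'); split; split => //.
- exact: commutantZ.
- by apply: self_adjointZ; apply: self_adjointD => //; exact: self_adjointZ.
- rewrite -scalemxAl -scalemxAr J'2 scalerA scale_scalar_mx -raddfN; congr (_%:M).
  by rewrite -expr2 -[LHS]opprK -mulrN opprB k2.
- by rewrite -scalemxAl -scalemxAr IJ' scalerN.
Qed.

(* The matrices of I and J in a basis u, uI, uJ, uIJ. *)
Definition I4 : 'M[R]_4 := mx4 [:: [:: 0; 1; 0; 0]; [:: -1; 0; 0; 0]; [:: 0; 0; 0; -1];
  [:: 0; 0; 1; 0]].
Definition K4 : 'M[R]_4 := mx4 [:: [:: 0; 0; 1; 0]; [:: 0; 0; 0; 1]; [:: -1; 0; 0; 0];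
  [:: 0; -1; 0; 0]].

(** Left multiplication by e0 + e1 i + e2 j + e3 k on rows of quaternion coefficients; [I4] and [K4]
    are the right multiplications by i and j. *)
Definition left_quaternion e0 e1 e2 e3 : 'M[R]_4 := mx4 [:: [:: e0; e1; e2; e3];
  [:: - e1; e0; e3; - e2]; [:: - e2; - e3; e0; e1]; [:: - e3; e2; - e1; e0]].

(** A map commuting with right multiplications is left multiplication by the image of 1, the first
    row of [P]. *)
Lemma commute_I4_K4 P : P *m I4 = I4 *m P -> P *m K4 = K4 *m P ->
  exists e0 e1 e2 e3, P = left_quaternion e0 e1 e2 e3.
Proof.
have [x00 [x01 [x02 [x03 [x10 [x11 [x12 [x13 [x20 [x21 [x22 [x23 [x30 [x31 [x32 [x33
  ->]]]]]]]]]]]]]]]] := mx4_eta P.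
rewrite /I4 /K4 !mx4M => /mx4_inj S /mx4_inj C.
exists x00, x01, x02, x03; rewrite /left_quaternion.
have := (S 0 0 isT isT, S 0 1 isT isT, S 0 2 isT isT, S 0 3 isT isT, S 2 0 isT isT, S 2 1
  isT isT, S 2 2 isT isT, S 2 3 isT isT)%N.
have := (C 0 0 isT isT, C 0 1 isT isT, C 0 2 isT isT, C 0 3 isT isT, C 1 0 isT isT, C 1 1
  isT isT, C 1 2 isT isT, C 1 3 isT isT)%N.
rewrite /= !(mul0r, mul1r, mulr0, mulr1, add0r, addr0, mulrN, mulNr, oppr0) => C' S';
  clear S C.
repeat match goal with H : prod _ _ |- _ => destruct H end.
by mx4_congr; lra.
Qed.

(** The symmetric forms for which [I4] and [K4] are self-adjoint: a three-parameter family, matched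
    by [form4E] with the imaginary quaternions. *)
Definition form4 a b c : 'M[R]_4 :=
  mx4 [:: [:: a; b; c; 0]; [:: b; - a; 0; c]; [:: c; 0; - a; - b]; [:: 0; c; - b; a]].

Lemma self_adjoint_I4_K4 G : G^T = G -> self_adjoint G I4 -> self_adjoint G K4 ->
  exists a b c, G = form4 a b c.
Proof.
have [x00 [x01 [x02 [x03 [x10 [x11 [x12 [x13 [x20 [x21 [x22 [x23 [x30 [x31 [x32 [x33
  ->]]]]]]]]]]]]]]]] := mx4_eta G.
rewrite /self_adjoint /I4 /K4 !mx4T !mx4M => /mx4_inj T /mx4_inj S /mx4_inj C.
exists x00, x01, x02; rewrite /form4.
have := (S 0 0 isT isT, S 0 1 isT isT, S 0 2 isT isT, S 0 3 isT isT, S 2 0 isT isT, S 2 1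
  isT isT, S 2 2 isT isT, S 2 3 isT isT)%N.
have := (C 0 0 isT isT, C 0 1 isT isT, C 0 2 isT isT, C 0 3 isT isT, C 1 0 isT isT, C 1 1
  isT isT, C 1 2 isT isT, C 1 3 isT isT)%N.
have := (T 0 1 isT isT, T 0 2 isT isT, T 0 3 isT isT, T 1 2 isT isT, T 1 3 isT isT, T 2 3
  isT isT)%N.
rewrite /= !(mul0r, mul1r, mulr0, mulr1, add0r, addr0, mulrN, mulNr, oppr0) => T' C' S';
  clear S C T.
repeat match goal with H : prod _ _ |- _ => destruct H end.
by mx4_congr; lra.
Qed.

(* A constant matrix commuting with all left quaternions, through which every
   invariant form is a left quaternion; see [form4E]. *)
Definition C4 : 'M[R]_4 := mx4 [:: [:: 0; 0; 0; -1]; [:: 0; 0; 1; 0]; [:: 0; -1; 0; 0];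
  [:: 1; 0; 0; 0]].

Lemma form4E a b c : form4 a b c = left_quaternion 0 c (- b) a *m C4.
Proof.
rewrite /form4 /left_quaternion /C4 mx4M.
by mx4_congr; rewrite /=; ring.
Qed.

Lemma left_quaternion_C4 a b c d : left_quaternion a b c d *m C4 = C4 *m left_quaternion
  a b c d.
Proof.
rewrite /left_quaternion /C4 !mx4M.
by mx4_congr; rewrite /=; ring.
Qed.

Lemma left_quaternion_I4 a b c d : left_quaternion a b c d *m I4 = I4 *m left_quaternion
  a b c d.
Proof.
rewrite /left_quaternion /I4 !mx4M.
by mx4_congr; rewrite /=; ring.
Qed.

Lemma left_quaternion_K4 a b c d : left_quaternion a b c d *m K4 = K4 *m left_quaternion
  a b c d.
Proof.
rewrite /left_quaternion /K4 !mx4M.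
by mx4_congr; rewrite /=; ring.
Qed.

Lemma left_quaternionT a b c d :
  (left_quaternion a b c d)^T = left_quaternion a (- b) (- c) (- d).
Proof.
rewrite /left_quaternion mx4T.
by mx4_congr; rewrite /=; ring.
Qed.

Lemma left_quaternion_norm a b c d :
  left_quaternion a (- b) (- c) (- d) *m left_quaternion a b c d = (a ^+ 2 + b ^+ 2 + c
    ^+ 2 + d ^+ 2)%:M.
Proof.
rewrite /left_quaternion mx4_scalar mx4M.
by mx4_congr; rewrite /=; ring.
Qed.

(** A quaternion times its conjugate is its norm, so a nonzero quaternion does not annihilate [u];
    hence [u], [uI], [uJ], [uIJ] are independent. *)
Lemma quaternion_normal_form I J : I *m I = - 1%:M -> J *m J = - 1%:M -> I *m J = - (J *m
  I) ->
  exists2 B, B \in unitmx & B *m I = I4 *m B /\ B *m J = K4 *m B.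
Proof.
move=> II JJ IJ; pose u : 'rV[R]_4 := delta_mx 0 0.
have u0 : u != 0 by apply/eqP => /rowP /(_ 0); rewrite !mxE /= => /eqP; rewrite oner_eq0.
exists (\matrix_k nth 0 [:: u; u *m I; u *m J; u *m (I *m J)] k).
  apply: unitmx_of_inj => v; rewrite row_mx4.
  set a := v 0 (inord 0); set b := v 0 (inord 1); set c := v 0 (inord 2); set d := v 0
    (inord 3).
  pose Q p q r s := p%:M + q *: I + r *: J + s *: (I *m J).
  have -> : a *: u + b *: (u *m I) + c *: (u *m J) + d *: (u *m (I *m J)) = u *m Q a b c d.
    by rewrite /Q !mulmxDr mul_mx_scalar -!scalemxAr.
  have JI : J *m I = - (I *m J) by rewrite IJ opprK.
  have KI : I *m J *m I = J by rewrite -mulmxA JI mulmxN mulmxA II mulNmx mul1mx opprK.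
  have KJ : I *m J *m J = - I by rewrite -mulmxA JJ mulmxN mulmx1.
  have IK : I *m (I *m J) = - J by rewrite mulmxA II mulNmx mul1mx.
  have JK : J *m (I *m J) = I by rewrite mulmxA JI mulNmx KJ opprK.
  have KK : I *m J *m (I *m J) = - 1%:M by rewrite mulmxA KI JJ.
  have N : Q a b c d *m Q a (- b) (- c) (- d) = (a ^+ 2 + b ^+ 2 + c ^+ 2 + d ^+ 2)%:M.
    rewrite /Q !mulmxDl !mulmxDr -!scalemxAl -!scalemxAr !mul_mx_scalar !mul_scalar_mx KI
      KJ IK JK KK II JJ JI.
    apply/matrixP => i j; rewrite !mxE.
    by case: (i == j); rewrite ?mulr1n ?mulr0n; ring.
  move=> E; have : u *m (Q a b c d *m Q a (- b) (- c) (- d)) = 0 by rewrite mulmxA E mul0mx.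
  rewrite N mul_mx_scalar => /eqP; rewrite scaler_eq0 (negPf u0) orbF => /eqP h.
  by apply: row4_eq0; rewrite -?/a -?/b -?/c -?/d; nra.
split; apply/row_matrixP => i; rewrite !row_mul row_mx4 rowK;
  case: i => [[|[|[|[|//]]]] hi]; rewrite !mxE /= !inordK //= ?scale0r ?scale1r ?scaleN1r
    ?addr0 ?add0r //.
- by rewrite -mulmxA II mulmxN mulmx1.
- by rewrite -mulmxA IJ mulmxN opprK.
- by rewrite -!mulmxA -[J *m I]opprK -IJ mulmxN (mulmxA I I) II mulNmx mul1mx opprK.
- by rewrite mulmxA.
- by rewrite -mulmxA JJ mulmxN mulmx1.
- by rewrite -!mulmxA JJ !mulmxN mulmx1.
Qed.

(* The isometries commuting with [I] and [J] form SO*(2) = U(1), and [E]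
   generates its Lie algebra. *)
Lemma quaternion_commutant I J G : G^T = G -> G \in unitmx ->
  I *m I = - 1%:M -> J *m J = - 1%:M -> I *m J = - (J *m I) ->
  self_adjoint G I -> self_adjoint G J ->
  exists E s, [/\ 0 < s, E *m E = - s%:M, E *m I = I *m E, E *m J = J *m E &
    forall P, P *m I = I *m P -> P *m J = J *m P -> P *m G *m P^T = G -> P *m E = E *m P].
Proof.
move=> sG uG II JJ IJ sI sJ; have [B uB [BI BJ]] := quaternion_normal_form II JJ IJ.
have uBT : B^T \in unitmx by rewrite unitmx_tr.
pose G' := B *m G *m B^T.
have sG' : G'^T = G' by rewrite /G' !trmx_mul trmxK sG mulmxA.
have tr_self (A A' : 'M[R]_4) : B *m A = A' *m B -> self_adjoint G A -> self_adjoint G' A'.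
  rewrite /self_adjoint /G' => BA sA.
  have BAT : A^T *m B^T = B^T *m A'^T by rewrite -!trmx_mul BA.
  by rewrite !mulmxA -BA -(mulmxA B A) sA -!mulmxA BAT.
have [a [b [c EG']]] := self_adjoint_I4_K4 sG' (tr_self _ _ BI sI) (tr_self _ _ BJ sJ).
(* The quaternion attached to the form by [form4E]; it is imaginary, so its square is minus its
   norm. *)
pose E' := left_quaternion 0 c (- b) a; pose s := c ^+ 2 + b ^+ 2 + a ^+ 2.
have E'2 : E' *m E' = - s%:M.
  have := left_quaternion_norm 0 c (- b) a.
  have -> : left_quaternion 0 (- c) (- - b) (- a) = - E'.
    rewrite /E' /left_quaternion mx4N.
    by mx4_congr; rewrite /=; ring.
  by rewrite mulNmx expr0n add0r sqrrN -/s -/E' => <-; rewrite opprK.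
have s0 : 0 < s.
  rewrite lt_neqAle !addr_ge0 ?sqr_ge0 // andbT eq_sym; apply/eqP => s0.
  have [a0 [b0 c0]] : a = 0 /\ b = 0 /\ c = 0 by rewrite /s in s0; split; [nra|split; nra].
  have : G' != 0 by apply: unitmx_neq0; rewrite /G' !unitmx_mul uB uG uBT.
  have -> : G' = 0%:M by rewrite EG' a0 b0 c0 /form4 mx4_scalar !oppr0.
  by rewrite raddf0 eqxx.
pose E := invmx B *m E' *m B.
have BE : B *m E = E' *m B by rewrite /E !mulmxA mulmxV // mul1mx.
clearbody E; have inj (X Y : 'M[R]_4) : B *m X = B *m Y -> X = Y by move=> /(can_inj
  (mulKmx uB)).
have injr (X Y : 'M[R]_4) : X *m B = Y *m B -> X = Y by move=> /(can_inj (mulmxK uB)).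
have conj_comm (X Y X' Y' : 'M[R]_4) : B *m X = X' *m B -> B *m Y = Y' *m B ->
    X' *m Y' = Y' *m X' -> X *m Y = Y *m X.
  by move=> hX hY h; apply: inj; rewrite !mulmxA hX hY -!mulmxA hX hY !mulmxA h.
exists E, s; split => //.
- by apply: inj; rewrite mulmxA BE -mulmxA BE mulmxA E'2 mulNmx mulmxN scalar_mxC.
- exact: (conj_comm _ _ _ _ BE BI (left_quaternion_I4 _ _ _ _)).
- exact: (conj_comm _ _ _ _ BE BJ (left_quaternion_K4 _ _ _ _)).
move=> P PI PJ PG; pose P' := B *m P *m invmx B.
have BP : B *m P = P' *m B by rewrite /P' mulmxKV.
have uP : P \in unitmx.
  by move: uG; rewrite -{1}PG !unitmx_mul => /andP[/andP[]].
have P'0 : P' != 0 by apply: unitmx_neq0; rewrite /P' !unitmx_mul unitmx_inv uB uP.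
clearbody P'.
have conj_comm' (X X' : 'M[R]_4) : B *m X = X' *m B -> P *m X = X *m P -> P' *m X' = X'
  *m P'.
  by move=> hX h; apply: injr; rewrite -!mulmxA -BP -hX !mulmxA -BP -hX -!mulmxA h.
have [p0 [p1 [p2 [p3 EP']]]] := commute_I4_K4 (conj_comm' _ _ BI PI) (conj_comm' _ _ BJ PJ).
have PG' : P' *m G' *m P'^T = G'.
  have BPT : B^T *m P'^T = P^T *m B^T by rewrite -!trmx_mul BP.
  by rewrite /G' !mulmxA -BP -[RHS](congr1 (fun X => B *m X *m B^T) PG) -!mulmxA BPT.
apply: (conj_comm _ _ _ _ BP BE).
(* An isometry satisfies [P' E' P'^T = E']. As [P'^T P' = N], this gives [E' P' = N P' E']; applied
   twice it gives N^2 = 1, so N = 1 and [P'] commutes with [E']. *)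
pose N := p0 ^+ 2 + p1 ^+ 2 + p2 ^+ 2 + p3 ^+ 2.
have PN : P'^T *m P' = N%:M by rewrite EP' left_quaternionT left_quaternion_norm.
have PEP : P' *m E' *m P'^T = E'.
  have uC : C4 \in @unitmx R 4.
    by have : G' \in unitmx; [rewrite /G' !unitmx_mul uB uG|rewrite EG' form4E unitmx_mul
      => /andP[]].
  apply: (can_inj (mulmxK uC)); rewrite /= -form4E -EG' -[RHS]PG' EG' form4E -/E'.
  by rewrite -!mulmxA EP' left_quaternionT left_quaternion_C4.
have EPN : E' *m P' = N *: (P' *m E').
  by rewrite -mul_mx_scalar -PN mulmxA PEP.
have : (N ^+ 2 - 1) * s == 0.
  have : ((N ^+ 2 - 1) * s) *: P' = 0.
    have : E' *m (E' *m P') = N ^+ 2 *: (P' *m (E' *m E')).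
      by rewrite EPN -scalemxAr mulmxA EPN -scalemxAl scalerA -expr2 mulmxA.
    rewrite mulmxA E'2 mulNmx mulmxN mul_scalar_mx mul_mx_scalar scalerN => /oppr_inj h.
    by rewrite mulrBl scalerBl mul1r -scalerA -h subrr.
  by move/eqP; rewrite scaler_eq0 (negPf P'0) orbF.
rewrite mulf_eq0 (gt_eqF s0) orbF => /eqP N1.
have N0 : 0 <= N by rewrite !addr_ge0 ?sqr_ge0.
have N1' : N = 1 by nra.
by rewrite EPN N1' scale1r.
Qed.

Lemma not_division_quaternion (H : set 'M[R]_4) I J G : G^T = G -> G \in unitmx ->
  I *m I = - 1%:M -> J *m J = - 1%:M -> I *m J = - (J *m I) ->
  self_adjoint G I -> self_adjoint G J -> commutant H I -> commutant H J ->
  (forall P, H P -> P *m G *m P^T = G) -> ~ division_commutant H.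
Proof.
move=> sG uG II JJ IJ sI sJ cI cJ hG dH.
have [E [s [s0 EE EI EJ hE]]] := quaternion_commutant sG uG II JJ IJ sI sJ.
have cE : commutant H E by move=> P HP; apply: hE; [exact: cI|exact: cJ|exact: hG].
pose q := Num.sqrt s; have q2 : q ^+ 2 = s by rewrite sqr_sqrtr // ltW.
have q0 : q != 0 by rewrite sqrtr_eq0 -ltNge.
(* A scalar [I *m E] would make [E] a multiple of [I], which anticommutes with [J], while [E]
   commutes with it. *)
have abs r : r != 0 -> I *m E = r%:M -> False.
  move=> r0 h; have EI' : E = - r *: I.
    have := congr1 (mulmx I) h; rewrite mulmxA II mulNmx mul1mx mul_mx_scalar scaleNr => <-.
    by rewrite opprK.
  move: EJ; rewrite EI' -scalemxAl -scalemxAr IJ scalerN => /eqP.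
  rewrite eq_sym -addr_eq0 -mulr2n -scaler_nat !scaler_eq0 pnatr_eq0 oppr_eq0 (negPf r0) /=.
  by apply/negP/unitmx_neq0; rewrite unitmx_mul !unitmx_sqrN.
have prod0 : (I *m E - q%:M) *m (I *m E + q%:M) = 0.
  rewrite mulmxDr !mulmxBl -(mulmxA I E) (mulmxA E I) EI -(mulmxA I E E) mulmxA II EE.
  rewrite mulNmx mulmxN opprK mul1mx scalar_mxC -scalar_mxM -expr2 q2.
  by rewrite addrA subrK subrr.
have cIE := commutantB (commutantM cI cE) (@commutant_scalar _ _ H q).
have [/eqP|/eqP] := division_mul0 dH cIE prod0.
  by rewrite subr_eq0 => /eqP; exact: abs.
by rewrite addr_eq0 -raddfN => /eqP; apply: abs; rewrite oppr_eq0.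
Qed.

End Quaternions.

(** * Double coverings over a square *)

Section Sign_cocycles.

(* For a two-sheeted covering with an arbitrary point chosen in each fibre,
   [eps y z] tells whether the points over [y] and [z] lie on the same local
   sheet; it is meaningful only for [z] near [y].  A section corrects the chosen
   points by signs so that they form a continuous family. *)
Definition sign_cocycle (X : topologicalType) (eps : X -> X -> bool) :=
  forall y, \forall z \near y, \forall w \near z,
    eps y w (+) eps z w = eps y z (+) eps z z.

Definition sign_section (X : topologicalType) (eps : X -> X -> bool) (A : set X) (s : X
  -> bool) :=
  forall t, A t -> \forall u \near t, A u -> s u (+) eps t u = s t (+) eps t t.

Lemma sign_cocycle_comp (X Y : topologicalType) (f : X -> Y) eps : continuous f ->
  sign_cocycle eps -> sign_cocycle (fun x y => eps (f x) (f y)).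
Proof.
move=> cf ce y; have := cf y _ (ce (f y)); rewrite /= => h.
by near=> z; have : \forall w \near f z, eps (f y) w (+) eps (f z) w = eps (f y) (f z)
  (+) eps (f z) (f z);
  [near: z; exact: h|exact: cf].
Unshelve. all: by end_near. Qed.

Lemma sign_section_comp (X Y : topologicalType) (f : X -> Y) eps (A : set X) (B : set Y) s :
  continuous f -> (forall x, A x -> B (f x)) -> sign_section eps B s ->
  sign_section (fun x y => eps (f x) (f y)) A (s \o f).
Proof.
move=> cf AB se t /AB Bt.
have h : \forall u \near t, B (f u) -> s (f u) (+) eps (f t) (f u) = s (f t) (+) eps (f
  t) (f t).
  exact: cf t _ (se _ Bt).
by apply: filterS h => u h /AB; exact: h.
Qed.

Lemma sign_section_sub (X : topologicalType) (eps : X -> X -> bool) (A B : set X) s :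
  B `<=` A -> sign_section eps A s -> sign_section eps B s.
Proof. by move=> BA se t /BA /se; apply: filterS => u h /BA; exact: h. Qed.

(** The cocycle condition at [y] says that [eps y] itself is a section near [y]. *)
Lemma sign_section_local (X : topologicalType) (eps : X -> X -> bool) y : sign_cocycle
  eps ->
  exists2 U, nbhs y U & sign_section eps U (eps y).
Proof.
move=> ce; exists [set z | \forall w \near z, eps y w (+) eps z w = eps y z (+) eps z z].
  exact: ce.
by move=> t Ut; apply: filterS Ut.
Qed.

(** Two lifts differ by a deck transformation, which is locally constant. *)
Lemma sign_sections_diff (X : topologicalType) (eps : X -> X -> bool) (A : set X) s s' :
  connected A -> sign_section eps A s -> sign_section eps A s' ->
  forall x y, A x -> A y -> s x (+) s' x = s y (+) s' y.
Proof.
move=> cA ss ss'; apply: (connected_locally_constant (f := fun x => s x (+) s' x)) => //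
  x Ax.
apply: filterS2 (ss x Ax) (ss' x Ax) => y h h' Ay.
by move: (h Ay) (h' Ay); case: (s y) (s' y) (s x) (s' x) (eps x y) (eps x x) => [] [] []
  [] [] [].
Qed.

(** On the connected overlap the two sections differ by a constant sign [k], and [s'] is corrected
    by it. Closedness lets the two conditions be checked separately, because a point outside one set
    has a neighbourhood outside it. *)
Lemma sign_section_glue (X : topologicalType) (eps : X -> X -> bool) (A B : set X) s s' :
  closed A -> closed B -> connected (A `&` B) ->
  sign_section eps A s -> sign_section eps B s' -> exists s'', sign_section eps (A `|` B)
    s''.
Proof.
move=> clA clB cAB sA sB.
have [k hk] : exists k, forall x, A x -> B x -> s x (+) s' x = k.
  have [[x [Ax Bx]]|n] := pselect (exists x, A x /\ B x).
    exists (s x (+) s' x) => y Ay By.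
    apply: (sign_sections_diff cAB) => //; [exact: sign_section_sub sA|exact:
      sign_section_sub sB].
  by exists false => x Ax Bx; case: n; exists x.
pose s'' x := if `[< A x >] then s x else s' x (+) k.
have EA x : A x -> s'' x = s x by move=> /asboolP; rewrite /s'' => ->.
have EB x : B x -> s'' x = s' x (+) k.
  move=> Bx; rewrite /s''; case: asboolP => // Ax.
  by rewrite -(hk x Ax Bx); case: (s x) (s' x) => [] [].
have far (C : set X) t : closed C -> ~ C t -> \forall u \near t, ~ C u.
  by move=> cC nC; apply: open_nbhs_nbhs; split=> //; exact: closed_openC.
exists s'' => t ABt.
have nA : \forall u \near t, A u -> s'' u (+) eps t u = s'' t (+) eps t t.
  have [At|/(far _ _ clA)] := pselect (A t); last by apply: filterS => u nu /nu.
  by apply: filterS (sA t At) => u h Au; rewrite !EA // h.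
have nB : \forall u \near t, B u -> s'' u (+) eps t u = s'' t (+) eps t t.
  have [Bt|/(far _ _ clB)] := pselect (B t); last by apply: filterS => u nu /nu.
  apply: filterS (sB t Bt) => u h Bu; rewrite !EB //; move: (h Bu).
  by case: (s' u) (s' t) (eps t u) (eps t t) (k) => [] [] [] [] [].
by apply: filterS2 nA nB => u hA hB [/hA|/hB].
Qed.

(** Compactness of a segment as an induction principle. The points reachable from [u] have a
    supremum, and a small interval around it can be appended. *)
Lemma interval_induction (R : realType) (P : R -> R -> Prop) :
  (forall x, exists2 d, 0 < d & forall u v, x - d < u -> u <= v -> v < x + d -> P u v) ->
  (forall u m v, u <= m -> m <= v -> P u m -> P m v -> P u v) ->
  forall u v, u <= v -> P u v.
Proof.
move=> loc glue u v uv; pose A : set R := [set t | u <= t <= v /\ P u t].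
have Au : A u.
  split; first by rewrite lexx.
  by have [d d0 h] := loc u; apply: h; rewrite ?lexx // ?ltrBlDr ltrDl.
have ubA : ubound A v by move=> t [/andP[]].
have hs : has_sup A by split; [exists u|exists v].
set s := sup A; have us : u <= s by apply: ub_le_sup => //; exists v.
have sv : s <= v by apply: ge_sup => //; exists u.
have [d d0 h] := loc s.
have [t [/andP[ut tv] Pt] st] := sup_adherent d0 hs.
have ts : t <= s by apply: ub_le_sup; [exists v|split => //; rewrite ut].
(* The point [w] is reachable; unless it is [v], it lies beyond the supremum. *)
pose w := Num.min v (s + d / 2).
have Pw : P u w.
  apply: (glue u t w) => //.
    by rewrite /w le_min tv /= (le_trans ts) // lerDl ltW // divr_gt0.
  apply: h => //; first by rewrite /w le_min tv /= (le_trans ts) // lerDl ltW // divr_gt0.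
  by rewrite /w gt_min ltrD2l ltr_pdivrMr // ltr_pMr // ltr1n orbT.
have [vw|wv] := leP v (s + d / 2); first by move: Pw; rewrite /w (min_idPl vw).
rewrite /w (min_idPr (ltW wv)) in Pw.
have : s + d / 2 <= s.
  apply: ub_le_sup; first by exists v.
  by split => //; rewrite (le_trans us) ?lerDl ?ltW // divr_gt0.
by rewrite gerDl leNgt divr_gt0.
Qed.

End Sign_cocycles.

(** * Sections over rectangles and homotopies *)

Section Square.
Context {R : realType}.
Implicit Types (eps : R * R -> R * R -> bool).

Definition rect (a b c d : R) : set (R * R) := `[a, b]%classic `*` `[c, d]%classic.

Lemma rect_closed a b c d : closed (rect a b c d).
Proof.
apply: closedI; [apply: (closed_comp (f := fst))|apply: (closed_comp (f := snd))].
all: try exact: interval_closed.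
- by move=> x _; exact: cvg_fst.
- by move=> x _; exact: cvg_snd.
Qed.

Lemma continuous_pair (T U V : topologicalType) (f : T -> U) (g : T -> V) :
  continuous f -> continuous g -> continuous (fun x => (f x, g x)).
Proof. by move=> cf cg x; apply: cvg_pair; [exact: cf|exact: cg]. Qed.

Lemma continuous_pairl (m : R) : continuous (fun t : R => (m, t)).
Proof. by apply: continuous_pair => t; [exact: cvg_cst|exact: cvg_id]. Qed.

Lemma continuous_pairr (m : R) : continuous (fun t : R => (t, m)).
Proof. by apply: continuous_pair => t; [exact: cvg_id|exact: cvg_cst]. Qed.

Lemma vertical_connected m c d : connected (rect m m c d).
Proof.
rewrite (_ : rect m m c d = (fun t => (m, t)) @` `[c, d]%classic).
  apply: connected_continuous_connected; first exact: segment_connected.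
  exact/continuous_subspaceT/continuous_pairl.
apply/seteqP; split => [[x y] [/= + h]|_ [t h <-]]; last by split; [rewrite /= in_itv /=
  lexx|exact: h].
by rewrite in_itv /= -eq_le => /eqP <-; exists y.
Qed.

Lemma horizontal_connected m a b : connected (rect a b m m).
Proof.
rewrite (_ : rect a b m m = (fun t => (t, m)) @` `[a, b]%classic).
  apply: connected_continuous_connected; first exact: segment_connected.
  exact/continuous_subspaceT/continuous_pairr.
apply/seteqP; split => [[x y] [/= h +]|_ [t h <-]]; last by split; [exact: h|rewrite /=
  in_itv /= lexx].
by rewrite in_itv /= -eq_le => /eqP <-; exists x.
Qed.

(** Two nested interval inductions: small rectangles are stacked into a thin vertical strip around
    each [x], whose width shrinks at each gluing, and strips are then joined sideways. The overlaps
    are segments, hence connected. *)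
Lemma rect_section eps a b c d : sign_cocycle eps -> a <= b -> c <= d ->
  exists s, sign_section eps (rect a b c d) s.
Proof.
move=> ce ab cd.
have strip x : exists2 e, 0 < e & exists s, sign_section eps (rect (x - e) (x + e) c d) s.
  move: c d cd; apply: interval_induction => [y|u m v um mv [e1 e10 [s1 h1]] [e2 e20 [s2
    h2]]].
    have [U nU sU] := sign_section_local (x, y) ce.
    have [e /= e0 hU] : exists2 e : R, 0 < e & ball (x, y) e `<=` U by apply/nbhs_ballP.
    exists e => // u v yu uv vy; exists (e / 2); first exact: divr_gt0.
    exists (eps (x, y)); apply: sign_section_sub sU => -[p q] [/= hp hq]; apply: hU; split.
      rewrite -ball_normE /ball_ /= ltr_norml; move: hp; rewrite in_itv /= => /andP[]; lra.
    rewrite -ball_normE /ball_ /= ltr_norml; move: hq; rewrite in_itv /= => /andP[]; lra.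
  exists (Num.min e1 e2); first by rewrite lt_min e10.
  have l1 : Num.min e1 e2 <= e1 by rewrite ge_min lexx.
  have l2 : Num.min e1 e2 <= e2 by rewrite ge_min lexx orbT.
  set e := Num.min e1 e2 in l1 l2 *.
  have k1 : sign_section eps (rect (x - e) (x + e) u m) s1.
    apply: sign_section_sub h1 => -[p q] [/= hp hq]; split => //=.
    by move: hp; rewrite !in_itv /= => /andP[? ?]; apply/andP; split; lra.
  have k2 : sign_section eps (rect (x - e) (x + e) m v) s2.
    apply: sign_section_sub h2 => -[p q] [/= hp hq]; split => //=.
    by move: hp; rewrite !in_itv /= => /andP[? ?]; apply/andP; split; lra.
  have [s hs] : exists s, sign_section eps (rect (x - e) (x + e) u m `|` rect (x - e) (x
    + e) m v) s.
    apply: sign_section_glue k1 k2; try exact: rect_closed.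
    rewrite (_ : _ `&` _ = rect (x - e) (x + e) m m); first exact: horizontal_connected.
    apply/seteqP; split => -[p q] /=.
      by move=> [[hp hq] [_ hq']]; split => //=; move: hq hq'; rewrite /= !in_itv /= =>
        /andP[_ ->] /andP[->].
    move=> [hp]; rewrite /= in_itv /= => /andP[h h']; split; split => //=; rewrite in_itv
      /=; apply/andP; split; lra.
  exists s; apply: sign_section_sub hs => -[p q] [/= hp]; rewrite in_itv /= => /andP[uq qv].
  by have [qm|mq] := lerP q m; [left|right]; split => //=; rewrite in_itv /= ?uq ?qv ?qm
    ?(ltW mq).
move: a b ab; apply: interval_induction => [x|u m v um mv [s1 h1] [s2 h2]].
  have [e e0 [s hs]] := strip x; exists e => // u v xu uv vx; exists s.
  apply: sign_section_sub hs => -[p q] [/= hp hq]; split => //=.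
  by move: hp; rewrite !in_itv /= => /andP[? ?]; apply/andP; split; lra.
have [s hs] : exists s, sign_section eps (rect u m c d `|` rect m v c d) s.
  apply: sign_section_glue h1 h2; try exact: rect_closed.
  rewrite (_ : _ `&` _ = rect m m c d); first exact: vertical_connected.
  apply/seteqP; split => -[p q] /=.
    by move=> [[hp hq] [hp' _]]; split => //=; move: hp hp'; rewrite /= !in_itv /= =>
      /andP[_ ->] /andP[->].
  move=> [+ hq]; rewrite /= in_itv /= => /andP[h h']; split; split => //=; rewrite in_itv
    /=; apply/andP; split; lra.
exists s; apply: sign_section_sub hs => -[p q] [/= + hq]; rewrite in_itv /= => /andP[uq qv].
by have [qm|mq] := lerP p m; [left|right]; split => //=; rewrite in_itv /= ?uq ?qv ?qm
  ?(ltW mq).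
Qed.

(** The retraction of R onto [0, 1]; it extends a homotopy that is continuous only within the square
    to the whole plane. *)
Definition clamp (t : R) : R := (1 + `|t| - `|t - 1|) / 2.

Lemma clamp_continuous : continuous clamp.
Proof.
have h : continuous (fun t : R => 1 + `|t| - `|t - 1|).
  move=> t; apply: cvgB.
    by apply: cvgD; [exact: cvg_cst|exact: norm_continuous].
  by apply: cvg_norm; apply: cvgB; [exact: cvg_id|exact: cvg_cst].
by move=> t; apply: cvgM; [exact: h|exact: cvg_cst].
Qed.

Lemma clamp2_continuous : continuous (fun q : R * R => (clamp q.1, clamp q.2)).
Proof.
have c1 : continuous (clamp \o fst : R * R -> R).
  by move=> q; apply: continuous_comp; [exact: cvg_fst|exact: clamp_continuous].
have c2 : continuous (clamp \o snd : R * R -> R).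
  by move=> q; apply: continuous_comp; [exact: cvg_snd|exact: clamp_continuous].
exact: (continuous_pair c1 c2).
Qed.

Lemma clamp_itv t : 0 <= clamp t <= 1.
Proof.
rewrite /clamp; have [t0|t0] := ltP t 0.
  by rewrite ltr0_norm // ltr0_norm ?subr_lt0 ?(lt_trans t0) //; apply/andP; split; lra.
have [t1|t1] := ltP t 1.
  by rewrite ger0_norm // ltr0_norm ?subr_lt0 //; apply/andP; split; lra.
by rewrite ger0_norm // ger0_norm ?subr_ge0 //; apply/andP; split; lra.
Qed.

Lemma clamp_id t : 0 <= t <= 1 -> clamp t = t.
Proof.
move=> /andP[t0 t1]; rewrite /clamp ger0_norm // ler0_norm ?subr_le0 //.
by rewrite opprB; lra.
Qed.

(* A section of the pulled-back signs over the square of a homotopy is constant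
   along the three edges mapped to the base point. *)
Lemma null_homotopic_section (M : topologicalType) (eps : M -> M -> bool) (c : R -> M) x
    (H : R * R -> M) (s : R -> bool) : sign_cocycle eps ->
  {within `[0, 1] `*` `[0, 1], continuous H} ->
  (forall t, t \in `[0, 1] -> H (0, t) = c t) ->
  (forall t, t \in `[0, 1] -> H (1, t) = x) ->
  (forall u, u \in `[0, 1] -> H (u, 0) = x /\ H (u, 1) = x) ->
  sign_section (fun t u => eps (c t) (c u)) `[0, 1]%classic s -> s 0 = s 1.
Proof.
move=> ce cH Hc Hx Hs ss; pose K p := H (clamp p.1, clamp p.2).
have cK : continuous K.
  move=> p; move/subspace_continuousP: cH => cH.
  have Hp : (`[0, 1] `*` `[0, 1])%classic (clamp p.1, clamp p.2).
    by split; rewrite /= in_itv /= clamp_itv.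
  have h := cH _ Hp.
  have cc : (fun q : R * R => (clamp q.1, clamp q.2)) @ p --> (clamp p.1, clamp p.2).
    exact: clamp2_continuous.
  move=> U /h hU; change (\forall q \near p, U (K q)).
  have hp : \forall q \near p, (`[0, 1] `*` `[0, 1])%classic (clamp q.1, clamp q.2) -> U
    (K q).
    exact: cc _ hU.
  apply: filterS hp => q; apply.
  by split; rewrite /= in_itv /= clamp_itv.
have eK u v : u \in `[0, 1] -> v \in `[0, 1] -> K (u, v) = H (u, v).
  by rewrite !in_itv /= /K /= => hu hv; rewrite !clamp_id.
have i0 : 0 \in `[0, 1 : R] by rewrite in_itv /= lexx ler01.
have i1 : 1 \in `[0, 1 : R] by rewrite in_itv /= lexx ler01.
have [S hS] := rect_section (sign_cocycle_comp cK ce) ler01 ler01.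
(* Where [K] stays at [x], both sides of the section condition contain the same sign [eps x x], so
   [S] is locally constant. *)
have cst_edge (f : R -> R * R) : continuous f ->
    (forall t : R, t \in `[0, 1] -> rect 0 1 0 1 (f t) /\ K (f t) = x) -> S (f 0) = S (f 1).
  move=> cf hf.
  have hf1 (t : R) : `[0, 1]%classic t -> rect 0 1 0 1 (f t) by move=> /hf[].
  have hf2 (t : R) : `[0, 1]%classic t -> K (f t) = x by move=> /hf[].
  have sf := sign_section_comp cf hf1 hS.
  have lc (t : R) : `[0, 1]%classic t -> \forall u \near t, `[0, 1]%classic u -> (S \o f)
    u = (S \o f) t.
    move=> t01; apply: filterS (sf t t01) => u h u01; move: (h u01) => /=.
    by rewrite (hf2 u u01) (hf2 t t01); case: (S (f u)) (S (f t)) (eps x x) => [] [] [].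
  exact: (connected_locally_constant (@segment_connected R 0 1) lc i0 i1).
(* On the edge that carries [c], both [s] and [S] are sections, so their difference is constant. *)
have bottom : s 0 (+) S (0, 0) = s 1 (+) S (0, 1).
  have inb (t : R) : `[0, 1]%classic t -> rect 0 1 0 1 (0, t) by split.
  have sb := sign_section_comp (@continuous_pairl 0) inb hS.
  have sb' : sign_section (fun t u => eps (c t) (c u)) `[0, 1]%classic (S \o (fun t =>
    (0, t))).
    move=> t t01; apply: filterS (sb t t01) => u h u01; move: (h u01).
    by rewrite !eK // !Hc.
  exact: (sign_sections_diff (@segment_connected R 0 1) ss sb' i0 i1).
have e1 : S (0, 0) = S (1, 0).
  apply: (cst_edge (fun t => (t, 0)) (@continuous_pairr 0)) => t t01; split; first by split.
  by rewrite eK //; have [] := Hs t t01.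
have e2 : S (1, 0) = S (1, 1).
  apply: (cst_edge (fun t => (1, t)) (@continuous_pairl 1)) => t t01; split; first by split.
  by rewrite eK // Hx.
have e3 : S (0, 1) = S (1, 1).
  apply: (cst_edge (fun t => (t, 1)) (@continuous_pairr 1)) => t t01; split; first by split.
  by rewrite eK //; have [] := Hs t t01.
by move: bottom; rewrite e3 e1 e2; case: (s 0) (s 1) (S (1, 1)) => [] [] [].
Qed.

End Square.

(** * The field of rotations *)

Section Branch.
Context {R : realType} {T : Type} (F : set_system T) {FF : Filter F} (y : T).

Lemma mcts_cmx n (J : T -> 'M[R]_n.+1) (a b : T -> R) :
  cts F y a -> cts F y b -> mcts F y J -> mcts F y (fun z => cmx (J z) (a z) (b z)).
Proof.
move=> ca cb cJ; apply: mctsD; last exact: mctsZ.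
rewrite (_ : (fun z => _) = fun z => a z *: 1%:M); last by apply/funext => z; rewrite
  scalemx1.
by apply: mctsZ => //; exact: mcts_cst.
Qed.

Lemma rotation_sqr (J G E : 'M[R]_4) a b : J *m J = - 1%:M -> rotation J G E ->
  (cmx J a b *m E) *m (cmx J a b *m E) = - cmx J (a ^+ 2 - b ^+ 2) (2 * (a * b)).
Proof.
move=> JJ rE; rewrite (cmxM_rotation _ _ _ _ JJ rE); congr (- cmx J _ _); ring.
Qed.

(* Locally, the element of the pair {E, -E} closest to [E y] is an explicit
   algebraic function of [J] and [G]: project [E y] onto so(2, C) at [z] to get
   [K], with [K^2 = - (p + q J)], and divide by a square root of [p + q J]. *)
Lemma rotation_branch (J G E : T -> 'M[R]_4) :
  mcts F y J -> mcts F y G ->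
  (forall z, J z *m J z = - 1%:M) -> (forall z, (G z)^T = G z) -> (forall z, G z \in
    unitmx) ->
  (forall z, J z *m G z = G z *m (J z)^T) -> (forall z, rotation (J z) (G z) (E z)) ->
  exists L : T -> 'M[R]_4, [/\ mcts F y L, L y = E y &
    \forall z \near F, L z = E z \/ L z = - E z].
Proof.
move=> cJ cG JJ sG uG JG rE.
have [sX0 cX0 _] := rotation_skew (sG y) (uG y) (JG y) (rE y).
have [X0 EX0] : exists X0, X0 = E y *m G y by exists (E y *m G y).
rewrite -EX0 in sX0 cX0.
(* Half of [X0 - J X0 J^T] projects skew matrices onto those with [J X = X J^T], and it fixes [X0]
   at [y]. *)
pose X z := 2^-1 *: (X0 + (-1) *: (J z *m X0 *m (J z)^T)).
have sX z : (X z)^T = - X z.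
  rewrite /X -scalerN [LHS]linearZ /=; congr (_ *: _); rewrite linearD opprD /= sX0;
    congr (_ + _).
  by rewrite linearZ /= !trmx_mul trmxK sX0 mulNmx mulmxN scalerN mulmxA.
have JX z : J z *m X z = X z *m (J z)^T.
  rewrite /X -scalemxAr -scalemxAl; congr (_ *: _).
  rewrite mulmxDr mulmxDl -scalemxAr -scalemxAl !mulmxA JJ.
  have JJT : (J z)^T *m (J z)^T = - 1%:M by rewrite -trmx_mul JJ linearN /= trmx1.
  rewrite -(mulmxA _ (J z)^T (J z)^T) JJT mulmxN mulmx1 !mulNmx mul1mx !scaleN1r !opprK.
  by rewrite addrC.
have cX : mcts F y X.
  apply: (mctsZ (f := fun=> 2^-1)); first exact: cts_cst.
  apply: mctsD; first exact: mcts_cst.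
  apply: (mctsZ (f := fun=> -1)); first exact: cts_cst.
  apply: mctsM; last exact: mcts_tr.
  by apply: mctsM => //; exact: mcts_cst.
have Xy : X y = X0.
  rewrite /X cX0 -mulmxA -trmx_mul JJ linearN /= trmx1 mulmxN mulmx1 scaleN1r opprK.
  by rewrite -mulr2n -(scaler_nat 2 X0) scalerA mulVf ?scale1r // pnatr_eq0.
clearbody X; pose K z := X z *m invmx (G z).
have KG z : K z *m G z = X z by rewrite /K mulmxKV.
have cK : mcts F y K by apply: mctsM => //; exact: mcts_inv.
have Ky : K y = E y by rewrite /K Xy EX0 mulmxK.
clearbody K; have hK z : exists a b, K z = cmx (J z) a b *m E z.
  by apply: rotation_span (rE z) _ _ => //; rewrite KG.
(* Since [J] has trace 0 and the identity trace 4, traces recover p and q from [K^2 = - (p + q J)],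
   which makes them continuous. *)
pose p z := - 4^-1 * \tr (K z *m K z); pose q z := 4^-1 * \tr (J z *m (K z *m K z)).
have KK z : K z *m K z = - cmx (J z) (p z) (q z).
  have [a [b h]] := hK z; have e := rotation_sqr a b (JJ z) (rE z).
  have tJ := trace_complex_structure (JJ z).
  have tr_c u v : \tr (cmx (J z) u v) = 4 * u.
    by rewrite /cmx linearD /= mxtrace_scalar linearZ /= tJ mulr0 addr0 mulr_natl.
  have -> : p z = a ^+ 2 - b ^+ 2.
    by rewrite /p h e linearN /= tr_c; field.
  have -> : q z = 2 * (a * b); last by rewrite h.
  have tJc u v : \tr (J z *m cmx (J z) u v) = - (4 * v).
    have -> : J z *m cmx (J z) u v = cmx (J z) (- v) u.
      by rewrite /cmx mulmxDr mul_mx_scalar -scalemxAr JJ scalerN scalemx1 raddfN addrC.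
    by rewrite tr_c mulrN.
  by rewrite /q h e mulmxN linearN /= tJc opprK mulKf // pnatr_eq0.
have py : p y = 1.
  have [EE _ _] := rE y.
  by rewrite /p Ky EE linearN /= mxtrace1; field.
have qy : q y = 0.
  have [EE _ _] := rE y.
  by rewrite /q Ky EE mulmxN mulmx1 linearN /= trace_complex_structure // oppr0 mulr0.
have cp : cts F y p by apply: ctsM; [exact: cts_cst|apply: mcts_trace; exact: mctsM].
have cq : cts F y q.
  by apply: ctsM; [exact: cts_cst|apply: mcts_trace; apply: mctsM => //; exact: mctsM].
have csqrt f : cts F y f -> cts F y (fun z => Num.sqrt (f z)).
  by move=> cf; apply: continuous_cvg => //; exact: sqrt_continuous.
have cinv f : f y != 0 -> cts F y f -> cts F y (fun z => (f z)^-1).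
  by move=> f0 cf; apply: cvgV.
pose r z := Num.sqrt (p z * p z + q z * q z).
have cr : cts F y r by apply: csqrt; apply: ctsD; exact: ctsM.
have ry : r y = 1 by rewrite /r py qy mulr0 addr0 mulr1 sqrtr1.
(* With r the modulus of p + q i, the number m - b i below is the principal square root of p + q i,
   and (m + b i) / r is its inverse. At [y] these are p = m = r = 1 and q = b = 0, so the divisions
   are safe nearby. *)
pose m z := Num.sqrt (2^-1 * (r z + p z)).
have cm : cts F y m by apply: csqrt; apply: ctsM; [exact: cts_cst|exact: ctsD].
have my : m y = 1 by rewrite /m ry py -[1 + 1]/(2 : R) mulVf ?pnatr_eq0 // sqrtr1.
pose b z := - 2^-1 * (q z * (m z)^-1).
have cb : cts F y b.
  apply: ctsM; first exact: cts_cst.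
  by apply: ctsM => //; apply: cinv => //; rewrite my oner_neq0.
pose L z := (r z)^-1 *: (cmx (J z) (m z) (b z) *m K z).
exists L; split.
- apply: mctsZ; first by apply: cinv => //; rewrite ry oner_neq0.
  by apply: mctsM => //; exact: mcts_cmx.
- by rewrite /L ry invr1 scale1r my /b qy mul0r mulr0 /cmx scale0r addr0 mul1mx Ky.
have nr : \forall z \near F, 0 < r z by apply: (cts_near_gt cr); rewrite ry ltr01.
have nm : \forall z \near F, 0 < m z by apply: (cts_near_gt cm); rewrite my ltr01.
apply: filterS2 nr nm => z r0 m0.
apply: rotation_unique (rE z) _ => //.
have r2 : r z ^+ 2 = p z ^+ 2 + q z ^+ 2 by rewrite sqr_sqrtr -?expr2 // addr_ge0 //
  sqr_ge0.
have m2 : m z ^+ 2 = 2^-1 * (r z + p z).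
  rewrite sqr_sqrtr // leNgt; apply/negP => n0.
  by move: m0; rewrite /m ltr0_sqrtr // ltxx.
have KJ : K z *m J z = J z *m K z.
  have [u [v ->]] := hK z; have [_ EJ _] := rE z.
  by rewrite -mulmxA EJ !mulmxA; congr (_ *m _); rewrite /cmx mulmxDl mulmxDr scalar_mxC
    -scalemxAl -scalemxAr.
have cmK u v : K z *m cmx (J z) u v = cmx (J z) u v *m K z.
  by rewrite /cmx mulmxDl mulmxDr scalar_mxC -scalemxAl -scalemxAr KJ.
have bm : b z * m z = - 2^-1 * q z by rewrite /b -!mulrA mulVf ?gt_eqF // mulr1.
have b2 : b z ^+ 2 = 2^-1 * (r z - p z).
  have : b z ^+ 2 * m z ^+ 2 = 2^-1 * (r z - p z) * m z ^+ 2.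
    by rewrite -exprMn bm m2; nra.
  by apply: mulIf; rewrite expf_neq0 // gt_eqF.
split.
- have e1 : (m z * m z - b z * b z) * p z - (m z * b z + b z * m z) * q z = r z ^+ 2 by nra.
  have e2 : (m z * m z - b z * b z) * q z + (m z * b z + b z * m z) * p z = 0 by nra.
  have ww : (cmx (J z) (m z) (b z) *m cmx (J z) (m z) (b z)) *m cmx (J z) (p z) (q z) =
    (r z ^+ 2)%:M.
    by rewrite !cmxM // e1 e2 /cmx scale0r addr0.
  rewrite /L -scalemxAl -scalemxAr scalerA -mulmxA (mulmxA (K z)) cmK -(mulmxA _ (K z) (K
    z)) KK.
  rewrite mulmxA mulmxN ww scalerN -scalemx1 scalerA -invfM -expr2 mulVf ?scale1r //.
  by rewrite expf_neq0 // gt_eqF.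
- have wJ u v : cmx (J z) u v *m J z = J z *m cmx (J z) u v.
    by rewrite /cmx mulmxDl mulmxDr scalar_mxC -scalemxAl -scalemxAr.
  by rewrite /L -scalemxAl -scalemxAr -mulmxA KJ mulmxA wJ -mulmxA.
- have <- : (L z *m G z)^T = G z *m (L z)^T by rewrite trmx_mul sG.
  have wX : (cmx (J z) (m z) (b z) *m X z)^T = - (cmx (J z) (m z) (b z) *m X z).
    rewrite trmx_mul sX mulNmx; congr (- _); apply/esym.
    have -> : (cmx (J z) (m z) (b z))^T = (m z)%:M + b z *: (J z)^T.
      by rewrite /cmx linearD /= tr_scalar_mx linearZ.
    by rewrite mulmxDr /cmx mulmxDl -scalemxAl -scalemxAr JX scalar_mxC.
  by rewrite /L -scalemxAl -mulmxA KG [X in - X]linearZ /= wX scalerN opprK.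
Qed.

End Branch.

(** * Endomorphisms built from parallel metrics *)

Section Metric_algebra.
Context {R : realType} {n : nat} (M : smooth_manifold R n).
Implicit Types (g T G : tensor02 M) (x : M).

Lemma metric_matrix_sym g x : semi_riemannian g -> (g x)^T = g x.
Proof.
move=> sg; apply/matrixP => a b; rewrite mxE.
have := metric_symmetric sg x (delta_mx 0 b) (delta_mx 0 a).
by rewrite /teval !mul_delta_tr -!rowE !mxE.
Qed.

Lemma metric_matrix_unit g x : semi_riemannian g -> g x \in unitmx.
Proof.
move=> sg; apply: unitmx_of_inj => v vg; apply: (metric_nondegenerate sg (x := x)) => w.
by rewrite /teval vg mul0mx mxE.
Qed.

Definition tensor_endo T G x := T x *m invmx (G x).

Lemma endo_transport (F T T' G G' : 'M[R]_n) : G \in unitmx ->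
  F *m T' *m F^T = T -> F *m G' *m F^T = G ->
  F *m (T' *m invmx G') = (T *m invmx G) *m F.
Proof.
move=> uG <- eG; move: (uG); rewrite -eG !unitmx_mul => /andP[/andP[uF uG'] _].
by rewrite (endo_congruence _ (mulmxV uF) uG') mulmxKV.
Qed.

End Metric_algebra.

Section Parallel_endo.
Context {R : realType} {n : nat} (M : smooth_manifold R n.+1) (D : linear_connection M).
Implicit Types (g T G : tensor02 M) (x : M).

(** Schur's lemma: the row space of [N] is invariant, so its rank is zero or full. *)
Lemma irreducible_division x : ~ reducible_holonomy D -> division_commutant
  (holonomy_group D x).
Proof.
move=> irr N cN; have [r0|r0] := eqVneq (\rank N) 0%N.
  by left; apply/eqP; rewrite -mxrank_eq0 r0.
right; rewrite -row_free_unit; apply: contrapT => nf; apply: irr; exists x, N; split.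
  rewrite lt0n r0 /= ltn_neqAle rank_leq_row andbT; apply/negP => /eqP e.
  by apply: nf; rewrite /row_free e.
by move=> P /cN e; rewrite -e submxMl.
Qed.

Lemma holonomy_isometry T x P : chart_parallel D T -> holonomy_group D x P ->
  P *m T x *m P^T = T x.
Proof.
move=> pT /holonomy_transports [c [F [bad [tr c0 c1 F0 F1]]]].
have i1 : 1 \in `[0, 1 : R] by rewrite in_itv /= lexx ler01.
by have := transports_gram pT tr i1; rewrite c0 c1 F0 F1 trmx1 mul1mx mulmx1.
Qed.

Lemma endo_commutant T G x : chart_parallel D T -> chart_parallel D G -> G x \in unitmx ->
  commutant (holonomy_group D x) (tensor_endo T G x).
Proof.
move=> pT pG uG P hP.
by apply: endo_transport => //; exact: holonomy_isometry hP.
Qed.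

Lemma endo_trace_constant T G : connected [set: M] -> chart_parallel D T ->
  chart_parallel D G ->
  (forall x, G x \in unitmx) -> forall x y,
  \tr (tensor_endo T G x) = \tr (tensor_endo T G y) /\
  \tr (tensor_endo T G x *m tensor_endo T G x) = \tr (tensor_endo T G y *m tensor_endo T
    G y).
Proof.
move=> cM pT pG uG x y.
have tr_conj (C C' A : 'M[R]_n.+1) : C' *m C = 1%:M ->
    \tr (C *m A *m C') = \tr A /\ \tr (C *m A *m C' *m (C *m A *m C')) = \tr (A *m A).
  move=> K; split; first by rewrite mxtrace_mulC mulmxA K mul1mx.
  by rewrite !mulmxA -(mulmxA _ C' C) K mulmx1 mxtrace_mulC !mulmxA K mul1mx.
(* Traces are invariant under the conjugation that leads to a fixed chart, where [trace_derive]
   applies. *)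
have chartE i c (t : R) : dom i (c t) -> {for t, continuous c} ->
    \forall s \near t, \tr (chart_tensor T i (c s) *m invmx (chart_tensor G i (c s))) =
      \tr (tensor_endo T G (c s)) /\
    \tr (chart_tensor T i (c s) *m invmx (chart_tensor G i (c s)) *m (chart_tensor T i (c
      s) *m invmx (chart_tensor G i (c s)))) =
    \tr (tensor_endo T G (c s) *m tensor_endo T G (c s)).
  move=> ict cc.
  have nd : \forall s \near t, dom i (c s).
    by apply: cc; apply: open_nbhs_nbhs; split=> //; exact: dom_open.
  apply: filterS nd => s ics; rewrite (chart_endo T ics (uG (c s))).
  exact: tr_conj (jacK (dom_chart_at (c s)) ics).
split.
- apply: (@connected_locally_constant _ _ setT (fun z => \tr (tensor_endo T G z))) => //
  z _.
  have := @locally_constant_of_curves R n.+1 M (fun z => \tr (tensor_endo T G z)).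
  move=> /(_ _ z) h; have {}h : \forall u \near z, \tr (tensor_endo T G u) = \tr
    (tensor_endo T G z).
    apply: h => c i t ict cc dc.
    have [B dB] := chart_endo_curve pT pG uG ict cc dc; have [d1 _] := trace_derive dB.
    by apply: near_eq_is_derive d1; apply: filterS (chartE i c t ict cc) => s [].
  by apply: filterS h.
- apply: (@connected_locally_constant _ _ setT (fun z => \tr (tensor_endo T G z *m
  tensor_endo T G z))) => // z _.
  have := @locally_constant_of_curves R n.+1 M (fun z => \tr (tensor_endo T G z *m
    tensor_endo T G z)).
  move=> /(_ _ z) h; have {}h : \forall u \near z, \tr (tensor_endo T G u *m tensor_endo
    T G u) = \tr (tensor_endo T G z *m tensor_endo T G z).
    apply: h => c i t ict cc dc.
    have [B dB] := chart_endo_curve pT pG uG ict cc dc; have [_ d1] := trace_derive dB.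
    by apply: near_eq_is_derive d1; apply: filterS (chartE i c t ict cc) => s [].
  by apply: filterS h.
Qed.

End Parallel_endo.

(** * Pointwise independence and three metrics *)

Section Dimension_four.
Context {R : realType} (M : smooth_manifold R 4) (D : linear_connection M).
Implicit Types (g T G : tensor02 M) (x : M).

(* Traces suffice to detect zero, and unlike [A] they are constant along [M]. *)
Lemma division_traces (H : set 'M[R]_4) A : division_commutant H -> commutant H A ->
  \tr A = 0 -> \tr (A *m A) = 0 -> A = 0.
Proof.
move=> dH cA t1 t2; have [[a Ea]|[a [b [J [b0 _ JJ EA]]]]] := division_scalar_or_complex
  dH cA.
  by move: t1; rewrite Ea mxtrace_scalar => /eqP; rewrite mulrn_eq0 /= => /eqP ->;
    rewrite raddf0.
have tJ := trace_complex_structure JJ.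
have a0 : a = 0.
  move: t1; rewrite EA linearD /= mxtrace_scalar linearZ /= tJ mulr0 addr0 => /eqP.
  by rewrite mulrn_eq0 => /eqP.
have AA : A *m A = (- b ^+ 2)%:M.
  by rewrite EA a0 raddf0 add0r -scalemxAl -scalemxAr JJ scalerA scalerN scalemx1 -raddfN
    -expr2.
move: t2; rewrite AA mxtrace_scalar => /eqP; rewrite mulrn_eq0 /= oppr_eq0 sqrf_eq0.
by rewrite (negPf b0).
Qed.

(** The traces of [T G^-1] and of its square vanish at [x0], hence everywhere, and [division_traces]
    applies at each point. *)
Lemma parallel_eq0 T G x0 : connected [set: M] -> ~ reducible_holonomy D ->
  chart_parallel D T -> chart_parallel D G -> (forall x, G x \in unitmx) ->
  T x0 = 0 -> forall x, T x = 0.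
Proof.
move=> cM irr pT pG uG T0 x.
have [t1 t2] := endo_trace_constant cM pT pG uG x x0.
have E0 : tensor_endo T G x0 = 0 by rewrite /tensor_endo T0 mul0mx.
have : tensor_endo T G x = 0.
  apply: (division_traces (@irreducible_division _ _ M D x irr) (endo_commutant pT pG (uG
    x))).
    by rewrite t1 E0 linear0.
  by rewrite t2 E0 mul0mx linear0.
by move=> /(congr1 (mulmx^~ (G x))); rewrite /tensor_endo mulmxKV // mul0mx.
Qed.

Lemma independent_at k (g : 'I_k -> tensor02 M) G x0 (a : 'I_k -> R) :
  connected [set: M] -> ~ reducible_holonomy D -> independent g ->
  (forall l, chart_parallel D (g l)) -> chart_parallel D G -> (forall x, G x \in unitmx) ->
  \sum_l a l *: g l x0 = 0 -> forall l, a l = 0.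
Proof.
move=> cM irr ind pg pG uG E; apply: ind.
exact: (parallel_eq0 cM irr (chart_parallel_sum a pg) pG uG E).
Qed.

(** The empty space counts as [connected], but over it every linear relation holds vacuously. *)
Lemma manifold_nonempty k (g : 'I_k.+1 -> tensor02 M) : independent g -> exists x : M, True.
Proof.
move=> ind; apply: contrapT => ne; have := ind (fun=> 1) _ ord0.
by move=> /(_ _) h; have /eqP := h (fun x => False_ind _ (ne (ex_intro _ x I))); rewrite
  oner_eq0.
Qed.

Lemma endo_self_adjoint g G x : semi_riemannian g -> semi_riemannian G ->
  self_adjoint (G x) (tensor_endo g G x).
Proof.
move=> sg sG; have uG := metric_matrix_unit x sG; rewrite /self_adjoint /tensor_endo
  mulmxKV //.
by rewrite trmx_mul trmx_inv !metric_matrix_sym // mulmxA mulmxV // mul1mx.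
Qed.

Lemma three_metrics (g : 'I_3 -> tensor02 M) : connected [set: M] ->
  (forall l, semi_riemannian (g l)) -> independent g -> (forall l, parallel_metric D (g
    l)) ->
  reducible_holonomy D.
Proof.
move=> cM sg ind pg; apply: contrapT => irr.
have [x _] := manifold_nonempty ind.
have cp l : chart_parallel D (g l) by apply: metric_chart_parallel => //; exact:
  (metric_smooth (sg l)).
pose i0 : 'I_3 := ord0; pose i1 : 'I_3 := lift ord0 ord0; pose i2 : 'I_3 := lift ord0
  (lift ord0 ord0).
have uG y : g i0 y \in unitmx by exact: metric_matrix_unit.
have dH := @irreducible_division _ _ M D x irr.
have [||||a b c E|I [J [[cI cJ sI sJ] [II JJ IJ]]]] := quaternions_exist (G := g i0 x)
   (A := tensor_endo (g i1) (g i0) x) (B := tensor_endo (g i2) (g i0) x) dH.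
- exact: endo_commutant.
- exact: endo_commutant.
- exact: endo_self_adjoint.
- exact: endo_self_adjoint.
- have h (l : 'I_3) : [:: a; b; c]`_l = 0.
    apply: (@independent_at 3 g (g i0) x (fun l : 'I_3 => [:: a; b; c]`_l) cM irr ind cp
      (cp i0) uG).
    move: E => /(congr1 (mulmx^~ (g i0 x))); rewrite /tensor_endo !mulmxDl -!scalemxAl
      !mulmxKV // mul_scalar_mx mul0mx => E'.
    by rewrite -[RHS]E' !big_ord_recl big_ord0 addr0 /= addrA.
  by split; [exact: (h i0)|exact: (h i1)|exact: (h i2)].
apply: (not_division_quaternion _ _ II JJ IJ sI sJ cI cJ _ dH) => //.
- exact: metric_matrix_sym.
- by move=> P; apply: holonomy_isometry.
Qed.

End Dimension_four.

Lemma mulmx_conj (R : comNzRingType) n (A B C C' P Q N : 'M[R]_n) :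
  A *m C = P -> C' *m B = Q -> A *m (C *m N *m C') *m B = P *m N *m Q.
Proof. by move=> <- <-; rewrite !mulmxA. Qed.

Section Charts_of_endomorphisms.
Context {R : realType} {n : nat} (M : smooth_manifold R n).
Implicit Types (i j : chart M) (x y z : M).

Lemma near_dom i x : dom i x -> \forall y \near x, dom i y.
Proof. by move=> ix; apply: open_nbhs_nbhs; split=> //; exact: dom_open. Qed.

Definition chart_conj i x (N : 'M[R]_n) := jac i (chart_at x) x *m N *m jac (chart_at x)
  i x.

Lemma chart_conjN i x N : chart_conj i x (- N) = - chart_conj i x N.
Proof. by rewrite /chart_conj mulmxN mulNmx. Qed.

Lemma chart_conj_change i j x N : dom i x -> dom j x ->
  jac j i x *m chart_conj i x N *m jac i j x = chart_conj j x N.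
Proof.
move=> ix jx; have cx := dom_chart_at x.
exact: mulmx_conj (jac_comp jx ix cx) (jac_comp cx ix jx).
Qed.

Lemma jac_cts i j x : dom i x -> dom j x -> mcts (nbhs x) x (fun y => jac i j y).
Proof.
move=> ix jx a b; have [_ d1] := transition_smooth i j 1.
pose f p := 'D_(delta_mx 0 a) (phi j \o psi i) p.
have cf : {for phi i x, continuous f} by apply: d1; exists x.
have cf' : {for x, continuous ((fun N : 'rV[R]_n => N 0 b) \o (f \o phi i))}.
  apply: continuous_comp; last exact: coord_continuous.
  by apply: continuous_comp; [exact: phi_continuous|exact: cf].
have E y : dom i y -> dom j y -> jac i j y a b = f (phi i y) 0 b.
  by move=> iy jy; rewrite /f -(mul_jac _ iy jy) -rowE [RHS]mxE.
apply: (@cts_near _ _ _ _ x ((fun N : 'rV[R]_n => N 0 b) \o (f \o phi i))) => //=; last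
  by rewrite E.
have ni : \forall y \near x, dom i y by exact: near_dom.
have nj : \forall y \near x, dom j y by exact: near_dom.
by apply: filterS2 ni nj => y iy jy; rewrite E.
Qed.

End Charts_of_endomorphisms.

Section Change_of_basis.
Context {R : realType}.

Lemma rotation_conj (C C' J0 G0 E : 'M[R]_4) : C' *m C = 1%:M -> rotation J0 G0 E ->
  rotation (C *m J0 *m C') (C *m G0 *m C^T) (C *m E *m C').
Proof.
move=> K; have [uC' _] := mulmx1_unit K.
have -> : C = invmx C' by rewrite -[LHS]mul1mx -(mulVmx uC') -mulmxA K mulmx1.
apply: rotation_transport => //; first by rewrite !mulmxA mulmxV // mul1mx.
by rewrite !mulmxA mulmxV // mul1mx -mulmxA -trmx_mul mulmxV // trmx1 mulmx1.
Qed.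

Lemma congr_sym (C T : 'M[R]_4) : T^T = T -> (C *m T *m C^T)^T = C *m T *m C^T.
Proof. by move=> sT; rewrite !trmx_mul trmxK sT mulmxA. Qed.

Lemma conj_self_adjoint (C C' J0 G0 : 'M[R]_4) : C' *m C = 1%:M -> J0 *m G0 = G0 *m J0^T ->
  (C *m J0 *m C') *m (C *m G0 *m C^T) = (C *m G0 *m C^T) *m (C *m J0 *m C')^T.
Proof.
move=> K e; have KT : C^T *m C'^T = 1%:M by rewrite -trmx_mul K trmx1.
rewrite !trmx_mul !mulmxA -(mulmxA _ C' C) K mulmx1 -(mulmxA _ C^T C'^T) KT mulmx1.
by rewrite -(mulmxA C J0) e mulmxA.
Qed.

Lemma conj_sqr (C C' J0 : 'M[R]_4) : C' *m C = 1%:M -> C *m C' = 1%:M -> J0 *m J0 = - 1%:M ->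
  (C *m J0 *m C') *m (C *m J0 *m C') = - 1%:M.
Proof.
move=> K K' e; rewrite !mulmxA -(mulmxA _ C' C) K mulmx1 -(mulmxA C J0) e.
by rewrite mulmxN mulmx1 mulNmx K'.
Qed.

End Change_of_basis.

Lemma cts_scaled_trace (R : realType) (T : Type) (F : set_system T) (FF : Filter F) (x0 :
  T) n
    (a : R) (A : T -> 'M[R]_n) (B : 'M[R]_n) :
  mcts F x0 A -> cts F x0 (fun x => a * \tr (A x *m B)).
Proof.
move=> cA; apply: ctsM; first exact: cts_cst.
by apply: mcts_trace; apply: mctsM => //; exact: mcts_cst.
Qed.

(** In use, [la] and [lb] are traces of a continuous branch against two reference matrices, and [a]
    and [b] those of the chosen rotation. Replacing the branch by its negative flips both signs, so
    their xor is unaffected. *)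
Lemma sign_xor (R : realType) (a b a0 la lb : R) :
  0 < (if a0 < 0 then -1 else 1) * la -> 0 < (-1) * lb ->
  (la = a /\ lb = b) \/ (la = - a /\ lb = - b) ->
  (a < 0) (+) (b < 0) = (a0 < 0) (+) true.
Proof.
rewrite mulN1r oppr_gt0 => h hb [] [ea eb]; move: h hb; rewrite ea eb.
  by case: ifP => _; rewrite ?mulN1r ?mul1r ?oppr_gt0 => h ->; rewrite ?h // ltNge (ltW h).
by rewrite oppr_lt0; case: ifP => _; rewrite ?mulN1r ?mul1r ?opprK ?oppr_gt0 => h h';
  rewrite [b < 0]ltNge (ltW h') ?h //= ltNge (ltW h).
Qed.

(** * The sign cocycle of the rotations *)

Section Rotation_field.
Context {R : realType} (M : smooth_manifold R 4) (D : linear_connection M).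
Context (G : tensor02 M) (J e : M -> 'M[R]_4).
Context (pG : chart_parallel D G) (sG : forall x, (G x)^T = G x) (uG : forall x, G x \in
  unitmx).
Context (JJ : forall x, J x *m J x = - 1%:M) (JG : forall x, J x *m G x = G x *m (J x)^T).
Context (cJ : forall i x, dom i x -> mcts (nbhs x) x (fun y => chart_conj i y (J y))).
Context (re : forall x, rotation (J x) (G x) (e x)).
Implicit Types (i j : chart M) (x y z : M).

Lemma chart_rotation i x E : dom i x -> rotation (J x) (G x) E ->
  rotation (chart_conj i x (J x)) (chart_tensor G i x) (chart_conj i x E).
Proof. by move=> ix; apply: rotation_conj; apply: jacK => //; exact: dom_chart_at. Qed.

Lemma chart_branch i y : dom i y -> exists L : M -> 'M[R]_4,
  [/\ mcts (nbhs y) y L, L y = chart_conj i y (e y) &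
   \forall z \near y, L z = chart_conj i z (e z) \/ L z = - chart_conj i z (e z)].
Proof.
(* [rotation_branch] wants its hypotheses at every point; sending points outside the chart to [y]
   provides them and changes nothing near [y]. *)
move=> iy; pose rho z := if `[< dom i z >] then z else y.
have irho z : dom i (rho z) by rewrite /rho; case: asboolP.
have nrho : \forall z \near y, rho z = z.
  have ni : \forall z \near y, dom i z by exact: near_dom.
  by apply: filterS ni => z iz; rewrite /rho asboolT.
have rhoy : rho y = y by rewrite /rho asboolT.
have [L [cL Ly nL]] := @rotation_branch R M (nbhs y) _ y
  (fun z => chart_conj i (rho z) (J (rho z))) (fun z => chart_tensor G i (rho z))
  (fun z => chart_conj i (rho z) (e (rho z)))
  (mcts_near (filterS (fun z h => congr1 (fun w => chart_conj i w (J w)) (esym h)) nrho)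
    (congr1 (fun w => chart_conj i w (J w)) (esym rhoy)) (cJ iy))
  (mcts_near (filterS (fun z h => congr1 (fun w => chart_tensor G i w) (esym h)) nrho)
    (congr1 (fun w => chart_tensor G i w) (esym rhoy)) (chart_tensor_cts pG iy))
  (fun z => conj_sqr (jacK (dom_chart_at (rho z)) (irho z)) (jacK (irho z) (dom_chart_at
    (rho z))) (JJ (rho z)))
  (fun z => congr_sym _ (sG (rho z)))
  (fun z => chart_tensor_unit (irho z) (uG (rho z)))
  (fun z => conj_self_adjoint (jacK (dom_chart_at (rho z)) (irho z)) (JG (rho z)))
  (fun z => chart_rotation (irho z) (re (rho z))).
exists L; split.
- exact cL.
- exact (etrans Ly (congr1 (fun w => chart_conj i w (e w)) rhoy)).
- apply: filterS2 nrho nL => z ez; rewrite [in X in X -> _]ez; exact.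
Qed.

(* The trace is -4 for the same and 4 for the opposite branch at [z = y]. *)
Definition rotation_sign y z :=
  \tr (chart_conj (chart_at y) z (e z) *m chart_conj (chart_at y) y (e y)) < 0.

Lemma trace_rotation_sqr i y : dom i y ->
  \tr (chart_conj i y (e y) *m chart_conj i y (e y)) = - 4.
Proof.
by move=> iy; have [-> _ _] := chart_rotation iy (re y); rewrite linearN /= mxtrace1.
Qed.

(** Near [z] take a continuous branch through [e z], written [L1] in the chart of [y] and [L2] in
    the chart of [z]. Its traces against the rotations at [y] and at [z] keep their signs; passing
    from the branch to [e w] flips both or neither. *)
Lemma rotation_sign_cocycle : sign_cocycle rotation_sign.
Proof.
move=> y; set i := chart_at y; have iy : dom i y by exact: dom_chart_at.
have [L [cL Ly nL]] := chart_branch iy.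
have neg4 : - 4 < 0 :> R by rewrite oppr_lt0 ltr0n.
pose h z := (-1) * \tr (L z *m chart_conj i y (e y)).
have ch : cts (nbhs y) y h.
  exact: cts_scaled_trace cL.
have hy : 0 < h y by rewrite /h Ly trace_rotation_sqr // mulN1r opprK ltr0n.
have ni : \forall z \near y, dom i z by exact: near_dom.
have nh : \forall z \near y, 0 < h z by exact: cts_near_gt ch hy.
(* The trace is -4 at [y] along the branch, and [e z] is the branch up to sign, so it is nonzero
   nearby. *)
have : \forall z \near y, dom i z /\ \tr (chart_conj i z (e z) *m chart_conj i y (e y))
  != 0.
  apply: filterS3 ni nh nL => z iz hz Lz; split => //.
  apply: contraTneq hz => t0; rewrite /h mulN1r -leNgt.
  by case: Lz => ->; rewrite ?mulNmx ?linearN /= t0 ?oppr0.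
apply: filterS => z [iz tz]; set j := chart_at z; have jz : dom j z by exact: dom_chart_at.
have [L1 [cL1 L1z nL1]] := chart_branch iz.
pose L2 w := jac j i w *m L1 w *m jac i j w.
have cL2 : mcts (nbhs z) z L2.
  by apply: mctsM; [apply: mctsM => //; exact: jac_cts|exact: jac_cts].
have L2z : L2 z = chart_conj j z (e z) by rewrite /L2 L1z; exact: chart_conj_change iz jz.
pose s : R := if \tr (chart_conj i z (e z) *m chart_conj i y (e y)) < 0 then -1 else 1.
pose f w := s * \tr (L1 w *m chart_conj i y (e y)).
have cf : cts (nbhs z) z f by exact: cts_scaled_trace cL1.
have fz : 0 < f z.
  rewrite /f L1z /s; case: ifPn => [|nt]; first by rewrite mulN1r oppr_gt0.
  by rewrite mul1r lt_neqAle eq_sym tz leNgt.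
pose k w := (-1) * \tr (L2 w *m chart_conj j z (e z)).
have ck : cts (nbhs z) z k by exact: cts_scaled_trace cL2.
have kz : 0 < k z by rewrite /k L2z trace_rotation_sqr // mulN1r opprK ltr0n.
have nf : \forall w \near z, 0 < f w by exact: cts_near_gt cf fz.
have nk : \forall w \near z, 0 < k w by exact: cts_near_gt ck kz.
have nij : \forall w \near z, dom i w /\ dom j w.
  by apply: filterS2 (near_dom iz) (near_dom jz) => u iu ju; exact (conj iu ju).
have nfk : \forall w \near z, 0 < f w /\ 0 < k w by apply: filterS2 nf nk => u fu ku;
  exact (conj fu ku).
apply: filterS3 nij nfk nL1 => w [iw jw] [fw kw] L1w.
have zz : rotation_sign z z by rewrite /rotation_sign trace_rotation_sqr.
rewrite zz /rotation_sign -/i -/j.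
have E1 (A : 'M[R]_4) : L1 w = chart_conj i w A -> L2 w = chart_conj j w A.
  by move=> E; rewrite /L2 E; exact: chart_conj_change iw jw.
apply: (sign_xor fw kw).
case: L1w => L1w; first by left; split; [rewrite L1w|rewrite (E1 _ L1w)].
have L1w' : L1 w = chart_conj i w (- e w) by rewrite chart_conjN.
right; split; first by rewrite L1w mulNmx linearN.
by rewrite (E1 _ L1w') chart_conjN mulNmx linearN.
Qed.

End Rotation_field.

Lemma sign_xor_branch (R : realType) (st su : bool) (a la : R) :
  0 < (if st then -1 else 1) * la -> a = (if su then la else - la) ->
  su (+) (a < 0) = st (+) true.
Proof.
move=> h ->; move: h; case: st; case: su; rewrite ?mulN1r ?mul1r ?oppr_gt0 ?oppr_lt0 => h.
- by rewrite h.
- by rewrite ltNge (ltW h).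
- by rewrite ltNge (ltW h).
- by rewrite h.
Qed.

Lemma conj_invmx (R : comUnitRingType) n (C C' F E : 'M[R]_n) : C' *m C = 1%:M -> F \in
  unitmx ->
  C *m (invmx F *m E *m F) *m C' = invmx (F *m C') *m E *m (F *m C').
Proof.
move=> K uF; have [uC' _] := mulmx1_unit K.
have uFC : F *m C' \in unitmx by rewrite unitmx_mul uF.
have -> : invmx (F *m C') = C *m invmx F.
  rewrite -[RHS]mul1mx -(mulVmx uFC) -!mulmxA (mulmxA C') K mul1mx mulmxV // mulmx1 //.
by rewrite !mulmxA.
Qed.

Lemma conj_affine (R : comNzRingType) n (C C' A : 'M[R]_n) (a b : R) : C *m C' = 1%:M ->
  C *m (b *: (A - a%:M)) *m C' = b *: (C *m A *m C' + (- a)%:M).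
Proof.
move=> K; rewrite -scalemxAr -scalemxAl mulmxBr mulmxBl mul_mx_scalar -scalemxAl K.
by rewrite scalemx1 raddfN.
Qed.

(** * Invariance of rotations under holonomy *)

Section Holonomy_of_rotations.
Context {R : realType} (M : smooth_manifold R 4) (D : linear_connection M).
Context (G : tensor02 M) (J e : M -> 'M[R]_4).
Context (pG : chart_parallel D G) (sG : forall x, (G x)^T = G x) (uG : forall x, G x \in
  unitmx).
Context (JJ : forall x, J x *m J x = - 1%:M) (JG : forall x, J x *m G x = G x *m (J x)^T).
Context (cJ : forall i x, dom i x -> mcts (nbhs x) x (fun y => chart_conj i y (J y))).
Context (re : forall x, rotation (J x) (G x) (e x)).
Context (tJ : forall c (F : R -> 'M[R]_4) bad t, transports D 0 1 c F bad -> F 0 = 1%:M ->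
  t \in `[0, 1] -> F t *m J (c t) = J (c 0) *m F t).

(** Transporting [e (c 0)] gives a continuous family of rotations along [c]. By [rotation_unique] it
    is [e (c t)] or its negative, and the Boolean records which. *)
Lemma transported_section c (F : R -> 'M[R]_4) bad : transports D 0 1 c F bad -> F 0 =
  1%:M ->
  sign_section (fun t u => rotation_sign e (c t) (c u)) `[0, 1]%classic
    (fun t => invmx (F t) *m e (c 0) *m F t == e (c t)).
Proof.
move=> tr F0; pose s t := invmx (F t) *m e (c 0) *m F t == e (c t).
change (sign_section (fun t u => rotation_sign e (c t) (c u)) `[0, 1]%classic s).
move=> t t01; have [A B _] := tr.
have FG u : u \in `[0, 1] -> F u *m G (c u) *m (F u)^T = G (c 0).
  by move=> u01; rewrite (transports_gram pG tr u01) F0 trmx1 mul1mx mulmx1.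
have uF u : u \in `[0, 1] -> F u \in unitmx.
  by move=> /FG h; have := uG (c 0); rewrite -h !unitmx_mul => /andP[/andP[]].
have rF u : u \in `[0, 1] -> rotation (J (c u)) (G (c u)) (invmx (F u) *m e (c 0) *m F u).
  by move=> u01; apply: rotation_transport (re (c 0)); [exact: uF|exact: tJ tr F0
    u01|exact: FG].
set i := chart_at (c t).
have ict : dom i (c t) by exact: dom_chart_at.
(* [F u] and the Jacobian may jump with [chart_at (c u)], but their product is continuous and
   expresses the transported rotation in the chart [i]. *)
pose W u := invmx (F u *m jac (chart_at (c u)) i (c u)) *m e (c 0) *m (F u *m jac
  (chart_at (c u)) i (c u)).
have WE u : u \in `[0, 1] -> dom i (c u) ->
    W u = chart_conj i (c u) (invmx (F u) *m e (c 0) *m F u).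
  move=> u01 icu; apply/esym; apply: conj_invmx (jacK (dom_chart_at (c u)) icu) (uF u u01).
have es u : u \in `[0, 1] -> e (c u) = if s u then invmx (F u) *m e (c 0) *m F u else -
  (invmx (F u) *m e (c 0) *m F u).
  move=> u01; rewrite /s; case: eqP => // ne.
  by have [h|h] := rotation_unique (JJ (c u)) (sG (c u)) (uG (c u)) (JG (c u)) (rF u u01)
    (re (c u)); first by case: ne.
have cW : mcts (within `[0, 1]%classic (nbhs t)) t W.
  have cF := B t i t01 ict.
  have uFi : F t *m jac (chart_at (c t)) i (c t) \in unitmx.
    rewrite unitmx_mul (uF t t01) /=.
    by have [] := mulmx1_unit (jacK (dom_chart_at (c t)) ict).
  apply: mctsM; last exact: cF.
  by apply: mctsM; [exact: mcts_inv cF uFi|exact: mcts_cst].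
pose N := chart_conj i (c t) (e (c t)).
have N2 : \tr (N *m N) = - 4 by exact: (trace_rotation_sqr re).
have NW : N = if s t then W t else - W t.
  by rewrite /N es // WE //; case: (s t); rewrite ?chart_conjN.
have cf : cts (within `[0, 1]%classic (nbhs t)) t (fun u => (if s t then -1 else 1) * \tr
  (W u *m N)).
  exact: cts_scaled_trace cW.
have ft : 0 < (if s t then -1 else 1) * \tr (W t *m N).
  move: N2; rewrite {1}NW; case: (s t) => [->|]; first by rewrite mulN1r opprK ltr0n.
  by rewrite mulNmx linearN /= => /oppr_inj ->; rewrite mul1r ltr0n.
have nf : \forall u \near t, `[0, 1]%classic u -> 0 < (if s t then -1 else 1) * \tr (W u
  *m N).
  exact: cts_near_gt cf ft.
have nd : \forall u \near t, `[0, 1]%classic u -> dom i (c u).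
  by apply: (A t t01); exact: near_dom.
apply: filterS2 nf nd => u hu du u01.
have eps_tt : rotation_sign e (c t) (c t) = true.
  by rewrite /rotation_sign -/i -/N N2 oppr_lt0 ltr0n.
rewrite eps_tt; apply: (sign_xor_branch (hu u01)).
rewrite (es u u01) WE //; last exact: du.
by case: (s u); rewrite // chart_conjN mulNmx linearN.
Qed.

Lemma rotation_holonomy x P : simply_connected M -> holonomy_group D x P ->
  P *m e x = e x *m P.
Proof.
move=> [_ sc] /holonomy_transports [c [F [bad [tr c0 c1 F0 F1]]]].
have [A _ _] := tr.
have lc : loop_at x c.
  split => //; apply/subspace_continuousP => t t01; exact: A.
have [H [cH H0 H1 Hs]] := sc x c lc.
have sec := transported_section tr F0.
have := null_homotopic_section (rotation_sign_cocycle pG sG uG JJ JG cJ re) cH H0 H1 Hs sec.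
(* The Boolean is true at 0, hence at 1, where it reads [P^-1 e P = e]. *)
rewrite F0 invmx1 mul1mx mulmx1 eqxx F1 c0 c1 => /esym/eqP h.
have i1 : 1 \in `[0, 1 : R] by rewrite in_itv /= lexx ler01.
have uP : P \in unitmx.
  have := transports_gram pG tr i1; rewrite F0 F1 c0 c1 trmx1 mul1mx mulmx1 => hG.
  by move: (uG x); rewrite -hG !unitmx_mul => /andP[/andP[]].
by rewrite -[in LHS]h !mulmxA mulmxV // mul1mx.
Qed.

End Holonomy_of_rotations.

(** * Two metrics *)

Section Two_metrics.
Context {R : realType} (M : smooth_manifold R 4) (D : linear_connection M).

(** Write [A = a + b J] at [x0] and [A = a' + b' J'] at [x]. The constant traces 4 a and 4 (a^2 -
    b^2) give a' = a and b'^2 = b^2. So (A - a) / b squares to -1 at [x] whatever the sign of b';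
    the second witness is the inverse of b. *)
Lemma parallel_complex_structure (g : 'I_2 -> tensor02 M) : connected [set: M] ->
  ~ reducible_holonomy D -> (forall l, semi_riemannian (g l)) -> independent g ->
  (forall l, chart_parallel D (g l)) ->
  exists (a b : R), b != 0 /\ forall x,
    let J := b *: (tensor_endo (g ord_max) (g ord0) x - a%:M) in J *m J = - 1%:M.
Proof.
move=> cM irr sg ind cp; have [x0 _] := manifold_nonempty ind.
pose A := tensor_endo (g ord_max) (g ord0).
have uG y : g ord0 y \in unitmx by exact: metric_matrix_unit.
have cplx x : exists a b J, [/\ b != 0, J *m J = - 1%:M & A x = a%:M + b *: J].
  have [[a Ea]|[a [b [J [b0 _ JJ EA]]]]] := division_scalar_or_complex
    (@irreducible_division _ _ M D x irr) (endo_commutant (cp ord_max) (cp ord0) (uG x));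
      last by exists a, b, J.
  have h (l : 'I_2) : [:: - a; 1]`_l = 0.
    apply: (@independent_at _ M D 2 g (g ord0) x (fun l : 'I_2 => [:: - a; 1]`_l) cM irr
      ind cp (cp ord0) uG).
    have E : g ord_max x = a *: g ord0 x.
      by rewrite -mul_scalar_mx -Ea /tensor_endo mulmxKV.
    rewrite !big_ord_recl big_ord0 addr0 /= scale1r.
    rewrite (_ : lift ord0 ord0 = ord_max); last exact/val_inj.
    by rewrite E scaleNr addNr.
  by have /eqP := h ord_max; rewrite oner_eq0.
have [a [b [J0 [b0 JJ0 E0]]]] := cplx x0.
exists a, b^-1; split; first by rewrite invr_eq0.
move=> x J; have [a' [b' [J' [b'0 JJ' E']]]] := cplx x.
have tr1 u v (K : 'M[R]_4) : K *m K = - 1%:M -> \tr (u%:M + v *: K) = 4 * u.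
  by move=> KK; rewrite linearD /= mxtrace_scalar linearZ /= trace_complex_structure //
    mulr0 addr0 mulr_natl.
have tr2 u v (K : 'M[R]_4) : K *m K = - 1%:M ->
    \tr ((u%:M + v *: K) *m (u%:M + v *: K)) = 4 * (u ^+ 2 - v ^+ 2).
  by move=> KK; rewrite (cmxM _ _ _ _ KK) tr1 // !expr2.
have [t1 t2] := endo_trace_constant cM (cp ord_max) (cp ord0) uG x x0.
move: t1 t2; rewrite -/(A x) -/(A x0) E0 E' !tr1 // !tr2 // => t1 t2.
have four : (4 : R) != 0 by rewrite pnatr_eq0.
have aa := mulfI four t1; have bb : b' ^+ 2 = b ^+ 2.
  by have := mulfI four t2; rewrite aa => /addrI /oppr_inj.
rewrite /J -/(A x) E' aa addrAC subrr add0r scalerA -scalemxAl -scalemxAr scalerA JJ'.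
by rewrite scalerN -expr2 exprMn bb exprVn mulVf ?scale1r // expf_neq0.
Qed.

Lemma two_metrics (g : 'I_2 -> tensor02 M) : simply_connected M ->
  (forall l, semi_riemannian (g l)) -> independent g -> (forall l, parallel_metric D (g
    l)) ->
  reducible_holonomy D.
Proof.
move=> sc sg ind pg; apply: contrapT => irr; have [cM _] := sc.
have [x0 _] := manifold_nonempty ind.
have cp l : chart_parallel D (g l) by apply: metric_chart_parallel => //; exact:
  (metric_smooth (sg l)).
have [a [b [b0 JJ]]] := parallel_complex_structure cM irr sg ind cp.
set G := g ord0; set T := g ord_max.
pose J x := b *: (tensor_endo T G x - a%:M).
have {}JJ x : J x *m J x = - 1%:M by exact: JJ.
have uG y : G y \in unitmx by exact: metric_matrix_unit (sg ord0).
have sG y : (G y)^T = G y by exact: metric_matrix_sym (sg ord0).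
have JG x : J x *m G x = G x *m (J x)^T.
  apply: self_adjointZ; apply: self_adjointD; first exact: (endo_self_adjoint _ (sg
    ord_max) (sg ord0)).
  by rewrite -raddfN; exact: self_adjoint_scalar.
(* The choice is made point by point, without continuity; the sign cocycle accounts for its
   jumps. *)
have [e re] : exists e : M -> 'M[R]_4, forall x, rotation (J x) (G x) (e x).
  have ex x := rotation_exists (JJ x) (sG x) (uG x) (JG x).
  by exists (fun x => sval (cid (ex x))) => x; exact: svalP (cid (ex x)).
have cJ i x : dom i x -> mcts (nbhs x) x (fun y => chart_conj i y (J y)).
  move=> ix.
  have E y : dom i y -> chart_conj i y (J y) =
      b *: (chart_tensor T i y *m invmx (chart_tensor G i y) + (- a)%:M).
    move=> iy; rewrite (chart_endo T iy (uG y)).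
    exact: conj_affine (jacK iy (dom_chart_at y)).
  apply: (mcts_near (A := fun y => b *: (chart_tensor T i y *m invmx (chart_tensor G i y)
    + (- a)%:M))).
  - by apply: filterS (near_dom ix) => y iy; rewrite E.
  - by rewrite E.
  - apply: (mctsZ (f := fun=> b)); first exact: cts_cst.
    apply: mctsD; last exact: mcts_cst.
    apply: mctsM; first exact: (chart_tensor_cts (cp ord_max) ix).
    apply: mcts_inv; first exact: (chart_tensor_cts (cp ord0) ix).
    exact: chart_tensor_unit.
have tJ c (F : R -> 'M[R]_4) bad t : transports D 0 1 c F bad -> F 0 = 1%:M ->
    t \in `[0, 1] -> F t *m J (c t) = J (c 0) *m F t.
  move=> tr F0 t01.
  have gram l : F t *m g l (c t) *m (F t)^T = g l (c 0).
    by rewrite (transports_gram (cp l) tr t01) F0 trmx1 mul1mx mulmx1.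
  have h := endo_transport (uG (c 0)) (gram ord_max) (gram ord0).
  by rewrite /J -scalemxAr -scalemxAl mulmxBr mulmxBl h scalar_mxC.
have dH := @irreducible_division _ _ M D x0 irr.
apply: (rotation_commutant (JJ x0) (uG x0) (JG x0) (re x0) _ _ dH).
- apply: commutantZ; apply: commutantB; last exact: commutant_scalar.
  exact: (endo_commutant (cp ord_max) (cp ord0) (uG x0)).
- by move=> P hP; exact: (rotation_holonomy (cp ord0) sG uG JJ JG cJ re tJ sc hP).
Qed.

End Two_metrics.

Theorem theorem3 (R : realType) :
  (forall (M : smooth_manifold R 4) (D : linear_connection M)
      (g : 'I_2 -> tensor02 M),
    simply_connected M ->
    (forall l, semi_riemannian (g l)) ->
    independent g ->
    (forall l, parallel_metric D (g l)) ->
    reducible_holonomy D)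
  /\
  (forall (M : smooth_manifold R 4) (D : linear_connection M)
      (g : 'I_3 -> tensor02 M),
    connected [set: M] ->
    (forall l, semi_riemannian (g l)) ->
    independent g ->
    (forall l, parallel_metric D (g l)) ->
    reducible_holonomy D).
Proof. by split=> M D g; [exact: two_metrics|exact: three_metrics]. Qed.
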